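(* Let $d$ be an odd integer and let $\Lambda$ be a set. The ribbon graph complex with leaves $\mathcal{RG}^d_{\Lambda}\llbracket\gamma\rrbracket$ decorated by $\Lambda$, equipped with its product, the operator $-d+\nabla+\delta_i+\gamma\delta_e$ and the bracket $\{\_,\_\}$ induced by gluing leaves (all defined in the context), is a $(d-2)$-twisted Beilinson–Drinfeld algebra over $k\llbracket\gamma\rrbracket$.
   Context: Conventions: $k$ is a field of characteristic $0$; differentials have degree $+1$; $V[1]$ is concentrated in degree $-1$ if $V$ is concentrated in degree $0$; Koszul signs; $V^\vee$ is the linear dual; $Sym\,V=\bigoplus_{n\ge 0}(V^{\otimes n})_{S_n}$. BD algebras: for $r$ odd, an $r$-twisted Beilinson–Drinfeld (BD) algebra over $k\llbracket\mu\rrbracket$ is a graded commutative unital $k\llbracket\mu\rrbracket$-algebra with a $k\llbracket\mu\rrbracket$-linear Poisson bracket $\{\_,\_\}$ of degree $r$ and a $k\llbracket\mu\rrbracket$-linear map $d$ of degree $1$ with $d^2=0$ and $d(ab)=d(a)b+(-1)^{|a|}a\,d(b)+\mu\{a,b\}$. Here $|\mu|=1-r$; one also allows the product to have even degree $m$, in which case $|\mu|=1-r+m$. Ribbon graphs: a ribbon graph is a finite graph, possibly with leaves (half-edges not belonging to an internal edge), all of whose vertices have valence at least $3$, with a cyclic ordering of the half-edges at each vertex. Let $\sigma_0$ be the permutation of half-edges given by the cyclic orderings and $\sigma_1$ the involution whose fixed points are leaves and whose 2-cycles are internal edges. The faces are the cycles of $\sigma_0^{-1}\sigma_1$. The leaves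 lying in a face are cyclically ordered; a free boundary of that face is a pair of consecutive leaves in that order, and a face without leaves counts as one free boundary. A $\Lambda$-coloring is a map from the set of free boundaries to $\Lambda$. An orientation is an ordering of the internal edges. $\mathcal{RG}^{\Lambda}_{c,\bullet}$ is the vector space generated by isomorphism classes of connected $\Lambda$-colored oriented ribbon graphs, modulo the relation that reversing the orientation (odd permutation of edges) is multiplication by $-1$, graded by the number of internal edges, with differential $\partial\Gamma=\sum_e\Gamma/e$, the sum over internal edges $e$ that are not loops, $\Gamma/e$ being the graph with $e$ contracted (with induced cyclic order, coloring and orientation). With $\gamma$ of degree $6-2d$ set $$\mathcal{RG}^d_\Lambda\llbracket\gamma\rrbracket:=Sym\big((\mathcal{RG}^{\Lambda}_{c,\bullet})^\vee[2d-6]\big)\llbracket\gamma\rrbracket[3-d],$$ with $d$ induced by the dual of $\partial$; its product is that of the (shifted) symmetric algebra and has even degree because of the shift. In the dual basis of connected graphs: $\{\Gamma_1,\Gamma_2\}=\sum\Gamma_1\cup_{l_1,l_2}\Gamma_2$, the sum over isomorphism classes of graphs obtained by gluing one leaf of $\Gamma_1$ to one leaf of $\Gamma_2$ (where the free boundaries that get merged have the same color), oriented by: edges of $\Gamma_1$, then the new edge, then edges of $\Gamma_2$. $\nabla\Gamma=\sum\circ_{l_1,l_2}\Gamma$, the sum over isomorphism classes of graphs obtained by gluing together two leaves of $\Gamma$ lying in the same face; $\delta_i\Gamma$ is the analogous sum over gluings of two leaves lying in different faces; in both cases the new edge is put first in the orientation. After shifting, $\nabla$ and $\delta_i$ are extended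 as derivations, $\{\_,\_\}$ is extended $\gamma$-linearly by the Leibniz rule, and $\delta_e$ is the Chevalley–Eilenberg differential on the symmetric algebra associated to the shifted Lie bracket $\{\_,\_\}$.
   Formalization: In the dual basis, the bracket, ∇ and δ_i count each glued graph once for every internal edge (for the bracket, every directed edge) realising the gluing, not once per isomorphism class (Jacobi would fail); the degree-shifted bracket carries the sign (-1)^{|a|}. *)

(* Defs.v *)
From HB Require Import structures.
From mathcomp Require Import all_boot all_order all_algebra.
From mathcomp Require Import boolp classical_sets functions.
From mathcomp Require Import freeg.

Set Implicit Arguments.
Unset Strict Implicit.
Unset Printing Implicit Defensive.

Import GRing.Theory.
Local Open Scope ring_scope.
Local Open Scope quotient_scope.

(** * Linear algebra *)

Definition ksign (R : pzRingType) (n : int) : R := (-1) ^+ `|n|%N.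
Arguments ksign {R} n.

Section Span.
Variables (k : pzRingType) (V : lmodType k) (S : V -> Prop).

Definition lspan : {pred V} := fun x => `[< exists s : seq (k * V),
  (forall p, p \in s -> S p.2) /\ x = \sum_(p <- s) p.1 *: p.2 >].

Lemma spanP x : (x \in lspan) <-> exists s : seq (k * V),
  (forall p, p \in s -> S p.2) /\ x = \sum_(p <- s) p.1 *: p.2.
Proof. by split=> [/asboolP|h]; last exact/asboolP. Qed.

Lemma spanZ a x : x \in lspan -> a *: x \in lspan.
Proof.
case/spanP => s [Ss ->]; apply/spanP.
exists [seq (a * p.1, p.2) | p <- s]; split=> [_ /mapP[q /Ss Sq ->]|] //.
by rewrite scaler_sumr big_map; apply: eq_bigr => p _; rewrite scalerA.
Qed.

Lemma span_zmod_closed : zmod_closed lspan.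
Proof.
split=> [|x y]; first by apply/spanP; exists [::]; split; rewrite ?big_nil.
move=> /spanP[s [Ss ->]] /(spanZ (-1)) /spanP[t [St yE]].
apply/spanP; exists (s ++ t); split=> [p|].
  by rewrite mem_cat => /orP[/Ss|/St].
by rewrite big_cat /= -yE scaleN1r.
Qed.

HB.instance Definition _ := GRing.isZmodClosed.Build V lspan span_zmod_closed.

Definition quotmod := Quotient.quot lspan.

HB.instance Definition _ := GRing.Zmodule.on quotmod.

HB.instance Definition _ : EqQuotient V (Quotient.equiv lspan) quotmod :=
  EqQuotient.on quotmod.

Definition qscale (a : k) (x : quotmod) : quotmod := \pi_quotmod (a *: repr x).

Lemma pi_qscale a x : qscale a (\pi_quotmod x) = \pi_quotmod (a *: x).
Proof.
apply/eqP; rewrite /qscale -Quotient.idealrBE -scalerBr; apply: spanZ.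
by rewrite Quotient.idealrBE reprK.
Qed.

Lemma quotmodW (P : quotmod -> Prop) :
  (forall x, P (\pi_quotmod x)) -> forall x, P x.
Proof. by move=> h x; rewrite -[x]reprK. Qed.

Lemma qpiD x y : \pi_quotmod (x + y) = \pi_quotmod x + \pi_quotmod y.
Proof. exact: Quotient.pi_add. Qed.

Lemma qscaleA a b x : qscale a (qscale b x) = qscale (a * b) x.
Proof. by elim/quotmodW: x => x; rewrite !pi_qscale scalerA. Qed.

Lemma qscale1 : left_id 1 qscale.
Proof. by elim/quotmodW => x; rewrite pi_qscale scale1r. Qed.

Lemma qscaleDr : right_distributive qscale +%R.
Proof.
move=> a; elim/quotmodW => x; elim/quotmodW => y.
by rewrite -qpiD !pi_qscale scalerDr qpiD.
Qed.

Lemma qscaleDl x : {morph qscale^~ x : a b / a + b}.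
Proof. by move=> a b; elim/quotmodW: x => x; rewrite !pi_qscale scalerDl qpiD. Qed.

HB.instance Definition _ := GRing.Zmodule_isLmodule.Build k quotmod
  qscaleA qscale1 qscaleDr qscaleDl.
End Span.

(* Series are stored by their coefficients; the product is the Cauchy product.
   No topology is involved, and the coefficients may lie in any module. *)
Definition powser (M : Type) : Type := nat -> M.

HB.instance Definition _ (M : zmodType) := GRing.Zmodule.copy (powser M) (nat -> M).

Section PowerSeries.
Variable k : comNzRingType.

Definition psact (M : lmodType k) (p : powser k) (x : powser M) : powser M :=
  fun n => \sum_(i < n.+1) p i *: x (n - i)%N.

Definition psC (c : k) : powser k := fun n => if n is 0 then c else 0.
Definition psX : powser k := fun n => (n == 1)%N%:R.

Definition psmul (p q : powser k) : powser k := psact p (q : powser k^o).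

Lemma triangular_sum (M : nmodType) (G : nat -> nat -> M) n :
  \sum_(i < n.+1) \sum_(j < (n - i).+1) G i j
    = \sum_(l < n.+1) \sum_(i < l.+1) G i (l - i)%N.
Proof.
elim: n => [|n IHn]; first by rewrite !big_ord1.
rewrite [RHS]big_ord_recr -IHn /= big_ord_recr /= subnn big_ord1.
rewrite [X in _ = _ + X]big_ord_recr /= subnn addrA; congr (_ + _).
rewrite -big_split; apply: eq_bigr => -[i lt_in] _ /=.
by rewrite subSn -1?ltnS // big_ord_recr.
Qed.

Lemma psactA (M : lmodType k) p q (x : powser M) :
  psact p (psact q x) = psact (psmul p q) x.
Proof.
apply/funext => n; rewrite /psact /psmul /psact.
under eq_bigr do rewrite scaler_sumr.
rewrite (triangular_sum (fun i j => p i *: (q j *: x (n - i - j)%N))).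
apply: eq_bigr => -[l lt_l] _ /=; rewrite scaler_suml.
apply: eq_bigr => -[i lt_i] _ /=.
by rewrite scalerA -subnDA subnKC // -ltnS.
Qed.

Lemma psact1 (M : lmodType k) (x : powser M) : psact (psC 1) x = x.
Proof.
apply/funext => n; rewrite /psact big_ord_recl /= subn0 scale1r big1 ?addr0 //.
by move=> i _; rewrite scale0r.
Qed.

Lemma psactDr (M : lmodType k) : right_distributive (@psact M) +%R.
Proof.
move=> p x y; apply/funext => n; rewrite /psact -[RHS]big_split.
by apply: eq_bigr => i _; exact: scalerDr.
Qed.

Lemma psactDl (M : lmodType k) (x : powser M) : {morph (@psact M)^~ x : p q / p + q}.
Proof.
move=> p q; apply/funext => n; rewrite /psact -[RHS]big_split.
by apply: eq_bigr => i _; exact: scalerDl.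
Qed.

Lemma psmulA : associative psmul.
Proof. by move=> p q r; exact: (psactA (M := k^o)). Qed.

Lemma psmulC : commutative psmul.
Proof.
move=> p q; apply/funext => n; rewrite /psmul /psact.
rewrite (reindex_inj rev_ord_inj) /=; apply: eq_bigr => -[i lt_in] _ /=.
by rewrite subSS subKn -1?ltnS //; exact: mulrC.
Qed.

Lemma psmul1 : left_id (psC 1) psmul.
Proof. by move=> p; rewrite /psmul (psact1 (M := k^o)). Qed.

Lemma psmulDl : left_distributive psmul +%R.
Proof. by move=> p q r; exact: (psactDl (M := k^o)). Qed.

Lemma psC1_neq0 : psC 1 != 0.
Proof.
by apply/eqP => /(congr1 (fun p : powser k => p 0%N))/eqP; rewrite oner_eq0.
Qed.

HB.instance Definition _ := GRing.Zmodule_isComNzRing.Build (powser k)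
  psmulA psmulC psmul1 psmulDl psC1_neq0.

HB.instance Definition _ (M : lmodType k) :=
  GRing.Zmodule_isLmodule.Build (powser k) (powser M)
    (@psactA M) (@psact1 M) (@psactDr M) (@psactDl M).
End PowerSeries.

Section Presentation.
Variables (k : fieldType) (T : choiceType) (rel : {freeg T / k} -> Prop).

Definition present : lmodType k := quotmod rel.

Definition cls (t : T) : present := \pi_(quotmod rel) << t >>.

(* The linear map with value [f t] at [cls t]; it is computed on a
   representative, and is independent of it when [f] kills the relations. *)
Definition lin_lift (W : lmodType k) (f : T -> W) (x : present) : W :=
  fglift f (repr (x : quotmod rel)).

HB.instance Definition _ (W : lmodType k) (f : T -> W) :=
  GRing.isZmodMorphism.Build {freeg T / k} W (fglift f) (lift_is_additive f).

Lemma fgliftZ (W : lmodType k) (f : T -> W) : scalable (fglift f).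
Proof.
move=> a D; rewrite -[in RHS](freeg_sumE D) -[a *: D]/(fgscale a D) /fgscale.
rewrite !raddf_sum.
by apply: eq_bigr => z _; rewrite /= !liftU scalerA.
Qed.

Lemma lin_lift_cls (W : lmodType k) (f : T -> W) t :
  (forall r, rel r -> fglift f r = 0) -> lin_lift f (cls t) = f t.
Proof.
move=> f0.
have /spanP[s [rels sE]] : repr (cls t : quotmod rel) - << t >> \in lspan rel.
  by rewrite Quotient.idealrBE reprK.
apply/eqP; rewrite -subr_eq0 /lin_lift -[X in _ - X]scale1r -(liftU f).
rewrite -raddfB sE raddf_sum big_seq big1 // => p /rels/f0 /= fp0.
by rewrite fgliftZ fp0 scaler0.
Qed.
End Presentation.

(** * Graded modules *)

(* An element of [V] need not be homogeneous: the graded module consists of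
   the submodules [ghom V i], for [i : int]. *)
Record gmod (R : pzRingType) := Gmod {
  gcar :> lmodType R;
  ghom : int -> gcar -> Prop }.

Definition gshift (R : pzRingType) (n : int) (V : gmod R) : gmod R :=
  @Gmod R V (fun i x => ghom (i + n) x).

Definition gdual (k : fieldType) (V : gmod k) : gmod k :=
  @Gmod k (V -> k^o) (fun i phi => linear phi /\
    forall j x, j != - i -> ghom j x -> phi x = 0).

(* The variable has degree [e]. *)
Definition gpowser (k : fieldType) (e : int) (V : gmod k) : gmod (powser k) :=
  @Gmod (powser k) (powser V)
    (fun n x => forall j : nat, ghom (n - j%:Z * e) (x j)).

Definition psdeg (k : fieldType) (e a : int) (p : powser k) : Prop :=
  forall j : nat, p j != 0 -> a = j%:Z * e.

(* Graded module over k[[mu]], where mu has degree [e]. *)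
Record is_graded (k : fieldType) (e : int) (A : gmod (powser k)) : Prop := {
  gr_zero : forall n, ghom n (0 : A);
  gr_add : forall n (x y : A), ghom n x -> ghom n y -> ghom n (x + y);
  gr_scale : forall a n (p : powser k) (x : A),
    psdeg e a p -> ghom n x -> ghom (a + n) (p *: x);
  gr_indep : forall (s : seq int) (x : int -> A), uniq s ->
    (forall n, ghom n (x n)) -> \sum_(n <- s) x n = 0 ->
    forall n, n \in s -> x n = 0 }.

(** * Beilinson-Drinfeld algebras *)

(* [r] is the twist, [m] the degree of the product, so mu has degree
   [1 - r + m] and the unit has degree [- m].  The relation [bd_rel] makes the
   bracket graded symmetric, [br a b = (-1)^(|a||b|) br b a]; it is a Poisson
   bracket of odd degree [r] in the sense that [(-1)^|a| br a b] is a graded Lie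
   bracket for the degrees [|a| + r], and [bd_sym], [bd_jacobi] are the axioms of
   the latter rewritten for [br]. *)
Record is_BD_algebra (k : fieldType) (r m : int) (A : gmod (powser k))
    (mul : A -> A -> A) (one : A) (br : A -> A -> A) (d : A -> A) : Prop := {
  bd_twist : odd `|r|%N;
  bd_even : ~~ odd `|m|%N;
  bd_graded : is_graded (1 - r + m) A;

  bd_mul_linl : forall b, linear (fun a => mul a b);
  bd_mul_linr : forall a, linear (mul a);
  bd_mul_deg : forall i j a b, ghom i a -> ghom j b -> ghom (i + j + m) (mul a b);
  bd_mulA : associative mul;
  bd_mulC : forall i j a b, ghom i a -> ghom j b ->
    mul a b = ksign (i * j) *: mul b a;
  bd_one_deg : ghom (- m) one;
  bd_mul1 : left_id one mul;

  bd_br_linl : forall b, linear (fun a => br a b);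
  bd_br_linr : forall a, linear (br a);
  bd_br_deg : forall i j a b, ghom i a -> ghom j b -> ghom (i + j + r) (br a b);
  bd_sym : forall i j a b, ghom i a -> ghom j b ->
    br a b = ksign (i * j) *: br b a;
  bd_jacobi : forall i j l a b c, ghom i a -> ghom j b -> ghom l c ->
    br a (br b c) = ksign (i + r) *: br (br a b) c
                    + ksign ((i + r) * (j + r)) *: br b (br a c);
  bd_leibniz : forall i j l a b c, ghom i a -> ghom j b -> ghom l c ->
    br a (mul b c) = mul (br a b) c + ksign ((i + r) * j) *: mul b (br a c);

  bd_d_lin : linear d;
  bd_d_deg : forall i a, ghom i a -> ghom (i + 1) (d a);
  bd_d_sq : forall a, d (d a) = 0;
  bd_rel : forall i a b, ghom i a ->
    d (mul a b) = mul (d a) b + ksign i *: mul a (d b) + psX k *: br a b }.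

(** * Symmetric algebras *)

Section Sym.
Variables (k : fieldType) (V : gmod k).

Definition word : choiceType := seq (int * V).
Implicit Types (u v w : word) (i j : int) (x y : V).

Definition hword w := all (fun l : int * V => `[< ghom l.1 l.2 >]) w.
Definition wdeg w : int := \sum_(l <- w) l.1.

(* The sum over n of the S_n-coinvariants of the n-th tensor powers of [V].
   Words [(i1, v1), ..., (in, vn)] with [vp] of degree [ip] stand for the
   monomials v1...vn; any other word is set to zero, so that monomials can be
   written without side conditions. *)
Inductive sym_rel : {freeg word / k} -> Prop :=
| sym_bad w : ~~ hword w -> sym_rel << w >>
| sym_lin u v i a x y : hword (u ++ [:: (i, x), (i, y) & v]) ->
    sym_rel (<< u ++ (i, a *: x + y) :: v >>
             - a *: << u ++ (i, x) :: v >> - << u ++ (i, y) :: v >>)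
| sym_swap u v i j x y : hword (u ++ [:: (i, x), (j, y) & v]) ->
    sym_rel (<< u ++ [:: (i, x), (j, y) & v] >>
             - ksign (i * j) *: << u ++ [:: (j, y), (i, x) & v] >>).

Definition mon (w : word) : present sym_rel := cls sym_rel w.

Definition Sym : gmod k := @Gmod k (present sym_rel)
  (fun n s => s \in lspan (fun t => exists w, [/\ hword w, wdeg w = n & t = mon w])).

Definition sym_one : Sym := mon [::].

Definition sym_mul (s t : Sym) : Sym :=
  lin_lift (rel := sym_rel) (fun u =>
    lin_lift (rel := sym_rel) (fun w => mon (u ++ w)) t) s.

(* Extension of a map of degree 1 on [V] as a derivation. *)
Definition der (q : V -> V) : Sym -> Sym := lin_lift (rel := sym_rel) (fun w =>
  if hword w then
    \sum_(p < size w) let l := nth (0, 0) w p in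
      ksign (wdeg (take p w)) *: mon (take p w ++ (l.1 + 1, q l.2) :: drop p.+1 w)
  else 0).

Section Bracket.
(* [lie] is a bracket on [V] of odd degree [c], antisymmetric and Jacobi for the
   degrees shifted by one; the associated symmetric bracket is
   [x, y |-> (-1)^|x| lie x y]. *)
Variables (c : int) (lie : V -> V -> V).

(* For [p < q < size w]: contract the letters [p] and [q] of [w], after moving
   them to the front. *)
Definition contract_letters w (p q : nat) : Sym :=
  let l := nth (0, 0) w p in
  let l' := nth (0, 0) w q in
  let u := take p w in
  let v := drop p.+1 (take q w) in
  ksign (l.1 * wdeg u + l'.1 * (wdeg u + wdeg v) + l.1) *:
    mon ((l.1 + l'.1 + c, lie l.2 l'.2) :: u ++ v ++ drop q.+1 w).

Definition ce : Sym -> Sym := lin_lift (rel := sym_rel) (fun w =>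
  if hword w then
    \sum_(q < size w) \sum_(p < q) contract_letters w p q
  else 0).

(* The extension of the symmetric bracket as a biderivation. *)
Definition poisson (s t : Sym) : Sym :=
  lin_lift (rel := sym_rel) (fun u => lin_lift (rel := sym_rel) (fun w =>
  if hword (u ++ w) then
    \sum_(p < size u) \sum_(q < size w) contract_letters (u ++ w) p (size u + q)
  else 0) t) s.
End Bracket.
End Sym.

(** * Ribbon graphs *)

Record rgraph (L : Type) := RGraph {
  lab : nat;
  hes : {set 'I_lab};
  s0 : 'I_lab -> 'I_lab;
  s1 : 'I_lab -> 'I_lab;
  col : 'I_lab -> L;
  ori : seq {set 'I_lab} }.
Arguments s0 {L} r _.
Arguments s1 {L} r _.
Arguments col {L} r _.

HB.instance Definition _ (L : Type) := gen_eqMixin (rgraph L).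
HB.instance Definition _ (L : Type) := gen_choiceMixin (rgraph L).

Section Graphs.
Variable L : Type.
Implicit Type G : rgraph L.

Definition internal_edge G (e : {set 'I_(lab G)}) : bool :=
  [exists h in hes G, (s1 G h != h) && (e == [set h; s1 G h])].

Definition face G (h : 'I_(lab G)) : 'I_(lab G) := finv (s0 G) (s1 G h).

Definition adjacent G : rel 'I_(lab G) := fun h h' => (h' == s0 G h) || (h' == s1 G h).

(* Half-edges are the labels in [hes]; values at other labels are irrelevant.  The
   vertices are the cycles of [s0], so isolated vertices do not occur.  Walking
   along the cycles of [face] one crosses from one free boundary to the next
   exactly when leaving a leaf; hence a free boundary is a maximal run of
   half-edges ending at a leaf (or a whole face without leaves), and a colouring
   of the free boundaries is a function on half-edges that is constant on each
   run, which is [rg_col]. *)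
Record connected_rg G : Prop := {
  rg_s0 : {in hes G, forall h, s0 G h \in hes G};
  rg_s0_inj : {in hes G &, injective (s0 G)};
  rg_s1 : {in hes G, forall h, s1 G h \in hes G};
  rg_s1K : {in hes G, involutive (s1 G)};
  rg_valence : {in hes G, forall h, (2 < order (s0 G) h)%N};
  rg_col : {in hes G, forall h, s1 G h != h -> col G (face h) = col G h};
  rg_ori_uniq : uniq (ori G);
  rg_ori : forall e, (e \in ori G) = internal_edge e;
  rg_nonempty : hes G != finset.set0;
  rg_conn : {in hes G &, forall h h', connect (@adjacent G) h h'} }.

Definition reorient G (s : seq {set 'I_(lab G)}) : rgraph L :=
  @RGraph L (lab G) (hes G) (s0 G) (s1 G) (col G) s.

Definition rg_iso G G' : Prop := exists f : 'I_(lab G) -> 'I_(lab G'),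
  [/\ {in hes G &, injective f}, f @: hes G = hes G',
      {in hes G, forall h, [/\ f (s0 G h) = s0 G' (f h), f (s1 G h) = s1 G' (f h)
                             & col G' (f h) = col G h]}
    & ori G' = [seq f @: e | e : {set _} <- ori G]].

(* G/e, for an edge [e] which is not a loop. *)
Definition contract G (e : {set 'I_(lab G)}) : rgraph L :=
  @RGraph L (lab G) (hes G :\: e)
    (fun x => if s0 G x \in e then s0 G (s1 G (s0 G x)) else s0 G x)
    (s1 G) (col G) (rem e (ori G)).

(* The graph from which G is obtained by gluing two leaves to form [e].  Its free
   boundaries keep their colours: when the two leaves are glued back, those that
   get merged have the same colour. *)
Definition cut G (e : {set 'I_(lab G)}) : rgraph L :=
  @RGraph L (lab G) (hes G) (s0 G) (fun x => if x \in e then x else s1 G x)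
    (col G) (rem e (ori G)).

Definition glue G (h h' : 'I_(lab G)) : rgraph L :=
  @RGraph L (lab G) (hes G) (s0 G)
    (fun x => if x == h then h' else if x == h' then h else s1 G x)
    (col G) ([set h; h'] :: ori G).

Definition component G (h : 'I_(lab G)) : rgraph L :=
  let H := [set x in hes G | connect (@adjacent G) h x] in
  @RGraph L (lab G) H (s0 G) (s1 G) (col G) [seq e : {set _} <- ori G | e \subset H].

Definition is_loop G (e : {set 'I_(lab G)}) : bool :=
  [forall h in e, forall h' in e, fconnect (s0 G) h h'].

Definition leaves_in_same_face G (e : {set 'I_(lab G)}) : bool :=
  [forall h in e, forall h' in e, fconnect (@face (cut e)) h h'].

Definition is_bridge G (e : {set 'I_(lab G)}) : bool :=
  ~~ [forall h in e, forall h' in e, connect (@adjacent (cut e)) h h'].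

Lemma glue_cut G (h : 'I_(lab G)) : connected_rg G -> h \in hes G ->
  s1 G h != h ->
  @glue (cut [set h; s1 G h]) h (s1 G h)
    = reorient ([set h; s1 G h] :: rem [set h; s1 G h] (ori G)).
Proof.
move=> cG hG leafN; congr RGraph; apply/funext => x /=.
rewrite !inE; have [->//|xh] := eqVneq x h.
by have [->|//] := eqVneq x (s1 G h); rewrite (rg_s1K cG).
Qed.
End Graphs.

(* The number of pairs of entries of [s] that occur in the opposite order in [t],
   and the sign of the permutation relating two orderings of the same edges. *)
Fixpoint inversions (X : eqType) (t s : seq X) : nat :=
  if s is x :: s' then
    (count (fun y => (index y t < index x t)%N) s' + inversions t s')%N
  else 0%N.

Definition osgn (R : pzRingType) (X : eqType) (s t : seq X) : R :=
  (-1) ^+ inversions t s.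
Arguments osgn {R X} s t.

(** * The ribbon graph complex *)

Section RibbonComplex.
Variables (k : fieldType) (L : Type).
Implicit Type G : rgraph L.

(* As for words, data that are not a connected ribbon graph are set to zero. *)
Inductive rg_rel : {freeg (rgraph L) / k} -> Prop :=
| rg_bad G : ~ connected_rg G -> rg_rel << G >>
| rg_isom G G' : connected_rg G -> connected_rg G' -> rg_iso G G' ->
    rg_rel (<< G >> - << G' >>)
| rg_orient G s : connected_rg G -> perm_eq s (ori G) ->
    rg_rel (<< reorient s >> - osgn s (ori G) *: << G >>).

Definition rg (G : rgraph L) : present rg_rel := cls rg_rel G.

(* A graph with n internal edges has degree -n, contracting an edge having
   degree +1. *)
Definition RG : gmod k := @Gmod k (present rg_rel)
  (fun i x => x \in lspan (fun y => exists G,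
     [/\ connected_rg G, - (size (ori G))%:Z = i & y = rg G])).

(* The sum over the internal edges satisfying [P] of the graphs obtained by
   performing [op] on an edge moved to the front of the orientation. *)
Definition edge_sum (P : forall G, {set 'I_(lab G)} -> bool)
    (op : forall G, {set 'I_(lab G)} -> rgraph L) : RG -> RG :=
  lin_lift (rel := rg_rel) (fun G => if `[< connected_rg G >] then
    \sum_(e <- ori G | P G e) osgn (ori G) (e :: rem e (ori G)) *: rg (op G e)
  else 0).

Definition boundary : RG -> RG :=
  edge_sum (fun G e => ~~ is_loop e) (@contract L).

Definition RGdual : gmod k := gdual RG.

Definition rg_d (phi : RGdual) : RGdual := phi \o boundary.

(* The coefficient of G in the sum of the graphs glued from a functional [phi] is
   the sum of the values of [phi] at the ways of writing G as a gluing, i.e. at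
   the graphs G cut along an edge ([glue_cut]).  If cutting disconnects G, then
   [rg] of the result is zero. *)
Definition nabla (phi : RGdual) : RGdual :=
  phi \o edge_sum (@leaves_in_same_face L) (@cut L).

Definition delta_i (phi : RGdual) : RGdual :=
  phi \o edge_sum (fun G e => ~~ leaves_in_same_face e) (@cut L).

(* Likewise, cutting the bridge [h - s1 h] into the components of [h] and of
   [s1 h].  Each bridge occurs twice, according to which side is fed to [phi]. *)
Definition rg_lie (phi psi : RGdual) : RGdual :=
  lin_lift (rel := rg_rel) (W := k^o) (fun G => if `[< connected_rg G >] then
    \sum_(h in hes G | s1 G h != h)
      let e := [set h; s1 G h] in
      let G1 := @component L (cut e) h in
      let G2 := @component L (cut e) (s1 G h) in
      if is_bridge e then
        osgn (ori G) (ori G1 ++ e :: ori G2) * (phi (rg G1) * psi (rg G2))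
      else 0
  else 0).

Variable d : int.

Definition deg_gamma : int := 6 - 2 * d.

(* The dual, shifted by [2d-6]; [rg_lie], of degree 1 on the dual, has degree
   [2d-5] on the shift. *)
Definition RGs : gmod k := gshift (2 * d - 6) RGdual.

Definition RG_Sym : gmod k := Sym RGs.

Definition RG_alg : gmod (powser k) :=
  gshift (3 - d) (gpowser deg_gamma RG_Sym).

Definition RG_one : RG_alg := fun n => if n is 0%N then sym_one RGs else 0.

Definition RG_mul (x y : RG_alg) : RG_alg :=
  fun n => \sum_(i < n.+1) @sym_mul k RGs (x i) (y (n - i)%N).

Definition RG_bracket (x y : RG_alg) : RG_alg :=
  fun n => \sum_(i < n.+1)
    @poisson k RGs (2 * d - 5) rg_lie (x i) (y (n - i)%N).

Definition RG_diff (x : RG_alg) : RG_alg := fun n =>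
  - @der k RGs rg_d (x n) + @der k RGs nabla (x n) + @der k RGs delta_i (x n)
  + (if n is n'.+1 then @ce k RGs (2 * d - 5) rg_lie (x n') else 0).
End RibbonComplex.

(* Main.v *)
(** On Sym V, with V the shifted dual of the connected ribbon graphs, let D be the
    derivation extending -d + nabla + delta_i.  Then D + gamma delta_e is a BD
    operator as soon as gluing leaves is an odd Lie bracket on V of which
    -d + nabla + delta_i is a derivation of square zero: delta_e fails to be a
    derivation by exactly the Poisson bracket, and every other identity needed
    between D, delta_e and the bracket is itself the vanishing of a derivation, so
    that it suffices to check it on V.

    On V, -d + nabla + delta_i is the transpose of "cut any edge" minus "contract any
    edge", and all identities compare the two orders in which two edges of one graph
    can be treated.  Exchanging two edges changes the orientation by -1, hence the
    square is zero.  For Jacobi, cutting along two bridges leaves a chain of three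
    pieces; each of the three double brackets is a sum over chains, once for either
    piece at the end, and reversing chains matches them.  For the derivation
    property, an edge to be cut or contracted lies on one side of the bridge to be
    cut.  The only unmatched terms come from pairs of edges which are not bridges,
    but which disconnect the graph when both are cut; there the two edges play the
    same role, so that the terms cancel in pairs. *)

(* The operations act on a dual, so gluing is read backwards: every identity becomes a finite sum
   over edges or half-edges of one fixed graph, and all graphs obtained from it keep its labels.
   [nabla] and [delta_i] are never treated separately, because whether the leaves left by an edge
   lie in one face can change when another edge is cut, while cutting an arbitrary edge knows
   nothing of faces.

   Signs are the second obstacle. A functional of degree i vanishes on graphs that do not have
   exactly i edges, so sizes of pieces can be traded for degrees, and each sign is that of a
   permutation of a few blocks of edges. The even shift 2d-6 changes no sign and turns the bracket
   of degree 1 into one of odd degree 2d-5; gamma makes up the difference to 1, and the shift 3-d,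
   even as d is odd, yields the twist (3-d)+(2d-5) = d-2.

   Since [Sym] and [RG] are quotients of words and graphs, each operation must first be shown to
   respect the relations. Derivations and [ce] do so by a recursion on the first letter, the Poisson
   bracket by being a derivation in either argument. *)
From HB Require Import structures.
From mathcomp Require Import all_boot all_order all_algebra.
From mathcomp Require Import boolp freeg.
From mathcomp Require Import ring.
Require Import Defs.
Set Implicit Arguments.
Unset Strict Implicit.
Unset Printing Implicit Defensive.
Import GRing.Theory.
Local Open Scope ring_scope.
Local Open Scope quotient_scope.

(** * Signs and presented modules *)

(* [zmod] decides identities between additive combinations in any [zmodType], where
   [ring] is not available: terms are compared by their integer coefficients. *)
Inductive zexp := ZVar of nat | ZZero | ZAdd of zexp & zexp | ZOpp of zexp.

Section Zexp.
Variable V : zmodType.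

Fixpoint zeval (env : seq V) e := match e with
  | ZVar n => env`_n | ZZero => 0
  | ZAdd a b => zeval env a + zeval env b | ZOpp a => - zeval env a end.

Fixpoint zcoef e n : int := match e with
  | ZVar m => (m == n)%:R | ZZero => 0
  | ZAdd a b => zcoef a n + zcoef b n | ZOpp a => - zcoef a n end.

Fixpoint zbound N e := match e with
  | ZVar m => (m < N)%N | ZZero => true
  | ZAdd a b => zbound N a && zbound N b | ZOpp a => zbound N a end.

Lemma zevalE env e : zbound (size env) e ->
  zeval env e = \sum_(n < size env) env`_n *~ zcoef e n.
Proof.
elim: e => [m|_|a IHa b IHb|a IHa] /=.
- move=> lt_m; rewrite (bigD1 (Ordinal lt_m)) //= eqxx mulr1z big1 ?addr0 //.
  by move=> i; rewrite -val_eqE eq_sym => /negPf/= ->; rewrite mulr0z.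
- by rewrite big1 // => i _; rewrite mulr0z.
- case/andP=> /IHa-> /IHb->; rewrite -big_split /=.
  by apply: eq_bigr => i _; rewrite mulrzDr.
- by move/IHa->; rewrite -sumrN; apply: eq_bigr => i _; rewrite mulrNz.
Qed.

Definition zcheck N a b :=
  [&& zbound N a, zbound N b & all (fun n => zcoef a n == zcoef b n) (iota 0 N)].

Lemma zcheckP env a b : zcheck (size env) a b -> zeval env a = zeval env b.
Proof.
case/and3P=> /zevalE-> /zevalE-> /allP ab; apply: eq_bigr => i _.
by congr (_ *~ _); apply/eqP/ab; rewrite mem_iota ltn_ord.
Qed.
End Zexp.

(** Atoms are compared with [unify], hence up to conversion. The inner [match goal] lets this tactic
    run while a term is being built; its failure makes the outer one try the rest of [env]. *)
Ltac zlookup x env :=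
  lazymatch env with
  | nil => constr:(@None nat)
  | ?y :: ?env' =>
    match goal with
    | _ => let _ := match goal with _ => unify x y end in constr:(Some 0%N)
    | _ => let r := zlookup x env' in
           lazymatch r with
           | Some ?n => constr:(Some (S n))
           | None => constr:(@None nat)
           end
    end
  end.

Ltac zatoms t env :=
  lazymatch t with
  | 0 => env
  | GRing.add ?a ?b => let env := zatoms a env in zatoms b env
  | GRing.opp ?a => zatoms a env
  | ?a => let r := zlookup a env in
          lazymatch r with Some _ => env | None => constr:(a :: env) end
  end.

Ltac zreify t env :=
  lazymatch t with
  | 0 => constr:(ZZero)
  | GRing.add ?a ?b =>
      let x := zreify a env in let y := zreify b env in constr:(ZAdd x y)
  | GRing.opp ?a => let x := zreify a env in constr:(ZOpp x)
  | ?a => let r := zlookup a env in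
          lazymatch r with Some ?n => constr:(ZVar n) end
  end.

Ltac zmod :=
  lazymatch goal with |- @eq ?T ?a ?b =>
    let env := zatoms a (@nil T) in
    let env := zatoms b env in
    let x := zreify a env in
    let y := zreify b env in
    exact: (@zcheckP _ env x y erefl)
  end.

Definition podd (i : int) : bool := odd `|i|%N.

Lemma poddD i j : podd (i + j) = podd i (+) podd j.
Proof.
have subE m n : podd (m%:Z - n%:Z) = odd m (+) odd n.
  rewrite /podd; case: (leqP n m) => [le_nm|/ltnW le_mn].
    by rewrite distnEl // oddB.
  by rewrite distnEr // oddB // addbC.
have NE n : Negz n = - (n.+1)%:Z by rewrite NegzE.
case: i j => m [] n; rewrite ?NE.
- by rewrite /podd -PoszD !absz_nat oddD.
- by rewrite subE /podd abszN absz_nat.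
- by rewrite addrC subE /podd abszN absz_nat addbC.
- by rewrite /podd -opprD !abszN -PoszD !absz_nat oddD.
Qed.

Lemma poddM i j : podd (i * j) = podd i && podd j.
Proof. by rewrite /podd abszM oddM. Qed.

Lemma poddN i : podd (- i) = podd i.
Proof. by rewrite /podd abszN. Qed.

Lemma podd1 : podd 1 = true. Proof. by []. Qed.
Lemma podd0 : podd 0 = false. Proof. by []. Qed.

Lemma podd_nat n : podd n%:Z = odd n. Proof. by []. Qed.

Definition poddE := (poddD, poddM, poddN, podd1, podd0).

Lemma ksignE (R : pzRingType) i : ksign i = (-1) ^+ podd i :> R.
Proof. by rewrite /ksign -signr_odd. Qed.

Lemma ksignD (R : pzRingType) i j : ksign (i + j) = ksign i * ksign j :> R.
Proof. by rewrite !ksignE poddD signr_addb. Qed.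

(** A sign depends only on the parities of finitely many degrees. Splitting on each of them leaves
    an identity with constant signs, for [zmod] to decide. *)
Ltac ksign_cases :=
  rewrite ?ksignE ?poddE;
  repeat match goal with
  | |- context [podd ?i] => case: (podd i)
  end;
  rewrite ?(expr0, expr1, scale1r, scaleN1r, scalerN, scalerDr, opprK).

(* Maps are linear by hypothesis here, not by a canonical structure. *)
Lemma exists_linear (R : pzRingType) (U W : lmodType R) (f : U -> W) :
  linear f -> {g : {linear U -> W} | g =1 f}.
Proof.
move=> f_lin; pose m := GRing.isLinear.Build R U W _ f f_lin.
pose F : {linear U -> W} := HB.pack f m.
by exists F.
Qed.

Section Linear.
Variables (R : pzRingType) (U W : lmodType R) (f : U -> W).
Hypothesis f_lin : linear f.
Let g := projT1 (exists_linear f_lin).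
Let gE : g =1 f := projT2 (exists_linear f_lin).

Lemma lin0 : f 0 = 0. Proof. by rewrite -gE raddf0. Qed.
Lemma linN x : f (- x) = - f x. Proof. by rewrite -!gE raddfN. Qed.
Lemma linD x y : f (x + y) = f x + f y. Proof. by rewrite -!gE raddfD. Qed.
Lemma linB x y : f (x - y) = f x - f y. Proof. by rewrite -!gE raddfB. Qed.
Lemma linZ a x : f (a *: x) = a *: f x. Proof. by rewrite -!gE linearZ. Qed.
Lemma lin_sum I (r : seq I) P (F : I -> U) :
  f (\sum_(i <- r | P i) F i) = \sum_(i <- r | P i) f (F i).
Proof. by rewrite -!gE raddf_sum; apply: eq_bigr => i _; exact: gE. Qed.
End Linear.

Section Presentation.
Variables (k : fieldType) (T : choiceType) (rel : {freeg T / k} -> Prop).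

Lemma pi_linear : linear (\pi_(quotmod rel) : _ -> present rel).
Proof. by move=> a x y; rewrite qpiD -pi_qscale. Qed.

Lemma present_ind (P : present rel -> Prop) :
  P 0 -> (forall a t x, P x -> P (a *: cls rel t + x)) -> forall x, P x.
Proof.
move=> P0 PD x; rewrite -[x](@reprK _ (quotmod rel)); set D := repr _.
rewrite -(freeg_sumE D) (lin_sum pi_linear); elim: (dom D) => [|t s IHs].
  by rewrite big_nil.
rewrite big_cons -[_ (<< _ *g t >>)]/(\pi_(quotmod rel) _).
have -> : \pi_(quotmod rel) << coeff t D *g t >> = coeff t D *: cls rel t.
  rewrite /cls -(linZ pi_linear); congr (\pi_(_) _); apply/eqP/freeg_eqP => z.
  by rewrite -[_ *: _]/(fgscale _ _) coeff_fgscale !coeffU mul1r.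
exact: PD.
Qed.

Lemma eq_lin_cls (W : lmodType k) (f g : present rel -> W) :
  linear f -> linear g -> (forall t, f (cls rel t) = g (cls rel t)) -> f =1 g.
Proof.
move=> f_lin g_lin fg; elim/present_ind => [|a t x IHx].
  by rewrite !lin0.
by rewrite f_lin g_lin fg IHx.
Qed.

Section Kills.
Variables (W : lmodType k) (f : T -> W).
Hypothesis f0 : forall r, rel r -> fglift f r = 0.

(** Two representatives of a class differ by a combination of relations, which [f] kills. *)
Lemma lin_lift_pi x : lin_lift f (\pi_(quotmod rel) x : present rel) = fglift f x.
Proof.
have /spanP[s [rels sE]] : repr (\pi_(quotmod rel) x) - x \in lspan rel.
  by rewrite Quotient.idealrBE reprK.
apply/eqP; rewrite -subr_eq0 /lin_lift -raddfB sE raddf_sum big_seq big1 // => p.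
by move/rels/f0 => /= fp0; rewrite fgliftZ fp0 scaler0.
Qed.

Lemma lin_lift_linear : linear (lin_lift f : present rel -> W).
Proof.
move=> a; elim/quotmodW => x; elim/quotmodW => y.
by rewrite -[X in lin_lift f X]pi_linear !lin_lift_pi raddfD /= fgliftZ.
Qed.
End Kills.

Lemma eq_lin_lift (W : lmodType k) (f g : T -> W) :
  f =1 g -> lin_lift (rel := rel) f =1 lin_lift g.
Proof. by move=> /funext ->. Qed.

Lemma fglift_fun_linear (W : lmodType k) (a : k) (f g : T -> W) (D : {freeg T / k}) :
  fglift (fun t => a *: f t + g t) D = a *: fglift f D + fglift g D.
Proof.
have liftE h : fglift h D = \sum_(z <- dom D) coeff z D *: h z.
  by rewrite -[in LHS](freeg_sumE D) raddf_sum; apply: eq_bigr => z _; exact: liftU.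
rewrite !liftE scaler_sumr -big_split /=.
by apply: eq_bigr => t _; rewrite scalerDr !scalerA mulrC.
Qed.

(** Both sides are evaluated on one and the same representative of [x]. This gives linearity in the
    second argument for lifts nested like [sym_mul] and [poisson]. *)
Lemma lin_lift_fun_linear (W : lmodType k) (a : k) (f g : T -> W) (x : present rel) :
  lin_lift (fun t => a *: f t + g t) x = a *: lin_lift f x + lin_lift g x.
Proof. exact: fglift_fun_linear. Qed.

End Presentation.

Lemma pi_rel (k : fieldType) (T : choiceType) (rel : {freeg T / k} -> Prop) r :
  rel r -> \pi_(quotmod rel) r = 0.
Proof.
move=> rel_r; rewrite -[RHS](lin0 (pi_linear rel)); apply/eqP.
rewrite -Quotient.idealrBE subr0; apply/spanP; exists [:: (1, r)].
by split=> [p|]; rewrite ?big_seq1 ?scale1r // inE => /eqP->.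
Qed.

Lemma lspan_ind (k : pzRingType) (V : lmodType k) (S P : V -> Prop) :
  P 0 -> (forall a x y, S x -> P y -> P (a *: x + y)) -> forall x, x \in lspan S -> P x.
Proof.
move=> P0 PD x /spanP[s [Ss ->]]; elim: s Ss => [|p s IHs] Ss; rewrite ?big_nil //.
rewrite big_cons; apply: PD; first by apply: Ss; rewrite mem_head.
by apply: IHs => q qs; apply: Ss; rewrite inE qs orbT.
Qed.

Lemma mem_lspan (k : pzRingType) (V : lmodType k) (S : V -> Prop) x :
  S x -> x \in lspan S.
Proof.
move=> Sx; apply/spanP; exists [:: (1, x)].
by split=> [p|]; rewrite ?big_seq1 ?scale1r // inE => /eqP->.
Qed.

Lemma lspan_lin (k : pzRingType) (V : lmodType k) (S : V -> Prop) a x y :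
  x \in lspan S -> y \in lspan S -> a *: x + y \in lspan S.
Proof. by move=> xS yS; rewrite rpredD ?spanZ. Qed.

(** * The symmetric algebra *)

(** A [gmod] carries bare predicates [ghom]; that they are submodules has to be required
    separately. *)
Definition gclosed (k : fieldType) (V : gmod k) : Prop :=
  (forall i, ghom i (0 : V)) /\
  (forall i a (x y : V), ghom i x -> ghom i y -> ghom i (a *: x + y)).

Section SymMul.
Variables (k : fieldType) (V : gmod k).
Hypothesis V_closed : gclosed V.
Implicit Types (u v w : word V) (l : int * V) (s t : Sym V).

Lemma hword_cat u w : hword (u ++ w) = hword u && hword w.
Proof. exact: all_cat. Qed.

Lemma hword_cons l w : hword (l :: w) <-> ghom l.1 l.2 /\ hword w.
Proof.
rewrite /hword /=; split=> [/andP[/asboolP hl hw]|[hl hw]]; first by split.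
by apply/andP; split=> //; apply/asboolP.
Qed.

Lemma hword1 l : ghom l.1 l.2 -> hword [:: l].
Proof. by move=> hl; apply/(hword_cons l [::]); split. Qed.

Lemma wdeg_cat u w : wdeg (u ++ w) = wdeg u + wdeg w.
Proof. exact: big_cat. Qed.

Lemma wdeg_cons l w : wdeg (l :: w) = l.1 + wdeg w.
Proof. exact: big_cons. Qed.

Lemma wdeg_nil : wdeg ([::] : word V) = 0.
Proof. exact: big_nil. Qed.

Lemma mon_bad w : ~~ hword w -> mon w = 0.
Proof. by move=> bad; apply: (pi_rel (sym_bad bad)). Qed.

Lemma mon_lin u v i a x y : ghom i x -> ghom i y ->
  mon (u ++ (i, a *: x + y) :: v)
    = a *: mon (u ++ (i, x) :: v) + mon (u ++ (i, y) :: v).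
Proof.
move=> ix iy; have [/andP[hu hv]|bad] := boolP (hword u && hword v); last first.
  by rewrite !mon_bad ?scaler0 ?addr0 // hword_cat /=; move: bad;
     apply: contra => /and3P[-> _ ->].
have h : hword (u ++ [:: (i, x), (i, y) & v]).
  by rewrite hword_cat /= hu hv !asboolT.
have /eqP := pi_rel (sym_lin a h); rewrite !(linB (pi_linear _)) (linZ (pi_linear _)).
rewrite subr_eq0 subr_eq => /eqP h0; rewrite [RHS]addrC; exact: h0.
Qed.

Lemma mon_swap u v i j x y :
  mon (u ++ [:: (i, x), (j, y) & v])
    = ksign (i * j) *: mon (u ++ [:: (j, y), (i, x) & v]).
Proof.
have [h|bad] := boolP (hword (u ++ [:: (i, x), (j, y) & v])); last first.
  rewrite !mon_bad ?scaler0 //; move: bad; rewrite !hword_cat.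
  by apply: contra => /= /and4P[-> -> -> ->].
have /eqP := pi_rel (sym_swap h); rewrite (linB (pi_linear _)) (linZ (pi_linear _)).
by rewrite subr_eq0 => /eqP h0; exact: h0.
Qed.

(** One obligation for each constructor of [sym_rel], with homogeneity unpacked. Most maps out of
    [Sym] are shown to be well defined through it. *)
Lemma kills_sym (W : lmodType k) (F : word V -> W) :
  (forall w, ~~ hword w -> F w = 0) ->
  (forall u v i a x y, hword u -> hword v -> ghom i x -> ghom i y ->
     F (u ++ (i, a *: x + y) :: v) = a *: F (u ++ (i, x) :: v) + F (u ++ (i, y) :: v)) ->
  (forall u v i j x y, hword u -> hword v -> ghom i x -> ghom j y ->
     F (u ++ [:: (i, x), (j, y) & v]) = ksign (i * j) *: F (u ++ [:: (j, y), (i, x) & v])) ->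
  forall r, sym_rel r -> fglift F r = 0.
Proof.
move=> Fbad Flin Fswap _ [w bad|u v i a x y h|u v i j x y h].
- by rewrite liftU scale1r Fbad.
- move: h; rewrite hword_cat => /andP[hu /and3P[/asboolP hx /asboolP hy hv]].
  rewrite !raddfB /= fgliftZ !liftU !scale1r Flin //; zmod.
- move: h; rewrite hword_cat => /andP[hu /and3P[/asboolP hx /asboolP hy hv]].
  by rewrite raddfB /= fgliftZ !liftU !scale1r Fswap // subrr.
Qed.

Lemma kills_mon u r : sym_rel r -> fglift (fun w => mon (u ++ w)) r = 0.
Proof.
apply: kills_sym => {r} [w bad|u' v i a x y _ _ ix iy|u' v i j x y _ _ _ _].
- by rewrite mon_bad // hword_cat negb_and bad orbT.
- by rewrite !catA mon_lin.
- by rewrite !catA mon_swap.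
Qed.

Let M u t := lin_lift (rel := @sym_rel k V) (fun w => mon (u ++ w)) t.

Let M_lin u : linear (M u). Proof. exact: lin_lift_linear (kills_mon u). Qed.

Let M_mon u w : M u (mon w) = mon (u ++ w).
Proof. exact: lin_lift_cls (kills_mon u). Qed.

Let M_kills t r : sym_rel r -> fglift (M^~ t) r = 0.
Proof.
apply: kills_sym => {r} [w bad|u v i a x y _ _ ix iy|u v i j x y _ _ _ _].
- apply: (eq_lin_cls (g := fun=> 0)) (M_lin _) _ _ t => [? ? ?|w'].
    by rewrite scaler0 addr0.
  by rewrite M_mon mon_bad // hword_cat negb_and bad.
- apply: (eq_lin_cls (g := fun t => a *: M _ t + M _ t)) (M_lin _) _ _ t => [b s t|w'].
    by rewrite !M_lin !scalerDr !scalerA mulrC; zmod.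
  by rewrite !M_mon -!catA /= mon_lin.
- apply: (eq_lin_cls (g := fun t => _ *: M _ t)) (M_lin _) _ _ t => [b s t|w'].
    by rewrite !M_lin !scalerDr !scalerA mulrC; zmod.
  by rewrite !M_mon -!catA /= mon_swap.
Qed.

Lemma sym_mul_mon u w : sym_mul (mon u) (mon w) = mon (u ++ w).
Proof. by rewrite [LHS](lin_lift_cls _ (M_kills _)) M_mon. Qed.

Lemma sym_mul_linl t : linear (fun s => sym_mul s t).
Proof. exact: lin_lift_linear (M_kills t). Qed.

Lemma sym_mul_linr s : linear (sym_mul s).
Proof.
move=> a t t'; rewrite [LHS](@eq_lin_lift _ _ (@sym_rel k V) _ _ _ (fun u => M_lin u a t t')).
exact: lin_lift_fun_linear.
Qed.

Lemma eq_sym_lin (W : lmodType k) (f g : Sym V -> W) :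
  linear f -> linear g -> (forall w, hword w -> f (mon w) = g (mon w)) -> f =1 g.
Proof.
move=> f_lin g_lin fg; apply: eq_lin_cls => // w; have [/fg//|bad] := boolP (hword w).
by rewrite -[cls _ w]/(mon w) mon_bad // !lin0.
Qed.

Lemma sym_ind (P : Sym V -> Prop) : P 0 ->
  (forall a w s, hword w -> P s -> P (a *: mon w + s)) -> forall s, P s.
Proof.
move=> P0 PD; elim/present_ind => // a w s Ps; have [/PD h|bad] := boolP (hword w).
  exact: h.
by rewrite -[cls _ w]/(mon w) mon_bad // scaler0 add0r.
Qed.

Lemma sym_mulA : associative (@sym_mul k V).
Proof.
move=> s t t'.
apply: (eq_sym_lin (f := fun s => sym_mul s (sym_mul t t'))
  (g := fun s => sym_mul (sym_mul s t) t')) => [||u _].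
- exact: sym_mul_linl.
- by move=> a x y; rewrite !sym_mul_linl.
apply: (eq_sym_lin (f := fun t => sym_mul (mon u) (sym_mul t t'))
  (g := fun t => sym_mul (sym_mul (mon u) t) t')) => [||w _].
- by move=> a x y; rewrite sym_mul_linl sym_mul_linr.
- by move=> a x y; rewrite sym_mul_linr sym_mul_linl.
apply: (eq_sym_lin (f := fun t' => sym_mul (mon u) (sym_mul (mon w) t'))
  (g := fun t' => sym_mul (sym_mul (mon u) (mon w)) t')) => [||w' _].
- by move=> a x y; rewrite !sym_mul_linr.
- exact: sym_mul_linr.
by rewrite !sym_mul_mon catA.
Qed.

Lemma sym_mul1 : left_id (sym_one V) (@sym_mul k V).
Proof.
apply: eq_sym_lin => [||w _]; first exact: sym_mul_linr.
  by move=> a x y.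
exact: sym_mul_mon.
Qed.

Lemma sym_mulr1 : right_id (sym_one V) (@sym_mul k V).
Proof.
apply: (eq_sym_lin (f := fun s => sym_mul s (sym_one V)) (g := id)) => [||w _] //.
  exact: sym_mul_linl.
by rewrite sym_mul_mon cats0.
Qed.

Lemma mon_swap_front l w w' :
  mon (w ++ l :: w') = ksign (l.1 * wdeg w) *: mon (l :: w ++ w').
Proof.
elim/last_ind: w w' => [|w l' IHw] w'.
  by rewrite wdeg_nil mulr0 scale1r.
rewrite -cats1 wdeg_cat wdeg_cons wdeg_nil addr0 -!catA /=.
case: l l' IHw => [i x] [j y] IHw; rewrite mon_swap IHw /= scalerA -ksignD.
by rewrite !ksignE !poddE andb_addr addbC [podd j && _]andbC.
Qed.

Lemma mon_catC u w : mon (u ++ w) = ksign (wdeg u * wdeg w) *: mon (w ++ u).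
Proof.
elim: u w => [|l u IHu] w; first by rewrite wdeg_nil mul0r scale1r cats0.
rewrite mon_swap_front wdeg_cons mulrDl ksignD -scalerA /=.
have lmul v : mon (l :: v) = sym_mul (mon [:: l]) (mon v) by rewrite sym_mul_mon.
by rewrite lmul IHu (linZ (sym_mul_linr _)) -lmul; ksign_cases.
Qed.

Lemma smulDl s s' t : sym_mul (s + s') t = sym_mul s t + sym_mul s' t.
Proof. exact: linD (sym_mul_linl t) s s'. Qed.
Lemma smulDr s t t' : sym_mul s (t + t') = sym_mul s t + sym_mul s t'.
Proof. exact: linD (sym_mul_linr s) t t'. Qed.
Lemma smulNl s t : sym_mul (- s) t = - sym_mul s t.
Proof. exact: linN (sym_mul_linl t) s. Qed.
Lemma smulNr s t : sym_mul s (- t) = - sym_mul s t.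
Proof. exact: linN (sym_mul_linr s) t. Qed.
Lemma smulZl a s t : sym_mul (a *: s) t = a *: sym_mul s t.
Proof. exact: linZ (sym_mul_linl t) a s. Qed.
Lemma smulZr a s t : sym_mul s (a *: t) = a *: sym_mul s t.
Proof. exact: linZ (sym_mul_linr s) a t. Qed.
Lemma smul0l t : sym_mul 0 t = 0 :> Sym V.
Proof. exact: lin0 (sym_mul_linl t). Qed.
Lemma smul0r s : sym_mul s 0 = 0 :> Sym V.
Proof. exact: lin0 (sym_mul_linr s). Qed.

Definition smulE := (smulDl, smulDr, smulNl, smulNr, smulZl, smulZr, smul0l, smul0r).

Definition ltr l : Sym V := mon [:: l].

Lemma mon_cons l w : mon (l :: w) = sym_mul (ltr l) (mon w).
Proof. by rewrite sym_mul_mon. Qed.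

Lemma ltr_lin i a x y : ghom i x -> ghom i y ->
  ltr (i, a *: x + y) = a *: ltr (i, x) + ltr (i, y).
Proof. exact: (@mon_lin [::] [::]). Qed.

Lemma ltr0 i : ltr (i, 0 : V) = 0.
Proof.
have h0 : ghom i (0 : V) by case: V_closed.
(* With coefficient -1 and both vectors zero, linearity expresses this letter as minus itself plus
   itself. *)
by have := ltr_lin (-1) h0 h0; rewrite scaler0 addr0 scaleN1r addNr.
Qed.

Lemma ltrZ i a x : ghom i x -> ltr (i, a *: x) = a *: ltr (i, x).
Proof.
have h0 : ghom i (0 : V) by case: V_closed.
by move=> hx; rewrite -[a *: x]addr0 ltr_lin // ltr0 addr0.
Qed.

Definition shom n s : Prop := ghom n s.

Lemma shom_mon w : hword w -> shom (wdeg w) (mon w).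
Proof. by move=> hw; apply: mem_lspan; exists w. Qed.

Lemma shom_ltr l : ghom l.1 l.2 -> shom l.1 (ltr l).
Proof.
by move=> hl; have := shom_mon (hword1 hl); rewrite wdeg_cons wdeg_nil addr0.
Qed.

Lemma shom0 n : shom n 0. Proof. exact: rpred0. Qed.

Lemma shom_lin n a s t : shom n s -> shom n t -> shom n (a *: s + t).
Proof. exact: lspan_lin. Qed.

Lemma shomZ n a s : shom n s -> shom n (a *: s).
Proof. by move=> hs; rewrite -[a *: s]addr0; apply: shom_lin => //; exact: shom0. Qed.

Lemma shomD n s t : shom n s -> shom n t -> shom n (s + t).
Proof. by move=> hs ht; rewrite -[s]scale1r; exact: shom_lin. Qed.

Lemma shom_cast m n s : shom m s -> m = n -> shom n s.
Proof. by move=> hs <-. Qed.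

Lemma shom_ind n (P : Sym V -> Prop) : P 0 ->
  (forall a w s, hword w -> wdeg w = n -> P s -> P (a *: mon w + s)) ->
  forall s, shom n s -> P s.
Proof. by move=> P0 PD; apply: lspan_ind => // a _ s [w [hw nw ->]]; exact: PD. Qed.

Lemma shom_lin_ind n (W : lmodType k) (f g : Sym V -> W) :
  linear f -> linear g -> (forall w, hword w -> wdeg w = n -> f (mon w) = g (mon w)) ->
  forall s, shom n s -> f s = g s.
Proof.
move=> f_lin g_lin fg; apply: shom_ind => [|a w s hw nw IHs]; first by rewrite !lin0.
by rewrite f_lin g_lin IHs fg.
Qed.

Lemma linear_shom (f : Sym V -> Sym V) m n : linear f ->
  (forall w, hword w -> wdeg w = n -> shom m (f (mon w))) ->
  forall s, shom n s -> shom m (f s).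
Proof.
move=> f_lin fh; apply: shom_ind => [|a w s hw nw IHs].
  by rewrite lin0 //; exact: shom0.
by rewrite f_lin; apply: shom_lin => //; exact: fh.
Qed.

Lemma shom_mul i j s t : shom i s -> shom j t -> shom (i + j) (sym_mul s t).
Proof.
move=> hs ht; apply: (linear_shom (f := fun s => sym_mul s t)) hs => [|u hu <-].
  exact: sym_mul_linl.
apply: linear_shom ht => [|w hw <-]; first exact: sym_mul_linr.
by rewrite sym_mul_mon -wdeg_cat; apply: shom_mon; rewrite hword_cat hu.
Qed.

Lemma sym_mulC i j s t : shom i s -> shom j t ->
  sym_mul s t = ksign (i * j) *: sym_mul t s.
Proof.
move=> hs ht; apply: (shom_lin_ind (f := fun s => sym_mul s t)
   (g := fun s => ksign (i * j) *: sym_mul t s)) hs => [||u hu <-].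
- exact: sym_mul_linl.
- by move=> a x y; rewrite !smulE; ksign_cases; zmod.
apply: (shom_lin_ind (g := fun t => ksign (wdeg u * j) *: sym_mul t (mon u))) ht
   => [||w hw <-].
- exact: sym_mul_linr.
- by move=> a x y; rewrite !smulE; ksign_cases; zmod.
by rewrite !sym_mul_mon mon_catC.
Qed.

(** The relations are homogeneous, so keeping only the words of degree [n] descends to a projection
    of [Sym] onto its part of degree [n]. Applied to the sum, it isolates [x n]. *)
Lemma shom_indep (s : seq int) (x : int -> Sym V) : uniq s ->
  (forall n, shom n (x n)) -> \sum_(n <- s) x n = 0 -> forall n, n \in s -> x n = 0.
Proof.
move=> s_uniq xh sum0 n ns.
pose F w : Sym V := if hword w && (wdeg w == n) then mon w else 0.
have F_kills r : sym_rel r -> fglift F r = 0.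
  have wdeg_mid u v l : wdeg (u ++ l :: v) = l.1 + wdeg (u ++ v).
    by rewrite !wdeg_cat wdeg_cons addrCA.
  apply: kills_sym => {r} [w /negPf|u v i a y z hu hv hy hz|u v i j y z hu hv hy hz]; rewrite /F.
  - by move=> ->.
  - rewrite !hword_cat !wdeg_mid hu /= !asboolT //=; last first.
      by case: V_closed => _; apply.
    move: hv; rewrite /hword => ->; case: eqP => _; rewrite ?mon_lin //.
    by rewrite scaler0 addr0.
  - rewrite !hword_cat !wdeg_cat !wdeg_cons hu /= !asboolT //=.
    move: hv; rewrite /hword => ->; rewrite [j + (i + _)]addrCA; case: eqP => _.
      by rewrite mon_swap.
    by rewrite scaler0.
have F_lin := lin_lift_linear F_kills.
have F_hom m y : shom m y -> lin_lift F y = if m == n then y else 0.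
  apply: (shom_lin_ind (g := fun y => if m == n then y else 0)) => // [a u v|w hw mw].
    by case: eqP => _; rewrite ?scaler0 ?addr0.
  by rewrite [LHS](lin_lift_cls _ F_kills) /F hw mw.
have := congr1 (lin_lift F) sum0; rewrite (lin_sum F_lin) (lin0 F_lin).
rewrite (bigD1_seq n) //= (F_hom n) // eqxx big1 ?addr0 // => m.
by move=> mn; rewrite (F_hom m) // (negPf mn).
Qed.
End SymMul.

(** * Derivations, the Chevalley-Eilenberg operator and the Poisson bracket *)

Section Recursion.
Variables (k : fieldType) (V : gmod k).
Variables (e : int) (A : int * V -> Sym V -> Sym V).
Implicit Types (u v w : word V) (l : int * V) (s t : Sym V).

(* Derivations ([A l s] is the product of the image of [l] with [s]) and the
   Chevalley-Eilenberg operator ([A l s] is the bracket of [l] with [s]) both satisfy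
   this recursion. *)
Fixpoint wrec w : Sym V := if w is l :: w' then
  A l (mon w') + ksign (e * l.1) *: sym_mul (ltr l) (wrec w') else 0.

Definition srec : Sym V -> Sym V :=
  lin_lift (rel := @sym_rel k V) (fun w => if hword w then wrec w else 0).

(** The last condition is what exchanging the first two letters of a word amounts to once the
    recursion is expanded twice: the remaining terms, which involve only the tail, agree by
    commutativity. *)
Definition rec_ok : Prop :=
  [/\ gclosed V, forall l, ghom l.1 l.2 -> linear (A l),
   forall i a x y s, ghom i x -> ghom i y ->
     A (i, a *: x + y) s = a *: A (i, x) s + A (i, y) s &
   forall i j x y s, ghom i x -> ghom j y ->
     A (i, x) (sym_mul (ltr (j, y)) s) + ksign (e * i) *: sym_mul (ltr (i, x)) (A (j, y) s)
     = ksign (i * j) *: (A (j, y) (sym_mul (ltr (i, x)) s)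
         + ksign (e * j) *: sym_mul (ltr (j, y)) (A (i, x) s))].

Hypothesis A_ok : rec_ok.

Lemma wrec_kills r : sym_rel r ->
  fglift (fun w : word V => if hword w then wrec w else 0) r = 0.
Proof.
case: A_ok => [[_ V_lin] A_lin A_letter A_swap].
apply: kills_sym => {r} [w /negPf-> //|u v i a x y hu hv hx hy|u v i j x y hu hv hx hy].
- have hxy := V_lin i a x y hx hy; rewrite !hword_cat hu /= !asboolT //.
  move: hv; rewrite /hword => -> /=.
  elim: u hu => [_|l u IHu] /=.
    by rewrite A_letter // ltr_lin // !smulE; ksign_cases; zmod.
  case/andP=> /asboolP hl hu; rewrite mon_lin // A_lin // IHu // !smulE.
  by ksign_cases; zmod.
- rewrite !hword_cat hu /= !asboolT //.
  move: hv; rewrite /hword => -> /=.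
  elim: u hu => [_|l u IHu] /=.
    rewrite !smulE (mon_cons (j, y)) (mon_cons (i, x)) scalerDr addrA A_swap //.
    rewrite !scalerDr -!addrA; congr (_ + (_ + _)).
    rewrite !sym_mulA (@sym_mulC _ _ i j (ltr (i, x)) (ltr (j, y))); try exact: shom_ltr.
    by rewrite !smulE; ksign_cases.
  case/andP=> /asboolP hl hu; rewrite mon_swap (linZ (A_lin _ hl)) IHu // !smulE.
  by ksign_cases; zmod.
Qed.

Lemma srec_linear : linear srec.
Proof. exact: lin_lift_linear wrec_kills. Qed.

Lemma srec_mon w : hword w -> srec (mon w) = wrec w.
Proof. by move=> hw; rewrite [LHS](lin_lift_cls _ wrec_kills) hw. Qed.

Lemma srec_cons l w : ghom l.1 l.2 -> hword w ->
  srec (mon (l :: w)) = A l (mon w) + ksign (e * l.1) *: sym_mul (ltr l) (srec (mon w)).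
Proof.
by move=> hl hw; rewrite !srec_mon //; apply/hword_cons.
Qed.

Lemma srec_one : srec (sym_one V) = 0.
Proof. exact: srec_mon. Qed.

Lemma srec_hom n s :
  (forall l j t, ghom l.1 l.2 -> shom j t -> shom (l.1 + j + e) (A l t)) ->
  shom n s -> shom (n + e) (srec s).
Proof.
move=> A_hom; apply: linear_shom => [|w]; first exact: srec_linear.
elim: w n => [|l w IHw] n; first by rewrite srec_one; move=> *; exact: shom0.
case/hword_cons=> hl hw <-; rewrite srec_cons // wdeg_cons.
apply: shomD; first by apply: A_hom => //; exact: shom_mon.
by apply/shomZ; rewrite -addrA; apply: shom_mul; [exact: shom_ltr|exact: IHw].
Qed.

(** Serves to recognise the explicit sums that define [der] and [ce]. They are compared as functions
    on words, before passing to the quotient. *)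
Lemma srec_unique (G : word V -> Sym V) : G [::] = 0 ->
  (forall l w, ghom l.1 l.2 -> hword w ->
    G (l :: w) = A l (mon w) + ksign (e * l.1) *: sym_mul (ltr l) (G w)) ->
  (fun w => if hword w then G w else 0) =1 (fun w => if hword w then wrec w else 0).
Proof.
move=> G0 GS w; case: ifP => // hw; elim: w hw => [|l w IHw] //.
by case/hword_cons=> hl hw; rewrite GS //= IHw.
Qed.
End Recursion.

Section Derivations.
Variables (k : fieldType) (V : gmod k).
Hypothesis V_closed : gclosed V.
Implicit Types (u v w : word V) (l : int * V) (s t : Sym V).

Definition derivation (e : int) (D : Sym V -> Sym V) : Prop := linear D /\
  forall n s t, shom n s ->
    D (sym_mul s t) = sym_mul (D s) t + ksign (e * n) *: sym_mul s (D t).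

Lemma eq_derivation e D D' : derivation e D -> derivation e D' ->
  (forall l, ghom l.1 l.2 -> D (ltr l) = D' (ltr l)) -> D =1 D'.
Proof.
move=> [Dlin DM] [D'lin D'M] DD'; apply: eq_sym_lin => // w.
have h1 : shom 0 (sym_one V).
  by have := @shom_mon _ V [::] isT; rewrite wdeg_nil.
(* A derivation kills the unit: applied to the product of the unit with itself, it gives F 1 = F 1 +
   F 1. *)
have one0 F : linear F -> (forall n s t, shom n s ->
    F (sym_mul s t) = sym_mul (F s) t + ksign (e * n) *: sym_mul s (F t)) ->
    F (sym_one V) = 0.
  move=> F_lin /(_ 0 _ (sym_one V) h1); rewrite mulr0 scale1r !sym_mul1 sym_mulr1.
  by move/(congr1 (fun s => s - F (sym_one V))); rewrite addrK subrr.
elim: w => [|l w IHw]; first by rewrite -/(sym_one V) !one0.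
case/hword_cons=> hl hw; rewrite mon_cons (DM l.1) ?(D'M l.1) ?DD' ?IHw //.
all: exact: shom_ltr.
Qed.

Variables (e : int) (Q : int * V -> Sym V).

Definition letter_map : Prop :=
  (forall l, ghom l.1 l.2 -> shom (l.1 + e) (Q l)) /\
  forall i a x y, ghom i x -> ghom i y -> Q (i, a *: x + y) = a *: Q (i, x) + Q (i, y).

Definition sder : Sym V -> Sym V := srec e (fun l s => sym_mul (Q l) s).

Hypothesis Q_ok : letter_map.

Lemma sder_ok : rec_ok e (fun l s => sym_mul (Q l) s).
Proof.
case: Q_ok => [Qhom Qlin]; split=> // [l _|i a x y s hx hy|i j x y s hx hy].
- exact: sym_mul_linr.
- by rewrite Qlin // !smulE.
rewrite !sym_mulA.
rewrite (@sym_mulC _ _ (i + e) j (Q (i, x)) (ltr (j, y))); [|exact: (Qhom (i, x))|exact: shom_ltr].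
rewrite (@sym_mulC _ _ (j + e) i (Q (j, y)) (ltr (i, x))); [|exact: (Qhom (j, y))|exact: shom_ltr].
by rewrite !smulE; ksign_cases; rewrite /=; zmod.
Qed.

Lemma sder_linear : linear sder. Proof. exact: srec_linear sder_ok. Qed.

Lemma sder_ltr l : ghom l.1 l.2 -> sder (ltr l) = Q l.
Proof.
move=> hl; rewrite [LHS](srec_cons sder_ok) // [srec _ _ _](srec_one sder_ok) smulE.
by rewrite scaler0 addr0 sym_mulr1.
Qed.

Lemma sder_derivation : derivation e sder.
Proof.
split=> [|n s t]; first exact: sder_linear.
apply: (shom_lin_ind (f := fun s => sder (sym_mul s t))
  (g := fun s => sym_mul (sder s) t + ksign (e * n) *: sym_mul s (sder t))).
- by move=> a x y; rewrite smulDl smulZl sder_linear.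
- by move=> a x y; rewrite sder_linear !smulE; ksign_cases; zmod.
move=> u; elim: u n => [|l u IHu] n.
  rewrite wdeg_nil => _ <-; rewrite -/(sym_one V) !sym_mul1 mulr0 scale1r.
  by rewrite [sder (sym_one V)](srec_one sder_ok) smulE add0r.
case/hword_cons=> hl hu <-; rewrite wdeg_cons mon_cons -sym_mulA.
have cons s' : sder (sym_mul (ltr l) s') = sym_mul (Q l) s'
    + ksign (e * l.1) *: sym_mul (ltr l) (sder s').
  apply: (eq_sym_lin (f := fun s' => sder (sym_mul (ltr l) s')) (g := fun s' =>
    sym_mul (Q l) s' + ksign (e * l.1) *: sym_mul (ltr l) (sder s'))) s' => [||w hw].
  - by move=> a x y; rewrite smulDr smulZr sder_linear.
  - by move=> a x y; rewrite sder_linear !smulE; ksign_cases; zmod.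
  - by rewrite -mon_cons [LHS](srec_cons sder_ok).
by rewrite !cons (IHu (wdeg u)) // !smulE !sym_mulA; ksign_cases; zmod.
Qed.

Lemma sder_hom n s : shom n s -> shom (n + e) (sder s).
Proof.
apply: (srec_hom sder_ok) => l j t hl ht; rewrite -addrA [j + e]addrC addrA.
by apply: shom_mul => //; apply: (proj1 Q_ok).
Qed.
End Derivations.

Section DerivationAlgebra.
Variables (k : fieldType) (V : gmod k).
Hypothesis V_closed : gclosed V.
Implicit Types (u v w : word V) (l : int * V) (s t : Sym V) (D : Sym V -> Sym V).

Lemma derivation_deg e e' D : podd e = podd e' -> derivation e D -> derivation e' D.
Proof.
move=> ee' [Dlin DM]; split=> // n s t hs.
by rewrite (DM n) // !ksignE !poddE ee'.
Qed.

Lemma derivation_lin e a D D' : derivation e D -> derivation e D' ->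
  derivation e (fun s => a *: D s + D' s).
Proof.
move=> [Dlin DM] [D'lin D'M]; split=> [b s t|n s t hs].
  by rewrite Dlin D'lin !scalerDr !scalerA [a * b]mulrC; zmod.
by rewrite (DM n) // (D'M n) // !smulE; ksign_cases; zmod.
Qed.

Lemma derivation0 e : derivation e (fun=> 0 : Sym V).
Proof.
split=> [b s t|n s t hs]; first by rewrite scaler0 addr0.
by rewrite !smulE scaler0 addr0.
Qed.

Lemma derivation_mul e i s D : shom i s -> derivation e D ->
  derivation (i + e) (fun t => sym_mul s (D t)).
Proof.
move=> hs [Dlin DM]; split=> [b t t'|n t t' ht]; first by rewrite Dlin !smulE.
rewrite (DM n) // !smulE !sym_mulA (sym_mulC hs ht) smulE.
by ksign_cases.
Qed.

Lemma derivation_comm e e' D D' : derivation e D -> derivation e' D' ->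
  (forall n s, shom n s -> shom (n + e) (D s)) ->
  (forall n s, shom n s -> shom (n + e') (D' s)) ->
  derivation (e + e') (fun s => D (D' s) - ksign (e * e') *: D' (D s)).
Proof.
move=> [Dlin DM] [D'lin D'M] hD hD'; split=> [b t t'|n s t hs].
  by rewrite !(Dlin, D'lin); ksign_cases; zmod.
rewrite (DM n s t) // (D'M n s t) // !(linD Dlin, linD D'lin) !(linZ Dlin, linZ D'lin).
rewrite (DM n s) // (D'M n s) // (DM (n + e')) ?(D'M (n + e)); [|exact: hD|exact: hD'].
by rewrite !smulE; ksign_cases; zmod.
Qed.
End DerivationAlgebra.

Section Bracket.
Variables (k : fieldType) (V : gmod k) (c : int) (lie : V -> V -> V).
Implicit Types (u v w : word V) (l : int * V) (s t : Sym V).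

(** The sign in [lb_anti] is -(-1)^((i+1)(j+1)), antisymmetry for degrees shifted by one. The axioms
    speak of homogeneous elements only: the carrier of a dual consists of all functions, and
    linearity is part of being homogeneous there. *)
Record lie_bracket : Prop := {
  lb_closed : gclosed V;
  lb_odd : podd c;
  lb_hom : forall i j x y, ghom i x -> ghom j y -> ghom (i + j + c) (lie x y);
  lb_linl : forall i j a x y z, ghom i x -> ghom i y -> ghom j z ->
    lie (a *: x + y) z = a *: lie x z + lie y z;
  lb_linr : forall i j a x y z, ghom i x -> ghom j y -> ghom j z ->
    lie x (a *: y + z) = a *: lie x y + lie x z;
  lb_anti : forall i j x y, ghom i x -> ghom j y ->
    lie x y = ksign (i * j + i + j) *: lie y x;
  lb_jacobi : forall i j n x y z, ghom i x -> ghom j y -> ghom n z ->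
    lie x (lie y z)
      = lie (lie x y) z + ksign ((i + 1) * (j + 1)) *: lie y (lie x z) }.

Hypothesis lieP : lie_bracket.
Let V_closed := lb_closed lieP.
Let c_odd := lb_odd lieP.

Definition lbr l l' : Sym V := ksign l.1 *: ltr (l.1 + l'.1 + c, lie l.2 l'.2).

(** The Poisson bracket with a single letter. Both [ce] and [poisson] are rewritten in terms of it,
    so that their identities follow from those of derivations. *)
Definition ad l : Sym V -> Sym V := sder (l.1 + c) (lbr l).

Lemma lbr_hom l l' : ghom l.1 l.2 -> ghom l'.1 l'.2 -> shom (l.1 + l'.1 + c) (lbr l l').
Proof.
by move=> hl hl'; apply/shomZ/(@shom_ltr _ _ (_, _)); exact: lb_hom.
Qed.

(** The factor (-1)^|l| in [lbr] turns antisymmetry for the shifted degrees into symmetry for the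
    degrees themselves. *)
Lemma lbrC l l' : ghom l.1 l.2 -> ghom l'.1 l'.2 ->
  lbr l l' = ksign (l.1 * l'.1) *: lbr l' l.
Proof.
move=> hl hl'; rewrite /lbr (lb_anti lieP hl hl').
have h := lb_hom lieP hl' hl.
have -> : l.1 + l'.1 + c = l'.1 + l.1 + c by zmod.
by rewrite ltrZ //; ksign_cases.
Qed.

Lemma lbr_letter l : ghom l.1 l.2 -> letter_map (l.1 + c) (lbr l).
Proof.
move=> hl; split=> [l' hl'|i a x y hx hy].
  by rewrite addrA [l'.1 + _]addrC; exact: lbr_hom.
rewrite /lbr /= (lb_linr lieP a hl hx hy) ltr_lin; try exact: lb_hom.
by ksign_cases; zmod.
Qed.

Lemma ad_derivation l : ghom l.1 l.2 -> derivation (l.1 + c) (ad l).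
Proof. by move=> hl; exact (sder_derivation V_closed (lbr_letter hl)). Qed.

Lemma ad_hom l n s : ghom l.1 l.2 -> shom n s -> shom (l.1 + n + c) (ad l s).
Proof.
move=> hl hs; have -> : l.1 + n + c = n + (l.1 + c) by zmod.
exact (sder_hom V_closed (lbr_letter hl) hs).
Qed.

Lemma ad_ltr l l' : ghom l.1 l.2 -> ghom l'.1 l'.2 -> ad l (ltr l') = lbr l l'.
Proof. by move=> hl hl'; exact (sder_ltr V_closed (lbr_letter hl) hl'). Qed.

Lemma ad_lin i a x y s : ghom i x -> ghom i y ->
  ad (i, a *: x + y) s = a *: ad (i, x) s + ad (i, y) s.
Proof.
move=> hx hy; have hxy : ghom i (a *: x + y) by case: V_closed => _; exact.
apply: (eq_derivation (D := ad (i, a *: x + y)) (D' := fun s => a *: ad (i, x) s + ad (i, y) s)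
   (e := i + c)) => [||l hl].
- exact: (@ad_derivation (i, _)).
- by apply: derivation_lin; exact: (@ad_derivation (i, _)).
rewrite !ad_ltr // /lbr /= (lb_linl lieP a hx hy hl) ltr_lin; try exact: lb_hom.
by ksign_cases; zmod.
Qed.
End Bracket.

Section Contraction.
Variables (k : fieldType) (V : gmod k) (c : int) (lie : V -> V -> V).
Hypothesis lieP : lie_bracket c lie.
Let V_closed := lb_closed lieP.
Implicit Types (u v w : word V) (l : int * V) (s t : Sym V).
Local Notation "s ** t" := (sym_mul s t) (at level 40, left associativity).
Local Notation lbr := (lbr c lie).
Local Notation ad := (ad c lie).
Local Notation contract_letters := (contract_letters c lie).

Lemma hword_nth w p : hword w -> (p < size w)%N -> ghom (nth (0, 0) w p).1 (nth (0, 0) w p).2.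
Proof. by move=> /all_nthP h /(h (0, 0))/asboolP. Qed.

Lemma hword_take w p : hword w -> hword (take p w).
Proof. by move=> h; apply/allP => l /mem_take; move/allP: h; apply. Qed.

Lemma sder_sum e (Q : int * V -> Sym V) w : letter_map e Q -> hword w ->
  sder e Q (mon w) = \sum_(p < size w) ksign (e * wdeg (take p w)) *:
    (mon (take p w) ** (Q (nth (0, 0) w p) ** mon (drop p.+1 w))).
Proof.
move=> Q_ok; elim: w => [_|l w IHw /hword_cons[hl hw]].
  by rewrite big_ord0; exact: (srec_one (sder_ok V_closed Q_ok)).
rewrite [LHS](srec_cons (sder_ok V_closed Q_ok)) //= big_ord_recl /=.
rewrite drop0 wdeg_nil mulr0 scale1r -[mon [::]]/(sym_one V) sym_mul1.
congr (_ + _); rewrite [srec _ _ _]IHw // (lin_sum (sym_mul_linr _)) scaler_sumr.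
apply: eq_bigr => p _; rewrite /= wdeg_cons mon_cons -sym_mulA smulZr mulrDr ksignD scalerA //.
Qed.

(** The contracted letter has degree |p|+|q|+c and must pass [l]. The parts |p| and |q| cancel
    against the signs of moving the two letters past [l]; the odd [c] leaves (-1)^|l|. *)
Lemma contract_lettersS l w p q :
  contract_letters (l :: w) p.+1 q.+1
    = ksign l.1 *: (ltr l ** contract_letters w p q).
Proof.
case: l => i x; rewrite /contract_letters /= wdeg_cons smulZr (@mon_swap _ _ [::]) /=.
by rewrite -mon_cons; move: (lb_odd lieP); ksign_cases.
Qed.

Lemma contract_letters0 l w q : hword (l :: w) -> (q < size w)%N ->
  contract_letters (l :: w) 0 q.+1
    = ksign ((l.1 + c) * wdeg (take q w)) *:
      (mon (take q w) ** (lbr l (nth (0, 0) w q) ** mon (drop q.+1 w))).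
Proof.
case/hword_cons=> hl hw lt_q; have hq := hword_nth hw lt_q.
rewrite /contract_letters /= drop0 wdeg_nil mulr0 add0r add0r.
rewrite mon_cons -sym_mul_mon /lbr !smulE !sym_mulA.
rewrite (sym_mulC (shom_mon (hword_take q hw)) (@shom_ltr _ _ (_, _) (lb_hom lieP hl hq))).
move: (lb_odd lieP); rewrite !smulE; ksign_cases => //.
Qed.

Definition ce_word w : Sym V := \sum_(q < size w) \sum_(p < q) contract_letters w p q.

(** The pairs that contain the first letter add up to [ad l], all others to [ce_word w]. *)
Lemma ce_word_cons l w : ghom l.1 l.2 -> hword w ->
  ce_word (l :: w) = ad l (mon w) + ksign (1 * l.1) *: (ltr l ** ce_word w).
Proof.
move=> hl hw; rewrite /ce_word /= big_ord_recl big_ord0 add0r.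
rewrite [ad _ _](sder_sum (lbr_letter lieP hl) hw).
rewrite (lin_sum (sym_mul_linr _)) scaler_sumr -big_split /=; apply: eq_bigr => q _.
rewrite big_ord_recl /= contract_letters0 //; last exact/hword_cons.
congr (_ + _); rewrite (lin_sum (sym_mul_linr _)) scaler_sumr.
by apply: eq_bigr => p _; rewrite contract_lettersS mul1r.
Qed.

(** When the first two letters are exchanged, their brackets with the tail match because [ad] is a
    derivation, and their bracket with each other because [lbr] is symmetric. *)
Lemma ad_rec_ok : rec_ok 1 ad.
Proof.
split=> // [l hl|i a x y s hx hy|i j x y s hx hy].
- exact: (proj1 (ad_derivation lieP hl)).
- exact: ad_lin.
rewrite (proj2 (ad_derivation lieP (hx : ghom (i, x).1 (i, x).2)) j); last exact: shom_ltr.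
rewrite (proj2 (ad_derivation lieP (hy : ghom (j, y).1 (j, y).2)) i); last exact: shom_ltr.
rewrite !ad_ltr // [lbr (j, y) (i, x)](lbrC lieP) //= !smulE.
move: (lb_odd lieP); ksign_cases => //= _; zmod.
Qed.

Lemma ceE : ce c lie =1 srec 1 ad.
Proof.
apply: eq_lin_lift; apply: (srec_unique (G := ce_word)) => [|l w].
  by rewrite /ce_word big_ord0.
exact: ce_word_cons.
Qed.

Lemma ce_linear : linear (ce c lie : Sym V -> Sym V).
Proof. by move=> a s t; rewrite !ceE srec_linear //; exact: ad_rec_ok. Qed.

Lemma ce_cons l w : ghom l.1 l.2 -> hword w ->
  ce c lie (mon (l :: w))
    = ad l (mon w) + ksign l.1 *: (ltr l ** ce c lie (mon w)).
Proof. by move=> hl hw; rewrite !ceE [LHS](srec_cons ad_rec_ok) // mul1r. Qed.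

Lemma ce_one : ce c lie (sym_one V) = 0.
Proof. by rewrite ceE [LHS](srec_one ad_rec_ok). Qed.

Lemma ce_ltr l : ghom l.1 l.2 -> ce c lie (ltr l) = 0.
Proof.
move=> hl; rewrite ce_cons // -[mon [::]]/(sym_one V) ce_one smul0r scaler0 addr0.
have [D_lin DM] := ad_derivation lieP hl.
by have := srec_one (sder_ok V_closed (lbr_letter lieP hl)).
Qed.

Lemma ce_hom n s : shom n s -> shom (n + c) (ce c lie s).
Proof.
apply: linear_shom => [|w]; first exact: ce_linear.
elim: w n => [|l w IHw] n; first by rewrite -/(sym_one V) ce_one; move=> *; exact: shom0.
case/hword_cons=> hl hw <-; rewrite ce_cons // wdeg_cons; apply: shomD.
  by apply: ad_hom => //; exact: shom_mon.
by apply/shomZ; rewrite -addrA; apply: shom_mul; [exact: shom_ltr|exact: IHw].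
Qed.

(** The Leibniz rule in the first argument, peeling off one letter at a time. In the first summand
    [ad l] has to pass the rest of the word to reach [t], hence the sign. *)
Fixpoint poisson_rec u (t : Sym V) : Sym V := if u is l :: u' then
  ksign ((l.1 + c) * wdeg u') *: (mon u' ** ad l t)
    + ksign l.1 *: (ltr l ** poisson_rec u' t) else 0.

Lemma poisson_rec_linear u : hword u -> linear (poisson_rec u).
Proof.
elim: u => [_|l u IHu /hword_cons[hl hu]] a s t /=; first by rewrite scaler0 addr0.
rewrite (proj1 (ad_derivation lieP hl)) (IHu hu) !smulE.
by ksign_cases; zmod.
Qed.

Definition poisson_word u w : Sym V :=
  \sum_(p < size u) \sum_(q < size w) contract_letters (u ++ w) p (size u + q).

Lemma poisson_wordE u w : hword u -> hword w ->
  poisson_word u w = poisson_rec u (mon w).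
Proof.
rewrite /poisson_word; elim: u => [_ _|l u IHu hu hw] /=; first by rewrite big_ord0.
have [hl hu'] := iffLR (hword_cons _ _) hu.
rewrite big_ord_recl -IHu //; congr (_ + _); last first.
  rewrite (lin_sum (sym_mul_linr _)) scaler_sumr; apply: eq_bigr => p _.
  rewrite (lin_sum (sym_mul_linr _)) scaler_sumr; apply: eq_bigr => q _.
  exact: contract_lettersS.
rewrite [ad _ _](sder_sum (lbr_letter lieP hl) hw).
rewrite (lin_sum (sym_mul_linr _)) scaler_sumr; apply: eq_bigr => q _.
rewrite contract_letters0 ?size_cat ?ltn_add2l //; last first.
  by rewrite -cat_cons hword_cat hu.
rewrite smulZr scalerA take_cat ltnNge leq_addr /= addKn wdeg_cat mulrDr ksignD.
rewrite nth_cat ltnNge leq_addr /= addKn drop_cat ltnNge -addnS leq_addr /= addKn.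
by rewrite -sym_mul_mon !sym_mulA.
Qed.

Lemma lin_lift_linear_mon (L : Sym V -> Sym V) : linear L ->
  lin_lift (rel := @sym_rel k V) (fun w => L (mon w)) =1 L.
Proof.
move=> L_lin; have L_kills r : sym_rel r -> fglift (fun w => L (mon w)) r = 0.
  move=> r_rel; rewrite -[RHS](lin0 L_lin) -(pi_rel r_rel) -[in LHS](freeg_sumE r).
  rewrite -[in RHS](freeg_sumE r) (lin_sum (pi_linear _)) (lin_sum L_lin) raddf_sum.
  apply: eq_bigr => w _; rewrite /= liftU -(linZ L_lin); congr L.
  rewrite -[X in _ *: X]/(\pi_(quotmod (@sym_rel k V)) _) -(linZ (pi_linear _)).
  congr (\pi_(_) _); apply/eqP/freeg_eqP => z.
  by rewrite -[_ *: _]/(fgscale _ _) coeff_fgscale !coeffU mul1r.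
apply: eq_lin_cls => // [|w]; first exact: lin_lift_linear L_kills.
exact: lin_lift_cls L_kills.
Qed.

Lemma poissonE s t : poisson c lie s t =
  lin_lift (rel := @sym_rel k V) (fun u => if hword u then poisson_rec u t else 0) s.
Proof.
apply: eq_lin_lift => u; case: ifP => hu.
  rewrite -[RHS](lin_lift_linear_mon (poisson_rec_linear hu)).
  apply: eq_lin_lift => w; rewrite hword_cat hu /=; have [hw|bad] := boolP (hword w).
    exact: poisson_wordE.
  by rewrite mon_bad // (lin0 (poisson_rec_linear hu)).
have L0 : linear (fun _ : Sym V => 0 : Sym V) by move=> a x y; rewrite scaler0 addr0.
rewrite -[RHS](lin_lift_linear_mon L0 t).
by apply: eq_lin_lift => w; rewrite hword_cat hu.
Qed.
End Contraction.

(** * The Poisson bracket: symmetry, Leibniz rule and Jacobi identity *)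

Section Poisson.
Variables (k : fieldType) (V : gmod k) (c : int) (lie : V -> V -> V).
Hypothesis lieP : lie_bracket c lie.
Let V_closed := lb_closed lieP.
Let c_odd := lb_odd lieP.
Implicit Types (u v w : word V) (l : int * V) (s t : Sym V).
Local Notation "s ** t" := (sym_mul s t) (at level 40, left associativity).
Local Notation lbr := (lbr c lie).
Local Notation ad := (ad c lie).
Local Notation poisson := (poisson c lie).
Local Notation poisson_rec := (poisson_rec c lie).

(** By symmetry this ought to be the bracket of [t] with the letter [l]. Its extension as a
    derivation describes the bracket from the other side; comparing it with [poisson_rec] gives both
    well-definedness and symmetry. *)
Definition lbr_right j t l : Sym V := ksign (j * l.1) *: ad l t.

Lemma poisson_letter j t : shom j t -> letter_map (j + c) (lbr_right j t).
Proof.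
move=> ht; split=> [l hl|i a x y hx hy].
  by rewrite addrA; apply/shomZ; exact: ad_hom.
by rewrite /lbr_right /= ad_lin //; ksign_cases; zmod.
Qed.

Lemma poisson_recE j u t : shom j t -> hword u ->
  poisson_rec u t = ksign (wdeg u * j) *: sder (j + c) (lbr_right j t) (mon u).
Proof.
move=> ht; have ok := sder_ok V_closed (poisson_letter ht).
elim: u => [_|l u IHu /hword_cons[hl hu]] /=.
  by rewrite [sder _ _ _](srec_one ok) scaler0.
rewrite [sder _ _ _](srec_cons ok) // -/(sder _ _) IHu // wdeg_cons.
rewrite (sym_mulC (shom_mon hu) (ad_hom lieP hl ht)) /lbr_right !smulE.
by move: c_odd; ksign_cases => //= _; zmod.
Qed.

Definition poisson_fun t u : Sym V := if hword u then poisson_rec u t else 0.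

(** By linearity [t] may be taken to be a monomial. Then, up to a sign depending on degrees only,
    the function is a derivation evaluated at [mon u], so it respects the relations in [u]. *)
Lemma poisson_rec_kills t r : sym_rel r -> fglift (poisson_fun t) r = 0.
Proof.
move=> r_rel; elim/sym_ind: t => [|a w t hw IHt].
  have -> : poisson_fun 0 = (fun=> 0 : Sym V).
    apply/funext => u; rewrite /poisson_fun; case: ifP => // hu.
    by rewrite (lin0 (poisson_rec_linear lieP hu)).
  by rewrite -(freeg_sumE r) raddf_sum big1 // => z _; rewrite /= liftU scaler0.
have -> : poisson_fun (a *: mon w + t) = fun u => a *: poisson_fun (mon w) u + poisson_fun t u.
  apply/funext => u; rewrite /poisson_fun; case: ifP => hu; last by rewrite scaler0 addr0.
  exact: poisson_rec_linear.
rewrite fglift_fun_linear [X in _ + X]IHt addr0.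
suff -> : fglift (poisson_fun (mon w)) r = 0 by rewrite scaler0.
have ht := shom_mon hw; have dlin := proj1 (sder_derivation V_closed (poisson_letter ht)).
have FE u : hword u -> poisson_fun (mon w) u
    = ksign (wdeg u * wdeg w) *: sder (wdeg w + c) (lbr_right (wdeg w) (mon w)) (mon u).
  by move=> hu; rewrite /poisson_fun hu (poisson_recE ht).
have wdeg_mid u v l : wdeg (u ++ l :: v) = l.1 + wdeg (u ++ v).
  by rewrite !wdeg_cat wdeg_cons addrCA.
have hmid u v l : hword u -> hword v -> ghom l.1 l.2 -> hword (u ++ l :: v).
  by move=> hu hv hl; rewrite hword_cat hu; apply/hword_cons.
move: r r_rel {IHt}; apply: kills_sym => [u /negPf|u v i b x y hu hv hx hy|u v i j x y hu hv hx hy].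
- by rewrite /poisson_fun => ->.
- have hxy : ghom i (b *: x + y) by case: V_closed => _; exact.
  rewrite (FE _ (hmid u v (i, _) hu hv hxy)) (FE _ (hmid u v (i, _) hu hv hx)).
  rewrite (FE _ (hmid u v (i, _) hu hv hy)) mon_lin // dlin !wdeg_mid /=.
  by ksign_cases; zmod.
- have hxv := iffRL (hword_cons (i, x) v) (conj hx hv).
  have hyv := iffRL (hword_cons (j, y) v) (conj hy hv).
  rewrite (FE _ (hmid u _ (i, x) hu hyv hx)) (FE _ (hmid u _ (j, y) hu hxv hy)).
  by rewrite mon_swap (linZ dlin) !wdeg_mid /=; ksign_cases.
Qed.

Lemma poisson_mon u t : hword u -> poisson (mon u) t = poisson_rec u t.
Proof.
by move=> hu; rewrite poissonE // [LHS](lin_lift_cls _ (poisson_rec_kills t)) /poisson_fun hu.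
Qed.

Lemma poisson_linl t : linear (poisson^~ t).
Proof.
by move=> a s s'; rewrite !poissonE // (lin_lift_linear (poisson_rec_kills t)).
Qed.

Lemma poisson_linr s : linear (poisson s).
Proof.
move=> a t t'; rewrite !poissonE // -lin_lift_fun_linear; apply: eq_lin_lift => u.
case: ifP => hu; last by rewrite scaler0 addr0.
exact: poisson_rec_linear.
Qed.

Lemma poisson_ltr l t : ghom l.1 l.2 -> poisson (ltr l) t = ad l t.
Proof.
move=> hl; rewrite poisson_mon ?hword1 //= wdeg_nil mulr0 scale1r.
by rewrite -[mon _]/(sym_one V) sym_mul1 smul0r scaler0 addr0.
Qed.

Lemma poisson_sder i j s t : shom i s -> shom j t ->
  poisson s t = ksign (i * j) *: sder (j + c) (lbr_right j t) s.
Proof.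
move=> hs ht; have dlin := proj1 (sder_derivation V_closed (poisson_letter ht)).
apply: (shom_lin_ind (f := poisson^~ t)
  (g := fun s => ksign (i * j) *: sder (j + c) (lbr_right j t) s)) hs => [||u hu <-].
- exact: poisson_linl.
- by move=> a x y; rewrite dlin; ksign_cases; zmod.
- by rewrite poisson_mon // (poisson_recE ht).
Qed.

Lemma poisson_hom i j s t : shom i s -> shom j t -> shom (i + j + c) (poisson s t).
Proof.
move=> hs ht; rewrite (poisson_sder hs ht) -addrA; apply/shomZ.
exact (sder_hom V_closed (poisson_letter ht) hs).
Qed.

Lemma poisson_derivation i s : shom i s -> derivation (i + c) (poisson s).
Proof.
move: s; apply: shom_ind => [|a u s hu <- IHs].
  have -> : poisson 0 = fun=> 0.
    by apply/funext => t; exact: lin0 (poisson_linl t).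
  exact: derivation0.
have -> : poisson (a *: mon u + s) = fun t => a *: poisson (mon u) t + poisson s t.
  by apply/funext => t; exact: poisson_linl.
apply: derivation_lin => // {s IHs}; elim: u hu => [|l u IHu].
  have -> : poisson (mon [::]) = fun=> 0 by apply/funext => t; rewrite poisson_mon.
  by move=> _; exact: derivation0.
move=> h; have [hl hu] := iffLR (hword_cons _ _) h.
have -> : poisson (mon (l :: u)) = fun t => ksign ((l.1 + c) * wdeg u) *: (mon u ** ad l t)
    + (ksign l.1 *: (ltr l ** poisson (mon u) t) + 0).
  by apply/funext => t; rewrite addr0 !poisson_mon.
apply: derivation_lin; last (apply: derivation_lin; last exact: derivation0).
  apply: (@derivation_deg _ _ (wdeg u + (l.1 + c))); first by rewrite wdeg_cons; congr podd; zmod.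
  by apply: derivation_mul; [exact: shom_mon|exact: ad_derivation].
apply: (@derivation_deg _ _ (l.1 + (wdeg u + c))); first by rewrite wdeg_cons; congr podd; zmod.
by apply: derivation_mul; [exact: shom_ltr|exact: IHu].
Qed.

Lemma poissonr_ltr j l t : ghom l.1 l.2 -> shom j t ->
  poisson t (ltr l) = ksign (j * l.1) *: ad l t.
Proof.
move=> hl ht; rewrite (poisson_sder ht (shom_ltr hl)); congr (_ *: _).
have dQ := sder_derivation V_closed (poisson_letter (shom_ltr hl)).
apply: (eq_derivation dQ (ad_derivation lieP hl)) => l' hl'.
rewrite (sder_ltr V_closed (poisson_letter (shom_ltr hl))) // /lbr_right !ad_ltr //.
by rewrite [RHS](lbrC lieP).
Qed.

(** [poisson_sder] presents the bracket as a derivation evaluated at [s]; on letters this derivation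
    agrees with the bracket with [t] from the left, hence everywhere. *)
Lemma poissonC i j s t : shom i s -> shom j t ->
  poisson s t = ksign (i * j) *: poisson t s.
Proof.
move=> hs ht; rewrite (poisson_sder hs ht); congr (_ *: _).
have dQ := sder_derivation V_closed (poisson_letter ht).
apply: (eq_derivation dQ (poisson_derivation ht)) => l hl.
by rewrite (sder_ltr V_closed (poisson_letter ht)) // (poissonr_ltr hl ht).
Qed.

Lemma poissonMr i j s t t' : shom i s -> shom j t ->
  poisson s (t ** t') = poisson s t ** t' + ksign ((i + c) * j) *: (t ** poisson s t').
Proof. by move=> hs ht; rewrite (proj2 (poisson_derivation hs) j). Qed.

Lemma poissonDr s t t' : poisson s (t + t') = poisson s t + poisson s t'.
Proof. exact: linD (poisson_linr s) t t'. Qed.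
Lemma poissonZl a s t : poisson (a *: s) t = a *: poisson s t.
Proof. exact: linZ (poisson_linl t) a s. Qed.
Lemma poissonZr a s t : poisson s (a *: t) = a *: poisson s t.
Proof. exact: linZ (poisson_linr s) a t. Qed.
Let J i j s t t' := poisson s (poisson t t')
  = ksign (i + 1) *: poisson (poisson s t) t'
    + ksign ((i + 1) * (j + 1)) *: poisson t (poisson s t').

Let J_letters x y z : ghom x.1 x.2 -> ghom y.1 y.2 -> ghom z.1 z.2 ->
  J x.1 y.1 (ltr x) (ltr y) (ltr z).
Proof.
move: x y z => [i x] [j y] [n z] /= hx hy hz.
have hxy := lb_hom lieP hx hy; have hyz := lb_hom lieP hy hz.
have hxz := lb_hom lieP hx hz.
rewrite /J !poisson_ltr // !ad_ltr // /lbr /= poissonZl !(linZ (proj1 (ad_derivation lieP _))) //.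
rewrite poisson_ltr // !(@ad_ltr _ _ _ _ lieP (_, _) (_, _)) // /lbr /=.
have -> : i + j + c + n + c = i + (j + n + c) + c by zmod.
have -> : j + (i + n + c) + c = i + (j + n + c) + c by zmod.
have h1 : ghom (i + (j + n + c) + c) (lie (lie x y) z).
  have -> : i + (j + n + c) + c = (i + j + c) + n + c by zmod.
  exact: lb_hom.
have h2 : ghom (i + (j + n + c) + c) (lie y (lie x z)).
  have -> : i + (j + n + c) + c = j + (i + n + c) + c by zmod.
  exact: lb_hom.
rewrite (lb_jacobi lieP hx hy hz) [lie _ z + _]addrC ltr_lin //.
by move: c_odd; ksign_cases => //= _; zmod.
Qed.

Let J_derive i j s t : shom i s -> shom j t ->
  (forall z, ghom z.1 z.2 -> J i j s t (ltr z)) -> forall t', J i j s t t'.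
Proof.
move=> hs ht Jz t'.
have der_comm : derivation ((i + c) + (j + c))
    (fun t' => poisson s (poisson t t') - ksign ((i + c) * (j + c)) *: poisson t (poisson s t')).
  apply: derivation_comm; try exact: poisson_derivation.
    by move=> n x hx; apply: (shom_cast (poisson_hom hs hx)); zmod.
  by move=> n x hx; apply: (shom_cast (poisson_hom ht hx)); zmod.
have der_br : derivation ((i + c) + (j + c)) (fun t' => ksign (i + 1) *: poisson (poisson s t) t' + 0).
  apply: derivation_lin; last exact: derivation0.
  apply: derivation_deg (poisson_derivation (poisson_hom hs ht)).
  by congr podd; zmod.
have /= E : poisson s (poisson t t') - ksign ((i + c) * (j + c)) *: poisson t (poisson s t')
    = ksign (i + 1) *: poisson (poisson s t) t' + 0.
  apply: (eq_derivation der_comm der_br) => l hl.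
  by rewrite (Jz l hl); move: c_odd; ksign_cases => //= _; zmod.
rewrite /J -[ksign (i + 1) *: _]addr0 -E.
by move: c_odd; ksign_cases => //= _; zmod.
Qed.

Let J_swap12 i j n s t t' : shom i s -> shom j t -> shom n t' ->
  J i j s t t' -> J j i t s t'.
Proof.
move=> hs ht ht'; rewrite /J => ->; rewrite (poissonC ht hs) poissonZl.
by ksign_cases; zmod.
Qed.

Let J_swap23 i j n s t t' : shom i s -> shom j t -> shom n t' ->
  J i j s t t' -> J i n s t' t.
Proof.
move=> hs ht ht'; rewrite /J (poissonC ht' ht) poissonZr => ->.
rewrite (poissonC (poisson_hom hs ht') ht) (poissonC ht' (poisson_hom hs ht)).
by move: c_odd; ksign_cases => //= _; zmod.
Qed.

(** In its last argument the identity equates two derivations, so it is enough to have letters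
    there. Symmetry of the bracket moves any argument to the last place, and each use of [J_derive]
    frees one argument from being a letter. *)
Lemma poisson_jacobi i j s t t' : shom i s -> shom j t ->
  poisson s (poisson t t') = ksign (i + 1) *: poisson (poisson s t) t'
    + ksign ((i + 1) * (j + 1)) *: poisson t (poisson s t').
Proof.
rewrite -/(J i j s t t').
have J1 x y : ghom x.1 x.2 -> ghom y.1 y.2 -> forall z, J x.1 y.1 (ltr x) (ltr y) z.
  move=> hx hy; apply: J_derive; try exact: shom_ltr.
  by move=> z; exact: J_letters.
have J2 x m z : ghom x.1 x.2 -> shom m z -> forall z', J x.1 m (ltr x) z z'.
  move=> hx hz; apply: J_derive => //; try exact: shom_ltr.
  by move=> y hy; apply: (J_swap23 (shom_ltr hx) (shom_ltr hy) hz); exact: J1.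
move=> hs ht; apply: J_derive => // x hx.
apply: (J_swap23 hs (shom_ltr hx) ht).
by apply: (J_swap12 (shom_ltr hx) hs ht); exact: J2.
Qed.
End Poisson.

Section DerLift.
Variables (k : fieldType) (V : gmod k).
Hypothesis V_closed : gclosed V.
Implicit Types (u v w : word V) (l : int * V) (s t : Sym V) (q : V -> V).
Local Notation "s ** t" := (sym_mul s t) (at level 40, left associativity).

Definition degree1 q : Prop :=
  (forall i x, ghom i x -> ghom (i + 1) (q x)) /\
  forall i a x y, ghom i x -> ghom i y -> q (a *: x + y) = a *: q x + q y.

Lemma degree1_letter q : degree1 q -> letter_map 1 (fun l => ltr (l.1 + 1, q l.2) : Sym V).
Proof.
case=> q_hom q_lin; split=> [l hl|i a x y hx hy].
  by apply: (@shom_ltr _ _ (_, _)); exact: q_hom.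
by rewrite /= (q_lin i) // ltr_lin //; exact: q_hom.
Qed.

Lemma derE q : degree1 q -> der q =1 sder 1 (fun l => ltr (l.1 + 1, q l.2) : Sym V).
Proof.
move=> q_ok; pose G w := \sum_(p < size w) let l := nth (0, 0) w p in
  ksign (wdeg (take p w)) *: mon (take p w ++ (l.1 + 1, q l.2) :: drop p.+1 w).
apply: eq_lin_lift; apply: (srec_unique (G := G)) => [|l w hl hw].
  by rewrite /G big_ord0.
rewrite /G big_ord_recl /= drop0 wdeg_nil scale1r mon_cons; congr (_ + _).
rewrite (lin_sum (sym_mul_linr _)) scaler_sumr; apply: eq_bigr => p _.
by rewrite /= wdeg_cons mon_cons smulZr scalerA mul1r ksignD.
Qed.

Lemma der_derivation q : degree1 q -> derivation 1 (der q : Sym V -> Sym V).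
Proof.
move=> q_ok; rewrite (_ : der q = sder 1 (fun l => ltr (l.1 + 1, q l.2))).
  exact (sder_derivation V_closed (degree1_letter q_ok)).
exact/funext/derE.
Qed.

Lemma der_hom q n s : degree1 q -> shom n s -> shom (n + 1) (der q s).
Proof.
move=> q_ok hs; rewrite derE //.
exact (sder_hom V_closed (degree1_letter q_ok) hs).
Qed.

Lemma der_ltr q l : degree1 q -> ghom l.1 l.2 -> der q (ltr l) = ltr (l.1 + 1, q l.2).
Proof.
move=> q_ok hl; rewrite derE //.
exact (sder_ltr V_closed (degree1_letter q_ok) hl).
Qed.
End DerLift.

(** * Compatibility of the derivation, the Chevalley-Eilenberg operator and the bracket *)

Section BV.
Variables (k : fieldType) (V : gmod k) (c : int) (lie : V -> V -> V) (q : V -> V).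
Hypothesis lieP : lie_bracket c lie.
Hypothesis q_ok : degree1 q.
Hypothesis q_sq : forall i x, ghom i x -> q (q x) = 0.
Hypothesis q_lie : forall i j x y, ghom i x -> ghom j y ->
  q (lie x y) = lie (q x) y + ksign (i + 1) *: lie x (q y).
Let V_closed := lb_closed lieP.
Let c_odd := lb_odd lieP.
Implicit Types (u v w : word V) (l : int * V) (s t : Sym V).
Local Notation "s ** t" := (sym_mul s t) (at level 40, left associativity).
Local Notation poisson := (poisson c lie).
Local Notation ce := (ce c lie).
Local Notation D := (der q : Sym V -> Sym V).
Let D_der : derivation 1 D := der_derivation V_closed q_ok.
Let D_lin := proj1 D_der.
Let D_hom n s : shom n s -> shom (n + 1) (D s) := der_hom V_closed q_ok.
Let D_mul n s t (hs : shom n s) : D (s ** t) = D s ** t + ksign (1 * n) *: (s ** D t) :=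
  proj2 D_der n s t hs.

Lemma ce_mul n s t : shom n s ->
  ce (s ** t) = ce s ** t + ksign n *: (s ** ce t) + poisson s t.
Proof.
move=> hs; have ce_lin := ce_linear lieP.
apply: (shom_lin_ind (f := fun s => ce (s ** t))
  (g := fun s => ce s ** t + ksign n *: (s ** ce t) + poisson s t)) hs => [||u].
- by move=> a x y; rewrite smulDl smulZl ce_lin.
- by move=> a x y; rewrite ce_lin !smulE (poisson_linl lieP); ksign_cases; zmod.
elim: u n => [|l u IHu] n.
  rewrite wdeg_nil => _ <-; rewrite -/(sym_one V) !sym_mul1 (ce_one lieP) smul0l.
  by rewrite (poisson_mon lieP) // scale1r addr0 add0r.
case/hword_cons=> hl hu <-.
have cons s' : ce (ltr l ** s') = ad c lie l s' + ksign l.1 *: (ltr l ** ce s').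
  apply: (eq_sym_lin (f := fun s' => ce (ltr l ** s')) (g := fun s' =>
    ad c lie l s' + ksign l.1 *: (ltr l ** ce s'))) s' => [||w hw].
  - by move=> a x y; rewrite smulDr smulZr ce_lin.
  - move=> a x y; rewrite (proj1 (ad_derivation lieP hl)) ce_lin !smulE.
    by ksign_cases; zmod.
  - by rewrite -mon_cons ce_cons.
rewrite mon_cons -sym_mulA !cons (IHu (wdeg u)) // -mon_cons.
rewrite (proj2 (ad_derivation lieP hl) (wdeg u)); last exact: shom_mon.
rewrite !(poisson_mon lieP) //; last exact/hword_cons.
rewrite /= wdeg_cons mon_cons !smulE !sym_mulA.
by ksign_cases; zmod.
Qed.

Lemma D_ltr l : ghom l.1 l.2 -> D (ltr l) = ltr (l.1 + 1, q l.2).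
Proof. exact: (der_ltr V_closed q_ok). Qed.

(** The operator [T] is a derivation of the bracket; the signs are those of an odd operator and an
    odd bracket. *)
Let K (T : Sym V -> Sym V) i s t :=
  T (poisson s t) + poisson (T s) t + ksign i *: poisson s (T t) = 0.

Let K_swap e T i j s t : podd e -> linear T ->
  (forall n s, shom n s -> shom (n + e) (T s)) ->
  shom i s -> shom j t -> K T i s t -> K T j t s.
Proof.
move=> e_odd T_lin T_hom hs ht; rewrite /K (poissonC lieP ht hs) (linZ T_lin).
rewrite (poissonC lieP (T_hom _ _ ht) hs) (poissonC lieP ht (T_hom _ _ hs)) => E.
rewrite -[RHS](scaler0 _ (ksign (i * j))) -E !scalerDr.
by move: e_odd; ksign_cases => //= _; zmod.
Qed.

Let K_derive e T i s : derivation e (fun t =>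
    T (poisson s t) + poisson (T s) t + ksign i *: poisson s (T t)) ->
  (forall l, ghom l.1 l.2 -> K T i s (ltr l)) -> forall t, K T i s t.
Proof. by move=> dK; exact: (eq_derivation dK (derivation0 _ _)). Qed.

(** A derivation in [t] is determined by letters, and [K_swap] exchanges the arguments to reduce [s]
    as well. Only the defect has to be a derivation, not [T] itself, so that [T] can be [ce]. *)
Let K_all e T : podd e -> linear T -> (forall n s, shom n s -> shom (n + e) (T s)) ->
  (forall i s, shom i s -> derivation (i + c + e) (fun t =>
    T (poisson s t) + poisson (T s) t + ksign i *: poisson s (T t))) ->
  (forall l l', ghom l.1 l.2 -> ghom l'.1 l'.2 -> K T l.1 (ltr l) (ltr l')) ->
  forall i s t, shom i s -> K T i s t.
Proof.
move=> e_odd T_lin T_hom T_der T_ltr i s t hs.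
apply: (K_derive (T_der _ _ hs)) => l hl.
apply: (K_swap e_odd T_lin T_hom (shom_ltr hl) hs).
by apply: (K_derive (T_der _ _ (shom_ltr hl))) => l' hl'; exact: T_ltr.
Qed.

Lemma D_poisson i s t : shom i s ->
  D (poisson s t) + poisson (D s) t + ksign i *: poisson s (D t) = 0.
Proof.
move: i s t; apply: (@K_all 1) => // [i s hs|[i x] [j y] /= hx hy].
- have P_hom n t : shom n t -> shom (n + (i + c)) (poisson s t).
    by move=> ht; apply: (shom_cast (poisson_hom lieP hs ht)); zmod.
  have dc := derivation_comm D_der (poisson_derivation lieP hs) D_hom P_hom.
  have dD := poisson_derivation lieP (D_hom hs).
  have := derivation_lin 1 (derivation_deg _ dD) (derivation_deg _ dc).
  move=> /(_ (i + c + 1)) dl; rewrite (_ : (fun t => _) = fun t => 1 *: poisson (D s) t +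
    (D (poisson s t) - ksign (1 * (i + c)) *: poisson s (D t))).
    by apply: dl; congr podd; zmod.
  by apply/funext => t; move: c_odd; ksign_cases => //= _; zmod.
have hqx := proj1 q_ok _ _ hx; have hqy := proj1 q_ok _ _ hy.
have hxy := lb_hom lieP hx hy.
rewrite /K !D_ltr // !(poisson_ltr lieP) // !(@ad_ltr _ _ _ _ lieP (_, _) (_, _)) //.
rewrite /lbr /= (linZ D_lin) D_ltr //=.
have -> : i + 1 + j + c = i + j + c + 1 by zmod.
have -> : i + (j + 1) + c = i + j + c + 1 by zmod.
have h1 : ghom (i + j + c + 1) (lie (q x) y).
  have -> : i + j + c + 1 = (i + 1) + j + c by zmod.
  exact: (lb_hom lieP).
have h2 : ghom (i + j + c + 1) (lie x (q y)).
  have -> : i + j + c + 1 = i + (j + 1) + c by zmod.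
  exact: (lb_hom lieP).
rewrite (q_lie hx hy) [lie _ y + _]addrC ltr_lin //.
by ksign_cases => /=; zmod.
Qed.

Let ce_deg n s : shom n s -> shom (n + c) (ce s) := @ce_hom _ _ _ _ lieP n s.

(** The failure of [ce] to be a derivation of the product contributes double brackets, which cancel
    by the Jacobi identity; so the defect is a derivation. On letters it vanishes because [ce] kills
    every letter. *)
Lemma ce_poisson i s t : shom i s ->
  ce (poisson s t) + poisson (ce s) t + ksign i *: poisson s (ce t) = 0.
Proof.
move: i s t; apply: (@K_all c) => // [|i s hs|l l' hl hl'].
- exact: ce_linear.
- split=> [a t t'|n t t' ht].
    rewrite (ce_linear lieP) !(poisson_linr lieP) (ce_linear lieP).
    by ksign_cases; zmod.
  have Pst := poisson_hom lieP hs ht.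
  rewrite (poissonMr lieP _ hs ht) (poissonMr lieP _ (ce_deg hs) ht) (ce_mul _ ht).
  rewrite (linD (ce_linear lieP)) (linZ (ce_linear lieP)) (ce_mul _ Pst) (ce_mul _ ht).
  rewrite !(poissonDr lieP) !(poissonZr lieP) (poissonMr lieP _ hs ht).
  rewrite (poissonMr lieP _ hs (ce_deg ht)) (poisson_jacobi lieP _ hs ht) !smulE.
  by move: c_odd; ksign_cases => //= _; zmod.
rewrite /K !(ce_ltr lieP) // (poisson_ltr lieP) // (ad_ltr lieP) //.
rewrite (linZ (ce_linear lieP)) (ce_ltr lieP); last exact: lb_hom.
by rewrite (lin0 (poisson_linl lieP _)) (lin0 (poisson_linr lieP _)) !scaler0 !addr0.
Qed.

Lemma D_sq s : D (D s) = 0.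
Proof.
have dDD : derivation 2 (fun s => D (D s)).
  split=> [a t t'|n t t' ht]; first by rewrite !D_lin.
  rewrite (D_mul _ ht) (linD D_lin) (linZ D_lin) (D_mul _ (D_hom ht)) (D_mul _ ht).
  by ksign_cases => /=; zmod.
apply: (eq_derivation dDD (derivation0 _ _)) => l hl.
rewrite D_ltr // D_ltr /=; last exact: (proj1 q_ok).
by rewrite (q_sq hl) ltr0.
Qed.

(** The anticommutator is a derivation because the brackets by which [ce] fails to be one cancel by
    [D_poisson]. On letters both terms vanish, [ce] being zero there. *)
Lemma D_ce s : D (ce s) + ce (D s) = 0.
Proof.
have ce_lin := ce_linear lieP.
have dDc : derivation (1 + c) (fun s => D (ce s) + ce (D s)).
  split=> [a t t'|n t t' ht].
    by rewrite !(ce_lin, D_lin); ksign_cases; zmod.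
  rewrite (D_mul _ ht) (linD ce_lin) (linZ ce_lin) (ce_mul _ (D_hom ht)) (ce_mul _ ht).
  rewrite (ce_mul _ ht) !(linD D_lin) (linZ D_lin) (D_mul _ (ce_deg ht)).
  rewrite (D_mul _ ht); have := D_poisson t' ht.
  (* This solves [D_poisson] for the derivative of the bracket. *)
  move=> /(congr1 (fun z => z - (poisson (D t) t' + ksign n *: poisson t (D t')))).
  rewrite sub0r -[X in X - _]addrA addrK => ->.
  by rewrite !smulE; move: c_odd; ksign_cases => //= _; zmod.
apply: (eq_derivation dDc (derivation0 _ _)) => l hl.
rewrite (ce_ltr lieP hl) (lin0 D_lin) add0r D_ltr // (ce_ltr lieP) //.
exact: (proj1 q_ok).
Qed.

Lemma ce_sq s : ce (ce s) = 0.
Proof.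
have ce_lin := ce_linear lieP.
have dcc : derivation (c + c) (fun s => ce (ce s)).
  split=> [a t t'|n t t' ht]; first by rewrite !ce_lin.
  rewrite (ce_mul _ ht) !(linD ce_lin) (linZ ce_lin) (ce_mul _ (ce_deg ht)) (ce_mul _ ht).
  have := ce_poisson t' ht.
  move=> /(congr1 (fun z => z - (poisson (ce t) t' + ksign n *: poisson t (ce t')))).
  rewrite sub0r -[X in X - _]addrA addrK => ->.
  by move: c_odd; ksign_cases => //= _; zmod.
apply: (eq_derivation dcc (derivation0 _ _)) => l hl.
by rewrite (ce_ltr lieP) // (lin0 ce_lin).
Qed.
End BV.

(** * Power series *)

Section Triangle.
Variable M : nmodType.
Implicit Type F : nat -> nat -> nat -> M.

(** The sum over all i + j + l = n, as it occurs in coefficient n of a product of three series. *)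
Definition triangle F n : M := \sum_(i < n.+1) \sum_(j < (n - i).+1) F i j (n - i - j)%N.

Lemma triangle_last F n :
  triangle F n = \sum_(l < n.+1) \sum_(i < l.+1) F i (l - i)%N (n - l)%N.
Proof.
rewrite /triangle (Defs.triangular_sum (fun i j => F i j (n - i - j)%N)).
apply: eq_bigr => -[l lt_l] _; apply: eq_bigr => -[i lt_i] _ /=.
by rewrite -subnDA subnKC.
Qed.

Lemma triangle_swap F n : triangle F n = triangle (fun i j => F j i) n.
Proof.
rewrite !triangle_last; apply: eq_bigr => l _.
rewrite (reindex_inj rev_ord_inj) /=; apply: eq_bigr => -[i lt_i] _ /=.
by rewrite subSS subKn -1?ltnS.
Qed.

Lemma eq_triangle F G n : (forall i j l, F i j l = G i j l) -> triangle F n = triangle G n.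
Proof. by move=> FG; apply: eq_bigr => i _; apply: eq_bigr => j _. Qed.
End Triangle.

Section Cauchy.
Variables (k : fieldType) (U V W : lmodType k) (B : U -> V -> W).
Hypothesis B_linl : forall y, linear (B^~ y).
Hypothesis B_linr : forall x, linear (B x).

Definition cauchy (x : powser U) (y : powser V) : powser W :=
  fun n => \sum_(i < n.+1) B (x i) (y (n - i)%N).

Lemma cauchy_rev x y n : cauchy x y n = \sum_(i < n.+1) B (x (n - i)%N) (y i).
Proof.
rewrite /cauchy (reindex_inj rev_ord_inj); apply: eq_bigr => -[i lt_i] _ /=.
by rewrite subSS subKn -1?ltnS.
Qed.

Lemma cauchy_linl y : linear (cauchy^~ y).
Proof.
move=> p x x'; apply/funext => n.
rewrite -[RHS]/(psact p (cauchy x y) n + cauchy x' y n) /cauchy /psact.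
under [X in _ = X + _]eq_bigr do rewrite scaler_sumr.
rewrite -[X in _ = X + _]/(triangle (fun i j l => p i *: B (x j) (y l)) n) triangle_last -big_split.
apply: eq_bigr => l _; rewrite -[(p *: x + x') l]/(psact p x l + x' l).
rewrite (linD (B_linl _)) (lin_sum (B_linl _)); congr (_ + _).
by apply: eq_bigr => i _; rewrite (linZ (B_linl _)).
Qed.

Lemma cauchy_linr x : linear (cauchy x).
Proof.
move=> p y y'; apply/funext => n.
rewrite -[RHS]/(psact p (cauchy x y) n + cauchy x y' n) /psact.
under [X in _ = X + _]eq_bigr do rewrite scaler_sumr.
rewrite -[X in _ = X + _]/(triangle (fun i j l => p i *: B (x j) (y l)) n) triangle_swap -big_split.
apply: eq_bigr => l _; rewrite -[(p *: y + y') _]/(psact p y _ + y' _).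
rewrite (linD (B_linr _)) (lin_sum (B_linr _)); congr (_ + _).
by apply: eq_bigr => i _; rewrite (linZ (B_linr _)).
Qed.
End Cauchy.

Section CauchyTriple.
Variables (k : fieldType) (U V W T S S' : lmodType k).

Lemma cauchyr (B : U -> S -> T) (B' : V -> W -> S) x y z n : (forall u, linear (B u)) ->
  cauchy B x (cauchy B' y z) n = triangle (fun i j l => B (x i) (B' (y j) (z l))) n.
Proof. by move=> B_lin; apply: eq_bigr => i _; rewrite (lin_sum (B_lin _)). Qed.

Lemma cauchyl (B : S -> W -> T) (B' : U -> V -> S) x y z n : (forall u, linear (B^~ u)) ->
  cauchy B (cauchy B' x y) z n = triangle (fun i j l => B (B' (x i) (y j)) (z l)) n.
Proof.
move=> B_lin; rewrite triangle_last; apply: eq_bigr => i _.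
by rewrite (lin_sum (B_lin _)).
Qed.
End CauchyTriple.

Section Coefficients.
Variables (k : fieldType) (M : lmodType k).
Implicit Types (x y : powser M).

Lemma ps_ksign i x n : ((ksign i : powser k) *: x) n = ksign i *: x n.
Proof. by rewrite !ksignE; case: podd; rewrite /= ?expr0 ?expr1 ?scale1r ?scaleN1r. Qed.

Lemma ps_X x n : (psX k *: x) n = if n is n'.+1 then x n' else 0.
Proof.
rewrite -[LHS]/(psact _ _ _) /psact big_ord_recl /psX /= scale0r add0r.
case: n => [|n]; first by rewrite big_ord0.
rewrite big_ord_recl /= subn1 scale1r big1 ?addr0 // => i _.
by rewrite scale0r.
Qed.

Lemma ps_sum (I : Type) (r : seq I) (F : I -> powser M) n :
  (\sum_(i <- r) F i) n = \sum_(i <- r) F i n.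
Proof. by elim/big_rec2: _ => // i y x _ <-. Qed.
End Coefficients.

Section PowserBD.
Variables (k : fieldType) (V : gmod k) (c m : int) (lie : V -> V -> V) (q : V -> V).
Hypothesis lieP : lie_bracket c lie.
Hypothesis q_ok : degree1 q.
Hypothesis q_sq : forall i x, ghom i x -> q (q x) = 0.
Hypothesis q_lie : forall i j x y, ghom i x -> ghom j y ->
  q (lie x y) = lie (q x) y + ksign (i + 1) *: lie x (q y).
Hypothesis m_even : podd m = false.
Let V_closed := lb_closed lieP.
Let c_odd := lb_odd lieP.
Local Notation poisson := (poisson c lie).
Local Notation ce := (ce c lie).

Variables e r : int.
(** [e + c = 1] gives the variable times [ce] degree 1. In the algebra shifted by [m] an operation
    of two arguments gains [m] in degree, whence [m] for the product and [m + c] for the bracket. *)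
Hypotheses (eE : e = 1 - c) (rE : r = m + c).
Let A := gshift m (gpowser e (Sym V)).

Definition ps_mul (x y : A) : A := cauchy (@sym_mul k V) x y.
Definition ps_one : A := fun n => if n is 0%N then sym_one V else 0.
Definition ps_bracket (x y : A) : A := cauchy (poisson : Sym V -> Sym V -> Sym V) x y.
Definition ps_diff (x : A) : A := fun n =>
  der q (x n) + (if n is n'.+1 then ce (x n') else 0).

Let hA i (x : A) n : ghom i x -> shom (i + m - n%:Z * e) (x n).
Proof. exact. Qed.

Let e_even : podd e = false.
Proof. by rewrite eE poddD poddN c_odd. Qed.

(** The variable and the shift have even degree, so all coefficients of a homogeneous series have
    its parity, and signs can be computed from the degree of the series. *)
Let podd_deg i n : podd (i + m - n%:Z * e) = podd i.
Proof. by rewrite poddD poddN poddM poddD m_even e_even andbF !addbF. Qed.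

Let ksign_deg (R : pzRingType) i n : ksign (i + m - n%:Z * e) = ksign i :> R.
Proof. by rewrite !ksignE podd_deg. Qed.

Lemma ps_graded : is_graded e A.
Proof.
split=> [n j|n x y hx hy j|a n p x hp hx j|s x s_uniq hx sum0 n ns].
- exact: shom0.
- by apply: shomD; [exact: hx|exact: hy].
- rewrite -[(p *: x) j]/(psact p x j) /psact; apply: rpred_sum => -[i lt_i] _ /=.
  have [->|/hp ->] := eqVneq (p i) 0; first by rewrite scale0r; exact: shom0.
  apply: spanZ; have := hx (j - i)%N; rewrite -subzn // mulrBl.
  by congr (ghom _ _); zmod.
(* [f i] is the degree in [Sym] of the coefficient [j] of an element of degree [i]. As [f] is
   injective, independence in [Sym] applies to each coefficient. *)
- apply/funext => j; pose f (i : int) := i + m - j%:Z * e.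
  pose x' (N : int) : Sym V := x (N - m + j%:Z * e) j.
  have f_inj : injective f by move=> i i'; rewrite /f => /(addIr _)/(addIr _).
  have x'f i : x' (f i) = x i j by rewrite /x' /f; congr (x _ j); zmod.
  have := @shom_indep k V V_closed [seq f i | i <- s] x'.
  rewrite map_inj_uniq // => /(_ s_uniq) H; rewrite -x'f; apply: H; last exact: map_f.
    move=> N; rewrite /x'; apply: (shom_cast (hA j (hx (N - m + j%:Z * e)))); zmod.
  rewrite big_map -[RHS](congr1 (fun z : powser _ => z j) sum0) ps_sum.
  by apply: eq_bigr => i _; exact: x'f.
Qed.

Lemma ps_diff_rel i (a b : A) : ghom i a ->
  ps_diff (ps_mul a b) = ps_mul (ps_diff a) b + (ksign i : powser k) *: ps_mul a (ps_diff b)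
    + psX k *: ps_bracket a b.
Proof.
move=> ha; have [D_lin DM] := der_derivation V_closed q_ok.
have ce_lin := ce_linear lieP; apply/funext => n.
rewrite -[RHS]/(ps_mul (ps_diff a) b n + (_ *: ps_mul a (ps_diff b)) n + (psX k *: ps_bracket a b) n).
rewrite ps_ksign ps_X.
have DE : der q (ps_mul a b n) = cauchy (@sym_mul k V) (fun n => der q (a n)) b n
    + ksign i *: cauchy (@sym_mul k V) a (fun n => der q (b n)) n.
  rewrite (lin_sum D_lin) scaler_sumr -big_split; apply: eq_bigr => j _.
  by rewrite (DM _ _ _ (hA j ha)) mul1r ksign_deg.
have ceE n' : ce (ps_mul a b n') = cauchy (@sym_mul k V) (fun n => ce (a n)) b n'
    + ksign i *: cauchy (@sym_mul k V) a (fun n => ce (b n)) n' + ps_bracket a b n'.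
  rewrite (lin_sum ce_lin) scaler_sumr -big_split -big_split; apply: eq_bigr => j _.
  by rewrite (ce_mul lieP _ (hA j ha)) ksign_deg.
have E1 : ps_mul (ps_diff a) b n = cauchy (@sym_mul k V) (fun n => der q (a n)) b n
    + (if n is n'.+1 then cauchy (@sym_mul k V) (fun n => ce (a n)) b n' else 0).
  rewrite /ps_mul /cauchy; under eq_bigr do rewrite /ps_diff smulDl.
  rewrite big_split; congr (_ + _); case: n {DE} => [|n]; first by rewrite big_ord1 smul0l.
  by rewrite big_ord_recl /= smul0l add0r.
have E2 : ps_mul a (ps_diff b) n = cauchy (@sym_mul k V) a (fun n => der q (b n)) n
    + (if n is n'.+1 then cauchy (@sym_mul k V) a (fun n => ce (b n)) n' else 0).
  rewrite /ps_mul /cauchy; under eq_bigr do rewrite /ps_diff smulDr.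
  rewrite big_split; congr (_ + _); case: n {DE E1} => [|n]; first by rewrite big_ord1 smul0r.
  rewrite big_ord_recr /= subnn smul0r addr0; apply: eq_bigr => -[j lt_j] _ /=.
  by rewrite subSn // -ltnS.
rewrite E1 E2 {1}/ps_diff DE; case: n {DE E1 E2} => [|n].
  by rewrite !addr0.
by rewrite ceE scalerDr; zmod.
Qed.

Lemma powser_BD : is_BD_algebra r m ps_mul ps_one ps_bracket ps_diff.
Proof.
have [D_lin DM] := der_derivation V_closed q_ok; have ce_lin := ce_linear lieP.
rewrite rE; have Mlinl := @sym_mul_linl k V; have Mlinr := @sym_mul_linr k V.
have Plinl := poisson_linl lieP; have Plinr := poisson_linr lieP.
split.
- by rewrite -/(podd _) poddD m_even c_odd.
- by rewrite -/(podd _) m_even.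
- have -> : 1 - (m + c) + m = e by rewrite eE; zmod.
  exact: ps_graded.
- exact: cauchy_linl.
- exact: cauchy_linr.
- move=> i j a b ha hb n; apply: rpred_sum => -[l lt_l] _ /=.
  apply: (shom_cast (shom_mul (hA l ha) (hA (n - l)%N hb))).
  by rewrite -subzn // mulrBl; zmod.
- move=> a b d; apply/funext => n; rewrite /ps_mul cauchyr // cauchyl //.
  by apply: eq_triangle => i j l; exact: sym_mulA.
- move=> i j a b ha hb; apply/funext => n; rewrite ps_ksign /ps_mul (cauchy_rev _ b).
  rewrite scaler_sumr; apply: eq_bigr => l _.
  rewrite (sym_mulC (hA l ha) (hA (n - l)%N hb)); congr (_ *: _).
  by rewrite !ksignE !poddM !podd_deg.
- move=> n; have h1 : shom 0 (sym_one V).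
    by rewrite -(wdeg_nil V); exact: shom_mon.
  rewrite addNr sub0r; case: n => [|n]; last exact: shom0.
  by rewrite mul0r oppr0.
- move=> a; apply/funext => n; rewrite /ps_mul /cauchy big_ord_recl /= subn0 sym_mul1.
  by rewrite big1 ?addr0 // => l _; rewrite smul0l.
- exact: cauchy_linl.
- exact: cauchy_linr.
- move=> i j a b ha hb n; apply: rpred_sum => -[l lt_l] _ /=.
  apply: (shom_cast (poisson_hom lieP (hA l ha) (hA (n - l)%N hb))).
  by rewrite -subzn // mulrBl; zmod.
- move=> i j a b ha hb; apply/funext => n; rewrite ps_ksign /ps_bracket (cauchy_rev _ b).
  rewrite scaler_sumr; apply: eq_bigr => l _.
  rewrite (poissonC lieP (hA l ha) (hA (n - l)%N hb)); congr (_ *: _).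
  by rewrite !ksignE !poddM !podd_deg.
- move=> i j l a b d ha hb hd; apply/funext => n.
  rewrite -[RHS]/((_ *: ps_bracket (ps_bracket a b) d) n + (_ *: ps_bracket b (ps_bracket a d)) n).
  rewrite !ps_ksign /ps_bracket !cauchyr // cauchyl //.
  (* In the last term [b] comes before [a]; swapping two indices of the triple sum lets the three
     terms be compared summand by summand. *)
  rewrite [X in _ + _ *: X]triangle_swap !scaler_sumr -big_split; apply: eq_bigr => x _ /=.
  rewrite !scaler_sumr -big_split; apply: eq_bigr => y _ /=.
  rewrite (poisson_jacobi lieP _ (hA x ha) (hA y hb)); move: (podd_deg i x) (podd_deg j y).
  move: (i + m - _) (j + m - _) => I J EI EJ; rewrite !ksignE !poddE EI EJ m_even c_odd.
  by rewrite !(addbF, addFb).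
- move=> i j l a b d ha hb hd; apply/funext => n.
  rewrite -[RHS]/(ps_mul (ps_bracket a b) d n + (_ *: ps_mul b (ps_bracket a d)) n).
  rewrite !ps_ksign /ps_bracket /ps_mul !cauchyr // cauchyl //.
  rewrite [X in _ + _ *: X]triangle_swap !scaler_sumr -big_split; apply: eq_bigr => x _ /=.
  rewrite !scaler_sumr -big_split; apply: eq_bigr => y _ /=.
  rewrite (poissonMr lieP _ (hA x ha) (hA y hb)); move: (podd_deg i x) (podd_deg j y).
  move: (i + m - _) (j + m - _) => I J EI EJ; rewrite !ksignE !poddE EI EJ m_even c_odd.
  by rewrite !(addbF, addFb).
- move=> p x y; apply/funext => n.
  rewrite -[RHS]/(psact p (ps_diff x) n + ps_diff y n) /psact /ps_diff.
  under [X in _ = X + _]eq_bigr do rewrite scalerDr.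
  rewrite big_split -[(p *: x + y) n]/(psact p x n + y n) (linD D_lin) (lin_sum D_lin).
  have -> : \sum_(i < n.+1) der q (p i *: x (n - i)%N) = \sum_(i < n.+1) p i *: der q (x (n - i)%N).
    by apply: eq_bigr => i _; rewrite (linZ D_lin).
  rewrite -!addrA; congr (_ + _); rewrite [RHS]addrCA; congr (_ + _).
  case: n => [|n]; first by rewrite big_ord1 scaler0 addr0.
  rewrite -[(p *: x + y) n]/(psact p x n + y n) (linD ce_lin) (lin_sum ce_lin); congr (_ + _).
  rewrite [in RHS]big_ord_recr /= subnn scaler0 addr0; apply: eq_bigr => -[j lt_j] _ /=.
  by rewrite subSn -1?ltnS // (linZ ce_lin).
- move=> i a ha n; apply: shomD.
    by apply: (shom_cast (der_hom V_closed q_ok (hA n ha))); zmod.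
  case: n => [|n]; first exact: shom0.
  apply: (shom_cast (ce_hom lieP (hA n ha))); have -> : c = 1 - e by rewrite eE; zmod.
  rewrite -addn1 PoszD mulrDl mul1r; zmod.
(* A coefficient of the square consists of the square of [der q], of the anticommutator with [ce]
   one place lower, and of the square of [ce] two places lower. *)
- move=> a; apply/funext => n; rewrite -[RHS]/(0 : Sym V) /ps_diff.
  rewrite (linD D_lin) (D_sq lieP) // add0r; case: n => [|n]; first by rewrite (lin0 D_lin) addr0.
  rewrite (linD ce_lin) addrA (D_ce lieP) // add0r; case: n => [|n]; first exact: lin0.
  exact: ce_sq.
- exact: ps_diff_rel.
Qed.
End PowserBD.

(** * Signs of reorderings *)

Section PairProducts.
Variables (R : comNzRingType) (X : eqType).
Implicit Types (F : X -> X -> R) (s t u : seq X).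

Fixpoint pairprod F s : R :=
  if s is x :: s' then (\prod_(y <- s') F x y) * pairprod F s' else 1.

Lemma pairprod_perm F s t : (forall x y, F x y = F y x) -> perm_eq s t ->
  pairprod F s = pairprod F t.
Proof.
move=> F_sym; have mid x a b : pairprod F (a ++ x :: b) = pairprod F (x :: a ++ b).
  elim: a => [|y a IHa] //=; rewrite IHa /= !big_cat !big_cons /= [F x y]F_sym.
  rewrite big_cat /=; ring.
elim: s t => [|x s IHs] t st; first by move: st; rewrite perm_sym => /perm_nilP->.
have: x \in t by rewrite -(perm_mem st) mem_head.
move=> xt; case/splitPr: xt st => a b st; rewrite mid /=.
have {}st : perm_eq s (a ++ b).
  by rewrite -(perm_cons x); apply: perm_trans st _; exact: (permEl (perm_catCA a [:: x] b)).
by rewrite (IHs _ st) (perm_big _ st).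
Qed.

Lemma eq_pairprod F G s : uniq s -> {in s &, forall x y, x != y -> F x y = G x y} ->
  pairprod F s = pairprod G s.
Proof.
elim: s => //= x s IHs /andP[xs us] FG; rewrite IHs //; last first.
  by move=> y z ys zs; apply: FG; rewrite inE ?ys ?zs orbT.
congr (_ * _); rewrite !big_seq; apply: eq_bigr => y ys; apply: FG; rewrite ?mem_head //.
  by rewrite inE ys orbT.
by apply: contraNneq xs => ->.
Qed.

Lemma pairprodM F G s : pairprod F s * pairprod G s = pairprod (fun x y => F x y * G x y) s.
Proof. by elim: s => [|x s IHs] /=; rewrite ?mulr1 // -IHs big_split /= mulrACA. Qed.

(* As a product over unordered pairs the sign no longer depends on the order in which
   [s] lists them, which makes its multiplicativity a pointwise statement. *)
Definition disagree s t x y : bool :=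
  (index x s < index y s)%N && (index y t < index x t)%N ||
  (index y s < index x s)%N && (index x t < index y t)%N.

Lemma disagreeC s t x y : disagree s t x y = disagree s t y x.
Proof. exact: orbC. Qed.

Lemma osgn_pairprod s t : uniq s ->
  osgn s t = pairprod (fun x y => (-1) ^+ disagree s t x y) s.
Proof.
(* [disagree] looks up indices in the whole list, so the induction runs over suffixes, with the
   entries already read kept in a prefix [p]. *)
rewrite /osgn -[s in disagree s]cat0s -[s in uniq s]cat0s.
elim: s [::] => [|x s IHs] p //= us.
have us' : uniq (rcons p x ++ s) by rewrite cat_rcons.
rewrite exprD (IHs _ us') cat_rcons; congr (_ * _).
move: us; rewrite cat_uniq /= negb_or => /and4P[up /andP[xp /hasPn sp] xs us].
elim: s {IHs us'} xs us sp => [|y s IHs]; rewrite ?big_nil //= inE negb_or.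
move=> /andP[xy xs] /andP[ys us] sp; rewrite big_cons exprD.
have iy : index y (p ++ x :: y :: s) = (size p).+1.
  by rewrite index_cat (negPf (sp _ (mem_head _ _))) /= (negPf xy) eqxx addn1.
have ix z : index x (p ++ x :: z) = size p by rewrite index_cat (negPf xp) /= eqxx addn0.
have ltF : ((size p).+1 < size p)%N = false by rewrite ltnNge leqnSn.
congr (_ * _); first by rewrite /disagree iy ix ltnSn ltF orbF.
rewrite IHs //; last by move=> z zs; apply: sp; rewrite inE zs orbT.
rewrite !big_seq; apply: eq_bigr => z zs; congr (_ ^+ (nat_of_bool _)).
have zp : z \notin p by apply: sp; rewrite inE zs orbT.
have xz : (x == z) = false by apply: contraNF xs => /eqP->.
have yz : (y == z) = false by apply: contraNF ys => /eqP->.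
have ge n : (size p + n.+1 < size p)%N = false by rewrite ltnNge leq_addr.
have lt n : (size p < size p + n.+1)%N by rewrite -addSnnS leq_addr.
rewrite /disagree !ix !index_cat (negPf zp) /= xz yz /=.
by rewrite !lt !ge.
Qed.

(** For each single pair, disagreement between [s] and [u] is the exclusive or of those between [s]
    and [t] and between [t] and [u]. *)
Lemma osgnM s t u : uniq s -> perm_eq s t -> perm_eq t u ->
  osgn s t * osgn t u = osgn s u :> R.
Proof.
move=> us st tu; have ut : uniq t by rewrite -(perm_uniq st).
rewrite !osgn_pairprod // (pairprod_perm _ (s := t) (t := s)) 1?perm_sym //; last first.
  by move=> x y; rewrite disagreeC.
rewrite pairprodM; apply: eq_pairprod => // x y xs ys xy; rewrite -signr_addb.
have neq v : perm_eq s v -> (index x v == index y v) = false.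
  move=> sv; apply: contraNF xy => /eqP /(congr1 (nth x v)).
  by rewrite !nth_index -?(perm_mem sv) // => ->.
have {}neq v : perm_eq s v -> (index y v < index x v)%N = ~~ (index x v < index y v)%N.
  by move=> /neq xy'; rewrite ltnNge leq_eqVlt xy'.
rewrite /disagree !neq ?(perm_trans st tu) // /=.
by do 3!case: (index x _ < index y _)%N.
Qed.
End PairProducts.

Section Signs.
Variables (R : comNzRingType) (X : eqType).
Implicit Types (s t a b : seq X).

Lemma eq_inversions t t' s :
  {in s &, forall x y, (index y t < index x t)%N = (index y t' < index x t')%N} ->
  inversions t s = inversions t' s.
Proof.
elim: s => //= x s IHs tt'; rewrite IHs; last first.
  by move=> y z ys zs; apply: tt'; rewrite inE ?ys ?zs orbT.
congr (_ + _)%N; apply: eq_in_count => y ys; apply: tt'; rewrite ?mem_head //.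
by rewrite inE ys orbT.
Qed.

Lemma inversions_id s : uniq s -> inversions s s = 0%N.
Proof.
elim: s => //= x s IHs /andP[xs us]; rewrite eqxx.
have -> : count (fun y => index y (x :: s) < 0)%N s = 0%N.
  by apply/eqP; rewrite -leqn0 leqNgt -has_count; apply/hasPn.
rewrite -[RHS](IHs us); apply: eq_inversions => y z ys zs /=.
have xy : (x == y) = false by apply: contraNF xs => /eqP->.
have xz : (x == z) = false by apply: contraNF xs => /eqP->.
by rewrite xy xz ltnS.
Qed.

Lemma osgn_cons x s t : x \notin s -> perm_eq s t -> osgn (x :: s) (x :: t) = osgn s t :> R.
Proof.
move=> xs st; rewrite /osgn /= eqxx; have -> : count (fun y => index y (x :: t) < 0)%N s = 0%N.
  by apply/eqP; rewrite -leqn0 leqNgt -has_count; apply/hasPn => y ys; rewrite ltn0.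
congr (_ ^+ _); apply: eq_inversions => y z ys zs /=.
have xy : (x == y) = false by apply: contraNF xs => /eqP->.
have xz : (x == z) = false by apply: contraNF xs => /eqP->.
by rewrite xy xz ltnS.
Qed.

Lemma osgn_catl a s t : uniq (a ++ s) -> perm_eq s t ->
  osgn (a ++ s) (a ++ t) = osgn s t :> R.
Proof.
elim: a => //= x a IHa /andP[xa ua] st; rewrite osgn_cons ?IHa //.
by rewrite perm_cat2l.
Qed.

Lemma inversions_catr b s t : uniq (t ++ b) -> {subset s <= t} ->
  inversions (t ++ b) (s ++ b) = inversions t s.
Proof.
move=> utb; have /and3P[ut tb ub] : [&& uniq t, ~~ has (mem t) b & uniq b].
  by move: utb; rewrite cat_uniq.
have bt y : y \in b -> (y \in t) = false by move/(hasPn tb)/negPf.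
elim: s => [|x s IHs] st /=.
  rewrite -(inversions_id ub); apply: eq_inversions => y z yb zb.
  by rewrite !index_cat !bt // ltn_add2l.
rewrite IHs ?count_cat; last by move=> y ys; apply: st; rewrite inE ys orbT.
have xt : x \in t by apply: st; rewrite mem_head.
congr (_ + _)%N; rewrite -[RHS]addn0; congr (_ + _)%N.
  apply: eq_in_count => y ys; have yt : y \in t by apply: st; rewrite inE ys orbT.
  by rewrite !index_cat yt xt.
apply/eqP; rewrite -leqn0 leqNgt -has_count; apply/hasPn => y yb.
rewrite -leqNgt !index_cat xt bt //; apply: leq_trans (leq_addr _ _).
by apply: ltnW; rewrite index_mem.
Qed.

Lemma osgn_catr b s t : uniq (s ++ b) -> perm_eq s t ->
  osgn (s ++ b) (t ++ b) = osgn s t :> R.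
Proof.
move=> usb st; rewrite /osgn inversions_catr //; last by move=> x; rewrite (perm_mem st).
by rewrite (perm_uniq (perm_cat st (perm_refl b))) in usb *.
Qed.

(** Each entry of [s] is inverted with each entry of [t], and no other pair is inverted. *)
Lemma osgn_swap s t : uniq (s ++ t) ->
  osgn (s ++ t) (t ++ s) = (-1) ^+ (size s * size t) :> R.
Proof.
rewrite cat_uniq => /and3P[us ts ut].
have st x : x \in s -> (x \in t) = false.
  by move=> xs; apply: contraNF ts => xt; apply/hasP; exists x.
suff inv s' : {subset s' <= s} ->
    inversions (t ++ s) (s' ++ t) = (size s' * size t + inversions s s')%N.
  by rewrite /osgn inv // inversions_id // addn0.
elim: s' => [_|x s' IHs' ss'] /=.
  rewrite addn0 mul0n -[RHS](inversions_id ut).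
  by apply: eq_inversions => y z yt zt; rewrite !index_cat yt zt.
have xs : x \in s by apply: ss'; rewrite mem_head.
have {}ss' : {subset s' <= s} by move=> y ys; apply: ss'; rewrite inE ys orbT.
rewrite IHs' // count_cat mulSn.
have -> : count (fun y => index y (t ++ s) < index x (t ++ s))%N t = size t.
  apply/eqP; rewrite -all_count; apply/allP => y yt /=.
  by rewrite !index_cat yt st // ltn_addr ?index_mem.
rewrite [X in (X + _)%N]addnC addnACA; congr (_ + (_ + _))%N.
by apply: eq_in_count => y /ss' ys; rewrite !index_cat !st // ltn_add2l.
Qed.

Lemma osgn_map (Y : eqType) (f : X -> Y) s t : {in s &, injective f} -> perm_eq s t ->
  osgn (map f s) (map f t) = osgn s t :> R.
Proof.
move=> f_inj st; have idx x : x \in s -> index (f x) (map f t) = index x t.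
  move=> xs; have : {in t &, injective f} by move=> y z; rewrite -!(perm_mem st); exact: f_inj.
  have: x \in t by rewrite -(perm_mem st).
  elim: t {st} => //= y t IHt; rewrite inE => /orP[/eqP->|xt] tinj; first by rewrite !eqxx.
  have -> : (f y == f x) = (y == x).
    apply/eqP/eqP => [|-> //]; apply: tinj; rewrite inE ?eqxx //.
    by rewrite xt orbT.
  by rewrite IHt // => a b at1 bt1; apply: tinj; rewrite inE ?at1 ?bt1 orbT.
rewrite /osgn; congr (_ ^+ _).
suff inv s' : {subset s' <= s} -> inversions (map f t) (map f s') = inversions t s'.
  exact: inv.
elim: s' => //= x s' IHs' ss'; rewrite IHs'; last first.
  by move=> y ys; apply: ss'; rewrite inE ys orbT.
congr (_ + _)%N; rewrite count_map; apply: eq_in_count => y ys /=.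
by rewrite !idx //; apply: ss'; rewrite inE ?eqxx ?ys ?orbT.
Qed.
End Signs.

(** * Cutting and contracting edges *)

Section Comb.
Variable I : finType.
Implicit Types (H e : {set I}) (x y z h : I).

Definition adjr (s0 s1 : I -> I) : rel I := fun x y => (y == s0 x) || (y == s1 x).
(* Vertices and connected components are represented by the sets of their half-edges,
   so that being in the same one is an equality.  [cutf] and [conf] are the structure
   maps of [cut] and [contract], on bare functions so that different graphs on the same
   labels can be compared. *)
Definition vcl (s0 : I -> I) x : {set I} := [set y | fconnect s0 x y].
Definition cl (s0 s1 : I -> I) x : {set I} := [set y | connect (adjr s0 s1) x y].
Definition edge (s1 : I -> I) h : {set I} := [set h; s1 h].
Definition cutf (s1 : I -> I) e x := if x \in e then x else s1 x.
Definition conf (s0 s1 : I -> I) e x := if s0 x \in e then s0 (s1 (s0 x)) else s0 x.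

Record stable H (s0 s1 : I -> I) : Prop := {
  st0 : {in H, forall x, s0 x \in H};
  st0I : {in H &, injective s0};
  st1 : {in H, forall x, s1 x \in H};
  st1K : {in H, involutive s1} }.

Lemma connect_ind (r : rel I) (P : I -> Prop) x y : connect r x y -> P x ->
  (forall z t, connect r x z -> P z -> r z t -> P t) -> P y.
Proof.
case/connectP=> p xp -> Px IH; elim/last_ind: p xp => //= p z IHp.
rewrite rcons_path last_rcons => /andP[xp pz]; apply: (IH (last x p)) => //; last exact: IHp.
by apply/connectP; exists p.
Qed.

Section Stable.
Variables (H : {set I}) (s0 s1 : I -> I).
Hypothesis stH : stable H s0 s1.
Local Notation conn := (connect (adjr s0 s1)).

Lemma conn_s0 x : conn x (s0 x).
Proof. by apply: connect1; rewrite /adjr eqxx. Qed.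

Lemma conn_s1 x : conn x (s1 x).
Proof. by apply: connect1; rewrite /adjr eqxx orbT. Qed.

Lemma conn_in x y : x \in H -> conn x y -> y \in H.
Proof.
move=> xH xy; apply: (connect_ind (P := fun y => y \in H) xy) => // z t _ zH /orP[] /eqP->.
  exact: (st0 stH).
exact: (st1 stH).
Qed.

Lemma fconn_in x y : x \in H -> fconnect s0 x y -> y \in H.
Proof.
move=> xH xy; apply: (connect_ind (P := fun y => y \in H) xy) => // z t _ zH /eqP <-.
exact: (st0 stH).
Qed.

Lemma fconn_conn x y : fconnect s0 x y -> conn x y.
Proof. by apply: connect_sub => a b /eqP <-; exact: conn_s0. Qed.

Lemma fconn_sym x y : x \in H -> y \in H -> fconnect s0 x y = fconnect s0 y x.
Proof. by move=> xH yH; apply: (fconnect_sym_in (S := H)); case: stH. Qed.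

Lemma conn_sym x y : x \in H -> conn x y -> conn y x.
Proof.
move=> xH xy; apply: (connect_ind (P := fun y => conn y x) xy) => // z t xz zx zt; have zH := conn_in xH xz.
apply: connect_trans zx; case/orP: zt => /eqP->.
  by apply: fconn_conn; rewrite fconn_sym ?fconnect1 ?(st0 stH).
by rewrite -[X in conn _ X](st1K stH) //; exact: conn_s1.
Qed.

Lemma clE x y : x \in H -> y \in H -> conn x y <-> cl s0 s1 x = cl s0 s1 y.
Proof.
move=> xH yH; split=> [xy|xy]; last first.
  have : y \in cl s0 s1 y by rewrite inE connect0.
  by rewrite -xy inE.
apply/setP => z; rewrite !inE; apply/idP/idP; apply: connect_trans => //.
exact: conn_sym.
Qed.

Lemma vclE x y : x \in H -> y \in H -> fconnect s0 x y <-> vcl s0 x = vcl s0 y.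
Proof.
move=> xH yH; split=> [xy|xy]; last first.
  have : y \in vcl s0 y by rewrite inE connect0.
  by rewrite -xy inE.
apply/setP => z; rewrite !inE; apply/idP/idP; apply: connect_trans => //.
by rewrite fconn_sym.
Qed.

Lemma vcl_s0 x : x \in H -> vcl s0 (s0 x) = vcl s0 x.
Proof. by move=> xH; apply/esym/vclE; rewrite ?(st0 stH) ?fconnect1. Qed.

Lemma cl_s0 x : x \in H -> cl s0 s1 (s0 x) = cl s0 s1 x.
Proof. by move=> xH; apply/esym/clE; rewrite ?(st0 stH) ?conn_s0. Qed.

Lemma cl_s1 x : x \in H -> cl s0 s1 (s1 x) = cl s0 s1 x.
Proof. by move=> xH; apply/esym/clE; rewrite ?(st1 stH) ?conn_s1. Qed.

Variable h : I.
Hypothesis hH : h \in H.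
Local Notation e := (edge s1 h).

Lemma edge_s1 : edge s1 (s1 h) = e.
Proof. by rewrite /edge (st1K stH) // setUC. Qed.

Lemma edge_mem x : x \in e -> edge s1 x = e.
Proof. by case/set2P=> -> //; exact: edge_s1. Qed.

Lemma s1_edge x : x \in H -> (s1 x \in e) = (x \in e).
Proof.
have imp y : y \in e -> s1 y \in e.
  by case/set2P=> ->; rewrite ?(st1K stH) // !inE eqxx ?orbT.
move=> xH; apply/idP/idP => [/imp|/imp//]; by rewrite (st1K stH).
Qed.

Lemma stable_cut : stable H s0 (cutf s1 e).
Proof.
case: stH => H0 H0I H1 H1K; split=> // x xH; rewrite /cutf.
  by case: ifP => // _; exact: H1.
by have [xe|xe] := boolP (x \in e); rewrite ?xe // s1_edge // (negPf xe) H1K.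
Qed.

Local Notation cl' := (cl s0 (cutf s1 e)).
Local Notation conn' := (connect (adjr s0 (cutf s1 e))).

Lemma conn_cut x y : conn' x y -> conn x y.
Proof.
apply: connect_sub => a b /orP[] /eqP->; first exact: conn_s0.
by rewrite /cutf; case: ifP => _; [exact: connect0|exact: conn_s1].
Qed.
End Stable.

(** Restoring the edge can only merge the component of [h] with that of [s1 h]. *)
Lemma cl_cut H s0 s1 h x y : stable H s0 s1 -> h \in H -> x \in H -> y \in H ->
  cl s0 s1 x = cl s0 s1 y <->
  [\/ cl s0 (cutf s1 (edge s1 h)) x = cl s0 (cutf s1 (edge s1 h)) y,
      cl s0 (cutf s1 (edge s1 h)) x = cl s0 (cutf s1 (edge s1 h)) h /\
      cl s0 (cutf s1 (edge s1 h)) (s1 h) = cl s0 (cutf s1 (edge s1 h)) y |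
      cl s0 (cutf s1 (edge s1 h)) x = cl s0 (cutf s1 (edge s1 h)) (s1 h) /\
      cl s0 (cutf s1 (edge s1 h)) h = cl s0 (cutf s1 (edge s1 h)) y].
Proof.
move=> stH hH xH yH; have st' := stable_cut stH hH; have h'H := st1 stH hH.
set s1' := cutf _ _ in st' *; split.
  move/(clE stH xH yH) => xy.
  pose P z := [\/ cl s0 s1' x = cl s0 s1' z,
      cl s0 s1' x = cl s0 s1' h /\ cl s0 s1' (s1 h) = cl s0 s1' z |
      cl s0 s1' x = cl s0 s1' (s1 h) /\ cl s0 s1' h = cl s0 s1' z].
  suff: y \in H /\ P y by case.
  apply: (connect_ind (P := fun z => z \in H /\ P z) xy).
    by split=> //; exact: Or31.
  move=> z t _ [zH Pz] /orP[]/eqP->.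
    by split; [exact: (st0 stH)|rewrite /P (cl_s0 st')].
  split; first exact: (st1 stH).
  have [|ze] := boolP (z \in edge s1 h); last first.
    have -> : s1 z = s1' z by rewrite /s1' /cutf (negPf ze).
    by rewrite /P (cl_s1 st').
  case/set2P=> zE; rewrite zE ?(st1K stH) // in Pz *; case: Pz => [|[]|[]] *;
    by solve [apply: Or31; congruence | apply: Or32; split; congruence | apply: Or33; split; congruence].
have cc a b : a \in H -> b \in H -> cl s0 s1' a = cl s0 s1' b -> cl s0 s1 a = cl s0 s1 b.
  by move=> aH bH /(clE st' aH bH) ab; apply/(clE stH aH bH); exact: conn_cut ab.
have hh' : cl s0 s1 (s1 h) = cl s0 s1 h by rewrite (cl_s1 stH).
case=> [/cc->//|[/cc xh /cc hy]|[/cc xh /cc hy]]; first by rewrite xh // -hh' hy.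
by rewrite xh // hh' hy.
Qed.

(** * Vertices and connectedness after contracting an edge that is not a loop *)

Section Contract.
Variables (H : {set I}) (s0 s1 : I -> I) (h : I).
Hypothesis stH : stable H s0 s1.
Hypothesis val : {in H, forall x, s0 x != x /\ s0 (s0 x) != x}.
Hypothesis hH : h \in H.
Hypothesis nonloop : vcl s0 h <> vcl s0 (s1 h).
Local Notation e := (edge s1 h).
Local Notation s0' := (conf s0 s1 e).
Local Notation H' := (H :\: e).
Let h'H := st1 stH hH.

Lemma edgeP g : g \in e -> [/\ g \in H, s1 g \in e, s1 (s1 g) = g,
  vcl s0 g <> vcl s0 (s1 g) & e = edge s1 g].
Proof.
case/set2P=> ->; rewrite ?(st1K stH) // !inE !eqxx ?orbT; split=> //.
  by move/esym.
by rewrite (edge_s1 stH).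
Qed.

Lemma s0_edge g : g \in e -> s0 g \notin e.
Proof.
move=> ge; have [gH _ _ loop eE] := edgeP ge; rewrite eE !inE negb_or.
rewrite (proj1 (val gH)) /=; apply/eqP => gg; apply: loop.
by rewrite -gg (vcl_s0 stH).
Qed.

Lemma stable_con : stable H' s0' s1.
Proof.
case: stH => H0 H0I H1 H1K.
have He x : x \in H' -> x \in H /\ x \notin e by rewrite inE => /andP[].
split=> [x /He[xH xe]|x y /He[xH xe] /He[yH ye]|x /He[xH xe]|x /He[xH _]]; last exact: H1K.
- rewrite /conf; case: ifP => [xe0|/negbT xe0]; rewrite inE.
    have [_ ge _ _ _] := edgeP xe0; rewrite s0_edge // H0 //.
    by have [] := edgeP ge.
  by rewrite xe0 H0.
- rewrite /conf; case: ifP => xe0; case: ifP => ye0 xy; last exact: H0I.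
  + have [xH0 ge g2 _ _] := edgeP xe0; have [yH0 g'e g'2 _ _] := edgeP ye0.
    have [gH _ _ _ _] := edgeP ge; have [g'H _ _ _ _] := edgeP g'e.
    by apply: (st0I stH) => //; rewrite -g2 -g'2; congr s1; exact: H0I.
  + have [_ ge _ _ _] := edgeP xe0; have [gH _ _ _ _] := edgeP ge.
    by move: ye; rewrite -(H0I _ _ gH yH xy) ge.
  + have [_ ge _ _ _] := edgeP ye0; have [gH _ _ _ _] := edgeP ge.
    by move: xe; rewrite (H0I _ _ xH gH xy) ge.
- by rewrite inE (s1_edge stH) // xe H1.
Qed.

(** Vertices of valences a, b at least 3 merge into one of valence a+b-2, at least 4. For the
    rotation maps: a return after one or two steps would make the edge a loop or give one of its
    ends valence at most 2. *)
Lemma val_con : {in H', forall x, s0' x != x /\ s0' (s0' x) != x}.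
Proof.
move=> x; rewrite inE => /andP[xe xH]; have [v1 v2] := val xH.
split; rewrite /conf.
  case: ifP => // xe0; have [gH ge _ loop _] := edgeP xe0.
  have [g'H _ _ _ _] := edgeP ge.
  apply/eqP => /(congr1 (vcl s0)); rewrite (vcl_s0 stH) // -(vcl_s0 stH xH) => E.
  exact: loop.
have [xe0|xe0] := boolP (s0 x \in e); last first.
  case: ifP => [xe1|_]; last by [].
  have [gH ge _ loop _] := edgeP xe1; have [g'H _ _ _ _] := edgeP ge.
  apply/eqP => /(congr1 (vcl s0)); rewrite (vcl_s0 stH) // => E; apply: loop.
  by rewrite E !(vcl_s0 stH) // (st0 stH).
have [gH ge gK loop eE] := edgeP xe0; have [g'H _ _ _ _] := edgeP ge.
have g0H := st0 stH g'H.
case: ifP => xe1; last first.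
  apply/eqP => /(congr1 (vcl s0)); rewrite !(vcl_s0 stH) // => E; apply: loop.
  by rewrite E (vcl_s0 stH).
apply/eqP => E; move: xe1; rewrite eE => /set2P[] g1.
  have xE : x = s0 (s1 (s0 x)) by apply: (st0I stH).
  by apply: loop; rewrite (vcl_s0 stH) // [in LHS]xE (vcl_s0 stH).
move: E; rewrite g1 gK => E; have [_] := val gH.
by rewrite E eqxx.
Qed.

(** Start right after [s1 g] and turn around its vertex. Up to the half-edge [z] that precedes
    [s1 g], both rotations agree; from [z] the new one crosses over to the successor of [g]. *)
Lemma around g : g \in e -> fconnect s0' (s0 (s1 g)) (s0 g).
Proof.
move=> ge; have [gH g'e gK loop eE] := edgeP ge; have [g'H _ _ _ _] := edgeP g'e.
pose z := finv s0 (s1 g).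
have z0 : s0 z = s1 g by apply: (f_finv_in (S := H)); case: stH.
have zH : z \in H by apply: (finv_in (S := H)) => //; case: stH.
have ze : z \notin e.
  rewrite eE !inE negb_or; apply/andP; split; apply/eqP => zE.
    by apply: loop; rewrite -z0 zE (vcl_s0 stH).
  by have [/eqP] := val g'H; rewrite -{1}zE.
have z0' : s0' z = s0 g by rewrite /conf z0 g'e gK.
suff: fconnect s0' (s0 (s1 g)) z.
  by move/connect_trans; apply; rewrite -z0' fconnect1.
have zy : fconnect s0 (s0 (s1 g)) z.
  apply/(vclE stH) => //; first exact: (st0 stH).
  by rewrite (vcl_s0 stH) // -z0 (vcl_s0 stH).
pose P y := fconnect s0' (s0 (s1 g)) z \/ (y \notin e /\ fconnect s0' (s0 (s1 g)) y).
have [//|[_ //]] : P z.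
apply: (connect_ind (P := P) zy) => [|y t yc [c|[ye yc']] /eqP <-]; first by right; rewrite s0_edge ?connect0.
  by left.
have [yz|yz] := eqVneq y z; first by left; rewrite -yz.
have yH : y \in H by apply: (fconn_in stH) yc; exact: (st0 stH).
have ye0 : s0 y \notin e.
  rewrite eE !inE negb_or; apply/andP; split; apply/eqP => yE.
    apply: loop; rewrite -(vcl_s0 stH g'H) -[in LHS]yE (vcl_s0 stH yH).
    by apply/esym/(vclE stH) => //; exact: (st0 stH).
  by case/eqP: yz; apply: (st0I stH) => //; rewrite yE z0.
right; split=> //; apply: connect_trans yc' _; apply: connect1.
by rewrite /= /conf (negPf ye0).
Qed.

(** An end of the contracted edge is no longer a half-edge; its successor at the same vertex stands
    in for it, so that old paths can be transported. *)
Let rep x := if x \in e then s0 x else x.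

Lemma rep_fconn x y : x \in H -> fconnect s0 x y -> fconnect s0' (rep x) (rep y).
Proof.
move=> xH xy; apply: (connect_ind (P := fun y => fconnect s0' (rep x) (rep y)) xy) => // z t xz.
move=> zc /eqP <-; apply: connect_trans zc _ => {t}.
have zH := fconn_in stH xH xz; rewrite /rep; case: ifP => [ze|/negbT ze].
  by rewrite (negPf (s0_edge ze)) connect0.
case: ifP => [ze0|/negbT ze0]; last first.
  by apply: connect1; rewrite /= /conf (negPf ze0).
apply: connect_trans (around ze0); apply: connect1.
by rewrite /= /conf ze0.
Qed.

Lemma conn_con x y : x \in H' -> y \in H' ->
  connect (adjr s0' s1) x y = connect (adjr s0 s1) x y.
Proof.
rewrite !in_setD => /andP[xe xH] /andP[ye yH]; apply/idP/idP => [xy|xy].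
  apply: connect_sub xy => a b /orP[]/eqP->; last exact: conn_s1.
  rewrite /conf; case: ifP => _; last exact: conn_s0.
  apply: connect_trans (conn_s0 _ _ _); apply: connect_trans (conn_s1 _ _ _).
  exact: conn_s0.
suff: connect (adjr s0' s1) (rep x) (rep y) by rewrite /rep (negPf xe) (negPf ye).
apply: (connect_ind (P := fun y => connect (adjr s0' s1) (rep x) (rep y)) xy) => // z t xz zc zt.
apply: connect_trans zc _; have zH := conn_in stH xH xz.
case/orP: zt => /eqP ->; first by apply: fconn_conn; apply: rep_fconn => //; exact: fconnect1.
rewrite /rep (s1_edge stH) //; case: ifP => ze; last exact: conn_s1.
have [_ ge gK _ _] := edgeP ze; have := around ge; rewrite gK.
exact: fconn_conn.
Qed.

(** The counterpart of [cl_cut] for vertices: contraction merges the vertex of [h] with that of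
    [s1 h], the walk between them being [around]. *)
Lemma vcl_con x y : x \in H' -> y \in H' ->
  vcl s0' x = vcl s0' y <->
  [\/ vcl s0 x = vcl s0 y, vcl s0 x = vcl s0 h /\ vcl s0 (s1 h) = vcl s0 y |
      vcl s0 x = vcl s0 (s1 h) /\ vcl s0 h = vcl s0 y].
Proof.
move=> xH' yH'; have st' := stable_con; have he : h \in e by rewrite !inE eqxx.
have [_ h'e hK _ _] := edgeP he.
have [[xe xH] [ye yH]] : (x \notin e /\ x \in H) /\ (y \notin e /\ y \in H).
  by move: xH' yH'; rewrite !in_setD => /andP[-> ->] /andP[-> ->].
split=> [/(vclE st' xH' yH') xy|].
  pose P z := [\/ vcl s0 x = vcl s0 z, vcl s0 x = vcl s0 h /\ vcl s0 (s1 h) = vcl s0 z |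
      vcl s0 x = vcl s0 (s1 h) /\ vcl s0 h = vcl s0 z].
  suff: y \in H' /\ P y by case.
  apply: (connect_ind (P := fun z => z \in H' /\ P z) xy); first by split=> //; exact: Or31.
  move=> z t _ [zH' Pz] /eqP <-; split; first exact: (st0 st').
  have zH : z \in H by move: zH'; rewrite inE => /andP[].
  rewrite /P /conf; case: ifP => [ze|_]; last by rewrite (vcl_s0 stH).
  have [_ _ _ _ _] := edgeP ze; have vz := vcl_s0 stH zH.
  case/set2P: (ze) => zE; rewrite zE in vz *; rewrite ?hK !(vcl_s0 stH) //;
    rewrite /P -vz in Pz; case: Pz => [|[]|[]] *;
    by solve [apply: Or31; congruence | apply: Or32; split; congruence
             | apply: Or33; split; congruence].
have xx : rep x = x by rewrite /rep (negPf xe).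
have yy : rep y = y by rewrite /rep (negPf ye).
have hh : rep h = s0 h by rewrite /rep he.
have hh' : rep (s1 h) = s0 (s1 h) by rewrite /rep h'e.
move=> C; apply/(vclE st' xH' yH').
case: C => [/(vclE stH xH yH)/(rep_fconn xH)|[/(vclE stH xH hH)/(rep_fconn xH) a]|
  [/(vclE stH xH h'H)/(rep_fconn xH) a]]; first by rewrite xx yy.
  move/(vclE stH h'H yH)/(rep_fconn h'H) => b; rewrite xx yy hh hh' in a b.
  by apply: connect_trans a _; apply: connect_trans b; have := around h'e; rewrite hK.
move/(vclE stH hH yH)/(rep_fconn hH) => b; rewrite xx yy hh hh' in a b.
by apply: connect_trans a _; apply: connect_trans b; exact: around.
Qed.
End Contract.
End Comb.

Section Prerg.
Variable L : Type.
Implicit Type G : rgraph L.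

(* A possibly disconnected or empty ribbon graph, as arises from cutting. *)
Record prerg G : Prop := {
  pg_st : stable (hes G) (s0 G) (s1 G);
  pg_val : {in hes G, forall x, s0 G x != x /\ s0 G (s0 G x) != x};
  pg_col : {in hes G, forall x, s1 G (s0 G x) != s0 G x ->
    col G x = col G (s1 G (s0 G x))};
  pg_uniq : uniq (ori G);
  pg_ori : forall e, (e \in ori G) = internal_edge e }.

(** In this form the valence condition can be checked at each half-edge of a contracted graph,
    without computing its cycles. *)
Lemma order_gt2 (I : finType) (H : {set I}) (s0 s1 : I -> I) x : stable H s0 s1 ->
  x \in H -> (2 < order s0 x)%N <-> s0 x != x /\ s0 (s0 x) != x.
Proof.
move=> stH xH; have iter_x := iter_order_in (st0 stH) (st0I stH) xH.
split=> [gt2|[v1 v2]]; last first.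
  have := order_gt0 s0 x; case E : (order s0 x) iter_x => [|[|[|//]]] //= xx.
    by rewrite xx eqxx in v1.
  by rewrite xx eqxx in v2.
split; apply: contraTneq gt2 => xx; rewrite -leqNgt.
  suff : (order s0 x <= size [:: x])%N by move/leq_trans; apply.
  by apply: (@order_le_cycle _ s0); rewrite /= ?mem_head // xx eqxx.
by apply: (@order_le_cycle _ s0 [:: x; s0 x]); rewrite ?mem_head //= xx !eqxx.
Qed.

(** The colour condition is rewritten at [x = face h], that is [h = s1 (s0 x)], which removes the
    inverse [finv] from it. *)
Lemma connected_rgP G : connected_rg G <->
  [/\ prerg G, hes G != finset.set0 &
      {in hes G &, forall x y, connect (adjr (s0 G) (s1 G)) x y}].
Proof.
split=> [[H0 H0I H1 H1K Hval Hcol Huniq Hori Hne Hconn]|[[st Hval Hcol Huniq Hori] Hne Hconn]].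
  have st : stable (hes G) (s0 G) (s1 G) by split.
  split=> //; split=> // x xH; first exact/(order_gt2 st xH)/Hval.
  move=> xs; have s1H := H1 _ (H0 _ xH).
  rewrite -(Hcol (s1 G (s0 G x))) ?H1K ?H0 //; last by rewrite eq_sym.
  by rewrite /face H1K ?H0 // (finv_f_in H0 H0I).
case: (st) => H0 H0I H1 H1K; split=> // h hH; first exact/(order_gt2 st hH)/Hval.
move=> s1h; pose x := face h.
have x0 : s0 G x = s1 G h by rewrite /x /face (f_finv_in H0 H0I) // H1.
have xH : x \in hes G by apply: (finv_in H0); exact: H1.
by rewrite -/x Hcol // x0 H1K // eq_sym.
Qed.

Lemma connected_prerg G : connected_rg G -> prerg G.
Proof. by case/connected_rgP. Qed.

Lemma oriP G (e : {set 'I_(lab G)}) : prerg G -> reflect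
  (exists h, [/\ h \in hes G, s1 G h != h & e = edge (s1 G) h]) (e \in ori G).
Proof.
move=> pG; rewrite (pg_ori pG); apply: (iffP existsP) => [[h /and3P[hH hs /eqP ->]]|].
  by exists h.
by case=> h [hH hs ->]; exists h; rewrite hH hs eqxx.
Qed.

Lemma ori_mem G (e : {set 'I_(lab G)}) h : prerg G -> e \in ori G -> h \in e ->
  [/\ h \in hes G, s1 G h != h & e = edge (s1 G) h].
Proof.
move=> pG /(oriP _ pG)[g [gH gs ->]] /set2P[] -> //.
have stG := pg_st pG; rewrite (edge_s1 stG) //; split=> //; first exact: (st1 stG).
by rewrite (st1K stG) // eq_sym.
Qed.

Lemma ori_sub G (e : {set 'I_(lab G)}) : prerg G -> e \in ori G -> e \subset hes G.
Proof. by move=> pG eG; apply/subsetP => h /(ori_mem pG eG)[]. Qed.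

Lemma ori_neq0 G (e : {set 'I_(lab G)}) : prerg G -> e \in ori G -> exists h, h \in e.
Proof. by move=> pG /(oriP _ pG)[h [_ _ ->]]; exists h; rewrite !inE eqxx. Qed.

Lemma edge_ori G h : prerg G -> h \in hes G -> (edge (s1 G) h \in ori G) = (s1 G h != h).
Proof.
move=> pG hH; apply/idP/idP => [eG|hs]; last by apply/(oriP _ pG); exists h.
by have [] := ori_mem pG eG (set21 _ _).
Qed.

Lemma ori_disjoint G (e e' : {set 'I_(lab G)}) h : prerg G -> e \in ori G -> e' \in ori G ->
  h \in e -> h \in e' -> e = e'.
Proof. by move=> pG eG e'G /(ori_mem pG eG)[_ _ ->] /(ori_mem pG e'G)[_ _ ->]. Qed.

Lemma cut_prerg G (e : {set 'I_(lab G)}) : prerg G -> e \in ori G -> prerg (cut e).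
Proof.
move=> pG eG; have [h [hH hs eE]] := oriP _ pG eG.
have stG := pg_st pG.
have st' : stable (hes G) (s0 G) (cutf (s1 G) e) by rewrite eE; exact: stable_cut.
split=> //=.
- exact: (pg_val pG).
- move=> x xH; case: ifP => [_|_]; first by rewrite eqxx.
  exact: (pg_col pG).
- exact: rem_uniq (pg_uniq pG).
- move=> e'; rewrite (mem_rem_uniq _ (pg_uniq pG)) inE /=.
  apply/andP/existsP => [[ee' e'G]|[g /and3P[/= gH]]].
    have [g [gH gs e'E]] := oriP _ pG e'G; exists g => /=; rewrite gH /=.
    have ge : g \notin e.
      apply: contraNN ee' => ge; apply/eqP/esym/(ori_disjoint pG eG e'G ge).
      by rewrite e'E !inE eqxx.
    by rewrite (negPf ge) gs e'E /=.
  case: ifP => [|ge gs /eqP ->]; first by rewrite eqxx.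
  rewrite -[[set g; _]]/(edge (s1 G) g) edge_ori //; split=> //.
  by apply: contraFN ge => /eqP <-; rewrite !inE eqxx.
Qed.

Lemma loopP G (e : {set 'I_(lab G)}) h : prerg G -> e \in ori G -> h \in e ->
  reflect (vcl (s0 G) h = vcl (s0 G) (s1 G h)) (is_loop e).
Proof.
move=> pG eG he; have [hH hs eE] := ori_mem pG eG he; have stG := pg_st pG.
have h'H := st1 stG hH; have h'e : s1 G h \in e by rewrite eE !inE eqxx orbT.
apply: (iffP forall_inP) => [/(_ h he)/forall_inP/(_ _ h'e)/(vclE stG hH h'H)//|hh'].
move=> g; rewrite eE => /set2P[]->; apply/forall_inP => g' /set2P[]->;
  by rewrite ?connect0 //; apply/(vclE stG).
Qed.

Lemma contract_prerg G (e : {set 'I_(lab G)}) : prerg G -> e \in ori G ->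
  ~~ is_loop e -> prerg (contract e).
Proof.
move=> pG eG loop; have [h [hH hs eE]] := oriP _ pG eG; have stG := pg_st pG.
have he : h \in e by rewrite eE !inE eqxx.
have nl : vcl (s0 G) h <> vcl (s0 G) (s1 G h) by move=> /(loopP pG eG he); exact/negP.
have He x : x \in hes G :\: e -> x \notin e /\ x \in hes G by rewrite in_setD => /andP[].
split=> /=.
- by rewrite eE; exact: stable_con (pg_val pG) hH nl.
- by rewrite eE; exact: val_con (pg_val pG) hH nl.
(* If [s0 x] lies on [e], the new successor of [x] is found beyond [e]. The colour is then carried
   over in two steps, from [x] to [s1 (s0 x)] and from there on. *)
- move=> x /He[xe xH]; have colx := pg_col pG xH; case: ifP => xe0 xs; last exact: colx.
  have xs0 : s1 G (s0 G x) \in e by rewrite eE (s1_edge stG hH) ?(st0 stG) // -eE.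
  have [_ _ loop_] := ori_mem pG eG xs0.
  rewrite colx; last by have [_] := ori_mem pG eG xe0.
  have [gH _ _] := ori_mem pG eG xs0; rewrite -(pg_col pG gH) //.
- exact: rem_uniq (pg_uniq pG).
- move=> e'; rewrite (mem_rem_uniq _ (pg_uniq pG)) inE /=.
  apply/andP/existsP => [[ee' e'G]|[g /and3P[/= /He[ge gH] gs /eqP ->]]].
    have [g [gH gs e'E]] := oriP _ pG e'G; exists g => /=; rewrite in_setD gH gs e'E eqxx !andbT.
    apply: contraNN ee' => ge; apply/eqP/esym/(ori_disjoint pG eG e'G ge).
    by rewrite e'E !inE eqxx.
  rewrite -[[set g; _]]/(edge (s1 G) g) edge_ori //; split=> //.
  by apply: contraNN ge => /eqP <-; rewrite !inE eqxx.
Qed.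

Lemma component_connected G (h : 'I_(lab G)) : prerg G -> h \in hes G ->
  connected_rg (component h).
Proof.
move=> pG hH; have stG := pg_st pG; set H := hes (component h).
have Hin x : x \in H -> x \in hes G /\ connect (adjr (s0 G) (s1 G)) h x.
  by rewrite inE => /andP[].
have inH x y : x \in H -> connect (adjr (s0 G) (s1 G)) x y -> y \in H.
  case/Hin=> xH hx xy; rewrite inE (conn_in stG xH xy).
  exact: (connect_trans hx xy).
apply/connected_rgP; split; last 2 first.
- by apply/set0Pn; exists h; rewrite inE hH; exact: connect0.
- move=> x y /Hin[xH hx] /Hin[yH hy]; apply: connect_trans hy.
  exact: (conn_sym stG hH hx).
split=> /=.
- split=> [x xH|x y /Hin[xH _] /Hin[yH _]|x xH|x /Hin[xH _]].
  + by apply: (inH _ _ xH); exact: conn_s0.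
  + exact: (st0I stG).
  + by apply: (inH _ _ xH); exact: conn_s1.
  + exact: (st1K stG).
- by move=> x /Hin[xH _]; exact: (pg_val pG).
- by move=> x /Hin[xH _]; exact: (pg_col pG).
- exact: filter_uniq (pg_uniq pG).
- move=> e; rewrite mem_filter; apply/andP/existsP => [[eH eG]|].
    have [g [gH gs eE]] := oriP _ pG eG; exists g; rewrite /= gs eE eqxx !andbT.
    by apply: (subsetP eH); rewrite eE !inE eqxx.
  case=> g /and3P[gH gs /eqP->]; have [/= gG hg] := Hin g gH.
  rewrite -[[set g; _]]/(edge (s1 G) g) edge_ori //; split=> //.
  apply/subsetP => x /set2P[]-> //.
  by apply: (inH _ _ gH); exact: conn_s1.
Qed.
End Prerg.

(** The last hypothesis lifts a path of [r'] step by step; injectivity of [f] then identifies the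
    end of the lifted path. *)
Lemma connect_image (I J : finType) (H : {set I}) (f : I -> J) (r : rel I) (r' : rel J) :
  (forall x y, x \in H -> r x y -> y \in H) ->
  {in H &, injective f} ->
  (forall x y, x \in H -> r x y -> r' (f x) (f y)) ->
  (forall x z, x \in H -> r' (f x) z -> exists2 y, r x y & z = f y) ->
  {in H &, forall x y, connect r' (f x) (f y) = connect r x y}.
Proof.
move=> rH f_inj rr' r'r x y xH yH; apply/idP/idP => [xy|xy]; last first.
  have [//] : y \in H /\ connect r' (f x) (f y).
  apply: (connect_ind (P := fun y => y \in H /\ connect r' (f x) (f y)) xy); first by split.
  move=> z t _ [zH xz] zt; split; first exact: rH zt.
  by apply: connect_trans xz (connect1 _); exact: rr'.
have [y' [y'H /f_inj -> //]] : exists y', [/\ y' \in H, f y = f y' & connect r x y'].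
apply: (connect_ind (P := fun z => exists y', [/\ y' \in H, z = f y' & connect r x y']) xy).
  by exists x.
move=> _ z _ [t [tH -> xt]] /(r'r _ _ tH)[u tu ->]; exists u; split=> //.
  exact: rH tu.
exact: connect_trans xt (connect1 tu).
Qed.

(** * Isomorphisms *)

Section Iso.
Variable L : Type.
Implicit Type G : rgraph L.

Definition isoby G G' (f : 'I_(lab G) -> 'I_(lab G')) : Prop :=
  [/\ {in hes G &, injective f}, f @: hes G = hes G',
      {in hes G, forall h, [/\ f (s0 G h) = s0 G' (f h), f (s1 G h) = s1 G' (f h)
                             & col G' (f h) = col G h]}
    & ori G' = [seq f @: e | e : {set _} <- ori G]].

Section Transport.
Variables (G G' : rgraph L) (f : 'I_(lab G) -> 'I_(lab G')).
Hypotheses (pG : prerg G) (iso : isoby f).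
Let stG := pg_st pG.
Let f_inj : {in hes G &, injective f}. Proof. by case: iso. Qed.
Let fH : f @: hes G = hes G'. Proof. by case: iso. Qed.
Let f0 h : h \in hes G -> f (s0 G h) = s0 G' (f h).
Proof. by case: iso => _ _ E _ /E[]. Qed.
Let f1 h : h \in hes G -> f (s1 G h) = s1 G' (f h).
Proof. by case: iso => _ _ E _ /E[]. Qed.
Let fc h : h \in hes G -> col G' (f h) = col G h.
Proof. by case: iso => _ _ E _ /E[]. Qed.
Let fori : ori G' = [seq f @: e | e : {set _} <- ori G]. Proof. by case: iso. Qed.

Lemma iso_mem h : h \in hes G -> f h \in hes G'.
Proof. by move=> hH; rewrite -fH imset_f. Qed.

Lemma iso_memE (A : {set 'I_(lab G)}) h : A \subset hes G -> h \in hes G ->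
  (f h \in f @: A) = (h \in A).
Proof.
move=> /subsetP AH hH; apply/imsetP/idP => [[g gA /f_inj -> //]|hA]; last by exists h.
exact: AH.
Qed.

Lemma iso_subset (A B : {set 'I_(lab G)}) : A \subset hes G -> B \subset hes G ->
  (f @: A \subset f @: B) = (A \subset B).
Proof.
move=> AH BH; apply/idP/idP => [/subsetP AB|]; last exact: imsetS.
apply/subsetP => x xA; rewrite -(iso_memE BH) ?(subsetP AH) //.
by apply: AB; exact: imset_f.
Qed.

Lemma iso_imset_inj (A B : {set 'I_(lab G)}) : A \subset hes G -> B \subset hes G ->
  f @: A = f @: B -> A = B.
Proof.
by move=> AH BH AB; apply/eqP; rewrite eqEsubset -(iso_subset AH BH) -(iso_subset BH AH) AB subxx.
Qed.

Lemma iso_surj h' : h' \in hes G' -> exists2 h, h \in hes G & h' = f h.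
Proof. by rewrite -fH => /imsetP. Qed.

Lemma iso_edge h : h \in hes G -> edge (s1 G') (f h) = f @: edge (s1 G) h.
Proof. by move=> hH; rewrite /edge imsetU !imset_set1 f1. Qed.

Lemma iso_stable : stable (hes G') (s0 G') (s1 G').
Proof.
split=> [_ /iso_surj[x xH ->]|_ _ /iso_surj[x xH ->] /iso_surj[y yH ->]|
  _ /iso_surj[x xH ->]|_ /iso_surj[x xH ->]].
- by rewrite -f0 // iso_mem // (st0 stG).
- rewrite -!f0 // => /f_inj; rewrite !(st0 stG) // => /(_ isT isT) /(st0I stG) -> //.
- by rewrite -f1 // iso_mem // (st1 stG).
- by rewrite -!f1 ?(st1 stG) // (st1K stG).
Qed.

Lemma iso_prerg : prerg G'.
Proof.
have stG' := iso_stable.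
have neqf x y : x \in hes G -> y \in hes G -> (f x == f y) = (x == y).
  by move=> xH yH; apply/eqP/eqP => [/f_inj->|->].
split=> //.
- move=> _ /iso_surj[x xH ->]; have [v1 v2] := pg_val pG xH.
  by rewrite -!f0 ?(st0 stG) // !neqf ?(st0 stG) // (st0 stG).
- move=> _ /iso_surj[x xH ->]; rewrite -f0 // -f1 ?(st0 stG) //.
  rewrite neqf ?(st1 stG) ?(st0 stG) // !fc ?(st1 stG) ?(st0 stG) //.
  exact: (pg_col pG).
- rewrite fori map_inj_in_uniq; first exact: (pg_uniq pG).
  by move=> A B AG BG; apply: iso_imset_inj; exact: ori_sub.
- move=> e'; rewrite fori; apply/mapP/existsP => [[e eG ->]|[_ /and3P[/iso_surj[h hH ->] hs /eqP->]]].
    have [h [hH hs ->]] := oriP _ pG eG; exists (f h).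
    by rewrite iso_mem // -iso_edge // eqxx -f1 // neqf ?(st1 stG) // hs.
  exists (edge (s1 G) h); last by rewrite -iso_edge.
  by rewrite edge_ori // -(neqf _ h) ?(st1 stG) // f1.
Qed.

Lemma iso_conn x y : x \in hes G -> y \in hes G ->
  connect (adjr (s0 G') (s1 G')) (f x) (f y) = connect (adjr (s0 G) (s1 G)) x y.
Proof.
apply: connect_image => // [z t zH zt|z t zH /orP[]/eqP->|z t zH /orP[]/eqP->].
- by apply: (conn_in stG zH); exact: connect1.
- by rewrite /adjr f0 // eqxx.
- by rewrite /adjr f1 // eqxx orbT.
- by exists (s0 G z); rewrite ?f0 // /adjr eqxx.
- by exists (s1 G z); rewrite ?f1 // /adjr eqxx orbT.
Qed.

Lemma iso_connected : connected_rg G <-> connected_rg G'.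
Proof.
split=> /connected_rgP[_ /set0Pn[h hH] conn]; apply/connected_rgP; split=> //.
- exact: iso_prerg.
- by apply/set0Pn; exists (f h); exact: iso_mem.
- move=> _ _ /iso_surj[x xH ->] /iso_surj[y yH ->]; rewrite iso_conn //.
  exact: conn.
- by apply/set0Pn; move: hH => /iso_surj[x xH _]; exists x.
- by move=> x y xH yH; rewrite -iso_conn //; apply: conn; exact: iso_mem.
Qed.

Lemma iso_cut (e : {set 'I_(lab G)}) : e \in ori G ->
  @isoby (cut e) (cut (f @: e)) f.
Proof.
move=> eG; have eH := ori_sub pG eG; split=> //= [h hH|].
  split; [exact: f0| |exact: fc].
  by rewrite (iso_memE eH hH); have [he|he] := boolP (h \in e); rewrite /= ?he ?(negPf he) ?f1.
have sub A : A \in ori G -> A \subset hes G by exact: ori_sub.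
rewrite fori; elim: (ori G) sub eG => //= e' s IHs sub.
have e'H : e' \subset hes G by apply: sub; rewrite mem_head.
have -> : (f @: e' == f @: e) = (e' == e).
  by apply/eqP/eqP => [|->//]; exact: iso_imset_inj.
rewrite inE eq_sym; case: eqP => //= _ es; rewrite IHs // => A As.
by apply: sub; rewrite inE As orbT.
Qed.

Lemma iso_contract (e : {set 'I_(lab G)}) : e \in ori G ->
  @isoby (contract e) (contract (f @: e)) f.
Proof.
move=> eG; have eH := ori_sub pG eG; have [_ _ _ cut_ori] := iso_cut eG.
have He x : x \in hes G :\: e -> x \notin e /\ x \in hes G by rewrite in_setD => /andP[].
split=> //= [x y /He[_ xH] /He[_ yH]||h /He[he hH]]; first exact: f_inj.
  apply/setP => y; rewrite in_setD -fH; apply/imsetP/andP => [[x /He[xe xH] ->]|].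
    by rewrite iso_memE // imset_f.
  case=> ye /imsetP[x xH yE]; exists x => //; rewrite in_setD xH andbT.
  by rewrite -iso_memE // -yE.
split; [|exact: f1|exact: fc].
rewrite -f0 // iso_memE ?(st0 stG) //; case: ifP => // _.
by rewrite f0 ?f1 ?(st1 stG) ?(st0 stG).
Qed.

Lemma iso_component h : h \in hes G -> @isoby (component h) (component (f h)) f.
Proof.
move=> hH; have Hin x : x \in hes (component h) -> x \in hes G by rewrite inE => /andP[].
have imH : f @: hes (component h) = hes (component (f h)).
  apply/setP => y; rewrite inE; apply/imsetP/andP => [[x]|[/iso_surj[x xH ->]]].
    rewrite inE => /andP[xH hx] ->; split; first exact: iso_mem.
    by rewrite -[connect _ _ _]/(connect (adjr (s0 G') (s1 G')) (f h) (f x)) iso_conn.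
  rewrite -[connect _ _ _]/(connect (adjr (s0 G') (s1 G')) (f h) (f x)) iso_conn //.
  by move=> hx; exists x => //; rewrite inE xH.
split=> // [x y /Hin xH /Hin yH|x /Hin xH|]; first exact: f_inj.
  by split; [exact: f0|exact: f1|exact: fc].
rewrite [LHS]/= fori filter_map; congr map; apply: eq_in_filter => e eG /=.
have cH : hes (component h) \subset hes G by apply/subsetP => x; exact: Hin.
by rewrite -[RHS](iso_subset (ori_sub pG eG) cH) imH.
Qed.

Lemma iso_fconnect x y : x \in hes G -> y \in hes G ->
  fconnect (s0 G') (f x) (f y) = fconnect (s0 G) x y.
Proof.
apply: connect_image => // [z t zH /eqP<-|z t zH /eqP<-|z t zH /eqP<-].
- exact: (st0 stG).
- by rewrite /= f0.
- by exists (s0 G z); rewrite /= ?f0.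
Qed.

Lemma iso_face h : h \in hes G -> @face L G' (f h) = f (face h).
Proof.
move=> hH; have stG' := iso_stable; rewrite /face -f1 //.
have xH := st1 stG hH; have yH := finv_in (st0 stG) xH.
apply: (st0I stG').
- by apply: (finv_in (st0 stG')); exact: iso_mem.
- exact: iso_mem.
- by rewrite -f0 // (f_finv_in (st0 stG') (st0I stG')) ?iso_mem // (f_finv_in (st0 stG) (st0I stG)).
Qed.

Lemma iso_fconnect_face x y : x \in hes G -> y \in hes G ->
  fconnect (@face L G') (f x) (f y) = fconnect (@face L G) x y.
Proof.
have faceH z : z \in hes G -> face z \in hes G.
  by move=> zH; apply: (finv_in (st0 stG)); exact: (st1 stG).
apply: connect_image => // [z t zH /eqP<-|z t zH /eqP<-|z t zH /eqP<-].
- exact: faceH.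
- by rewrite /= iso_face.
- by exists (face z); rewrite /= ?iso_face.
Qed.

Lemma iso_forall_in2 (e : {set 'I_(lab G)}) (p : rel 'I_(lab G)) (p' : rel 'I_(lab G')) :
  e \subset hes G -> {in hes G &, forall x y, p' (f x) (f y) = p x y} ->
  [forall h in f @: e, forall h' in f @: e, p' h h'] = [forall h in e, forall h' in e, p h h'].
Proof.
move=> /subsetP eH pp'; apply/forall_inP/forall_inP => all h.
  move=> he; apply/forall_inP => h' h'e; rewrite -pp' ?eH //.
  by have /forall_inP := all _ (imset_f f he); apply; exact: imset_f.
case/imsetP=> x xe ->; apply/forall_inP => _ /imsetP[y ye ->]; rewrite pp' ?eH //.
by have /forall_inP := all _ xe; apply.
Qed.

Lemma iso_loop (e : {set 'I_(lab G)}) : e \in ori G -> is_loop (f @: e) = is_loop e.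
Proof. by move=> /(ori_sub pG) eH; apply: iso_forall_in2 => // x y; exact: iso_fconnect. Qed.
End Transport.

Lemma iso_same_face G G' (f : 'I_(lab G) -> 'I_(lab G')) (e : {set 'I_(lab G)}) :
  prerg G -> isoby f -> e \in ori G ->
  leaves_in_same_face (f @: e) = leaves_in_same_face e.
Proof.
move=> pG iso eG; have isoc := iso_cut pG iso eG; have pc := cut_prerg pG eG.
rewrite /leaves_in_same_face.
apply: (iso_forall_in2 (ori_sub pG eG)) => x y xH yH.
exact: (iso_fconnect_face pc isoc).
Qed.

Lemma iso_bridge G G' (f : 'I_(lab G) -> 'I_(lab G')) (e : {set 'I_(lab G)}) :
  prerg G -> isoby f -> e \in ori G -> is_bridge (f @: e) = is_bridge e.
Proof.
move=> pG iso eG; have isoc := iso_cut pG iso eG; have pc := cut_prerg pG eG.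
congr (~~ _); apply: (iso_forall_in2 (ori_sub pG eG)) => x y xH yH.
exact: (iso_conn pc isoc).
Qed.

(** If the graphs are not connected, both classes are zero. Hence the lemma applies to the results
    of cutting without a case distinction. *)
Lemma rg_iso_eq (k : fieldType) G G' (f : 'I_(lab G) -> 'I_(lab G')) :
  prerg G -> isoby f -> rg k G = rg k G'.
Proof.
move=> pG iso; have cE := iso_connected pG iso; apply/eqP; rewrite -subr_eq0 /rg /cls.
have [cG|ncG] := pselect (connected_rg G).
  have cG' := iffLR cE cG; have GG' : rg_iso G G' by exists f.
  by rewrite -(linB (pi_linear _)) (pi_rel (rg_isom k cG cG' GG')).
have ncG' : ~ connected_rg G' by move/cE.
by rewrite (pi_rel (rg_bad k ncG)) (pi_rel (rg_bad k ncG')) subr0.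
Qed.

Lemma rg_nconn (k : fieldType) G : ~ connected_rg G -> rg k G = 0.
Proof. by move=> ncG; exact: (pi_rel (rg_bad k ncG)). Qed.

Lemma reorient_prerg G s : prerg G -> perm_eq s (ori G) -> prerg (reorient s).
Proof.
case=> st val colG un oriG sG; split=> //=; first by rewrite (perm_uniq sG).
by move=> e; rewrite (perm_mem sG).
Qed.

Lemma reorient_connected G s : perm_eq s (ori G) ->
  connected_rg (reorient s) <-> connected_rg G.
Proof.
case: G s => n H a b c o s /= so.
split=> /connected_rgP[pG ne conn]; apply/connected_rgP; split=> //.
  by have := reorient_prerg pG (_ : perm_eq o s); rewrite perm_sym => /(_ so).
exact: (reorient_prerg pG so).
Qed.

Lemma rg_reorient (k : fieldType) G s : perm_eq s (ori G) ->
  rg k (reorient s) = osgn s (ori G) *: rg k G.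
Proof.
move=> sG; have [cG|ncG] := pselect (connected_rg G).
  apply/eqP; rewrite -subr_eq0; have := pi_rel (rg_orient k cG sG).
  by rewrite (linB (pi_linear _)) (linZ (pi_linear _)) => /eqP.
by rewrite !rg_nconn ?scaler0 // => /(reorient_connected sG).
Qed.
End Iso.

(** * Sums over edges *)

Lemma big_rem_cond (V : nmodType) (X : eqType) (s : seq X) x (P : pred X) (F : X -> V) :
  uniq s -> \sum_(y <- rem x s | P y) F y = \sum_(y <- s | (y != x) && P y) F y.
Proof. by move=> us; rewrite rem_filter // big_filter_cond. Qed.

(** The terms at (x, y) and (y, x) cancel. The induction removes the row and the column of the first
    entry together, and the diagonal term between them vanishes by hypothesis. *)
Lemma antisym_sum0 (V : zmodType) (X : eqType) (s : seq X) (T : X -> X -> V) :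
  {in s &, forall x y, T x y = - T y x} -> {in s, forall x, T x x = 0} ->
  \sum_(x <- s) \sum_(y <- s) T x y = 0.
Proof.
elim: s => [|x s IHs] TN T0; first by rewrite big_nil.
rewrite big_cons big_cons (T0 x) ?mem_head // add0r.
under [X in _ + X]eq_bigr do rewrite big_cons.
rewrite big_split /= addrA IHs => [|y z ys zs|y ys]; last 2 first.
- by apply: TN; rewrite inE ?ys ?zs orbT.
- by apply: T0; rewrite inE ys orbT.
rewrite addr0 -big_split big_seq big1 //= => y ys.
by rewrite (TN x y) ?mem_head ?inE ?ys ?orbT // addNr.
Qed.

Lemma rem_rem (X : eqType) (s : seq X) x y : uniq s -> rem x (rem y s) = rem y (rem x s).
Proof.
move=> us; rewrite !rem_filter ?filter_uniq ?rem_uniq // -!filter_predI.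
by apply: eq_filter => z /=; rewrite andbC.
Qed.

Section Signs2.
Variables (R : comNzRingType) (X : eqType).
Implicit Types (s t : seq X).

Lemma osgn_rem2 s x y : uniq s -> x \in s -> y \in s -> y != x ->
  osgn s (x :: rem x s) * osgn (rem x s) (y :: rem y (rem x s))
    = osgn s (x :: y :: rem y (rem x s)) :> R.
Proof.
move=> us xs ys yx; have xrs : x \notin rem x s by rewrite mem_rem_uniqF.
have yrs : y \in rem x s by rewrite mem_rem_uniq // inE yx.
rewrite -(osgn_cons R xrs (perm_to_rem yrs)) osgnM // ?perm_to_rem //.
by rewrite perm_cons perm_to_rem.
Qed.

Lemma osgn_transp s t x y : uniq s -> perm_eq s (x :: y :: t) ->
  osgn s (y :: x :: t) = - osgn s (x :: y :: t) :> R.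
Proof.
move=> us st; have ut : uniq ([:: x] ++ [:: y] ++ t) by rewrite -(perm_uniq st).
have sw : perm_eq ([:: x; y] ++ t) ([:: y; x] ++ t).
  by rewrite perm_cat2r; exact: (permEl (perm_catC [:: x] [:: y])).
have E : osgn ([:: x; y] ++ t) ([:: y; x] ++ t) = -1 :> R.
  rewrite osgn_catr //; last exact: (permEl (perm_catC [:: x] [:: y])).
  rewrite (@osgn_swap R _ [:: x] [:: y]) ?expr1 //.
  by move: ut; rewrite catA cat_uniq => /andP[].
by rewrite -(osgnM R us st sw) [osgn (x :: _) _]E mulrN1.
Qed.
End Signs2.

Section EdgeSum.
Variables (k : fieldType) (L : Type).
Implicit Type G : rgraph L.
Local Notation rg := (rg k).

Lemma kills_rg (W : lmodType k) (F : rgraph L -> W) :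
  (forall G, ~ connected_rg G -> F G = 0) ->
  (forall G G' (f : 'I_(lab G) -> 'I_(lab G')), connected_rg G -> connected_rg G' ->
     isoby f -> F G = F G') ->
  (forall G s, connected_rg G -> perm_eq s (ori G) ->
     F (reorient s) = osgn s (ori G) *: F G) ->
  forall r, rg_rel r -> fglift F r = 0.
Proof.
move=> Fbad Fiso Fori _ [G ncG|G G' cG cG' [f fP]|G s cG sG].
- by rewrite liftU scale1r Fbad.
- by rewrite raddfB /= !liftU !scale1r (Fiso _ _ f cG cG' fP) subrr.
- by rewrite raddfB /= fgliftZ !liftU !scale1r Fori // subrr.
Qed.

Variables (P : forall G, {set 'I_(lab G)} -> bool)
  (op : forall G, {set 'I_(lab G)} -> rgraph L).

(** What an operation on single edges must satisfy for its sum to descend to [RG]. Through [eo_conn]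
    the formula [edge_sum_rg] also holds for disconnected graphs, where both sides vanish; such
    graphs arise when a second operation follows a cut. *)
Record edge_op : Prop := {
  eo_isoP : forall G G' (f : 'I_(lab G) -> 'I_(lab G')) (e : {set 'I_(lab G)}),
    prerg G -> isoby f -> e \in ori G -> P (f @: e) = P e;
  eo_iso : forall G G' (f : 'I_(lab G) -> 'I_(lab G')) (e : {set 'I_(lab G)}),
    prerg G -> isoby f -> e \in ori G -> P e -> rg (op (f @: e)) = rg (op e);
  eo_oriP : forall G s (e : {set 'I_(lab G)}), @P (reorient s) e = P e;
  eo_ori : forall G s (e : {set 'I_(lab G)}), perm_eq s (ori G) ->
    rg (@op (reorient s) e) = osgn (rem e s) (rem e (ori G)) *: rg (op e);
  eo_conn : forall G (e : {set 'I_(lab G)}), prerg G -> e \in ori G -> P e ->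
    connected_rg (op e) -> connected_rg G }.

Hypothesis eoP : edge_op.

Definition edge_terms G : RG k L :=
  \sum_(e <- ori G | P e) osgn (ori G) (e :: rem e (ori G)) *: rg (op e).

Lemma edge_sum_kills r : rg_rel r ->
  fglift (fun G => if `[< connected_rg G >] then edge_terms G else 0) r = 0.
Proof.
apply: kills_rg => [G ncG|G G' f cG cG' iso|G s cG sG].
- by rewrite asboolF.
- rewrite !asboolT // /edge_terms; have pG := connected_prerg cG.
  have [_ _ _ ->] := iso; rewrite big_map big_seq_cond [RHS]big_seq_cond.
  apply: eq_big => [e|e /andP[eG Pe]].
    by apply: andb_id2l => eG; rewrite (eo_isoP eoP pG iso eG).
  have f_inj : {in ori G &, injective (fun e : {set _} => f @: e)}.
    by move=> A B AG BG; apply: (iso_imset_inj iso); exact: ori_sub.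
  rewrite (eo_iso eoP pG iso eG Pe); congr (_ *: _).
  have -> : rem (f @: e) [seq f @: e | e : {set _} <- ori G]
      = [seq f @: e | e : {set _} <- rem e (ori G)].
    elim: (ori G) f_inj eG => //= e' s IHs f_inj.
    have neq : (f @: e' == f @: e) = (e' == e) \/ e \notin e' :: s.
      have [es|es] := boolP (e \in e' :: s); last by right.
      left; apply/eqP/eqP => [|-> //]; apply: f_inj => //; exact: mem_head.
    move=> es; case: neq; rewrite ?es // => ->; move: es; rewrite inE eq_sym.
    case: eqP => //= _ es; rewrite IHs // => A B As Bs; apply: f_inj; rewrite inE ?As ?Bs orbT //.
  rewrite -[_ :: map _ _]/(map _ (e :: rem e (ori G))) osgn_map //.
  exact: perm_to_rem.
- rewrite !asboolT //; last exact/reorient_connected.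
  have pG := connected_prerg cG; have uG := pg_uniq pG.
  have us : uniq s by rewrite (perm_uniq sG).
  rewrite /edge_terms scaler_sumr /= (perm_big _ sG) /= big_seq_cond [RHS]big_seq_cond.
  under eq_bigl => e do rewrite (eo_oriP eoP).
  apply: eq_bigr => e /andP[eG _]; rewrite (eo_ori eoP) // !scalerA; congr (_ *: _).
  have es : e \in s by rewrite (perm_mem sG).
  have remP : perm_eq (rem e s) (rem e (ori G)).
    by rewrite -(perm_cons e) -(permPl (perm_to_rem es)) (perm_trans sG) ?perm_to_rem.
  have ens : e \notin rem e s by rewrite mem_rem_uniqF.
  rewrite -(osgn_cons _ ens remP) !osgnM // ?perm_to_rem // ?perm_cons //.
Qed.

Lemma edge_sum_linear : linear (edge_sum (k := k) P op).
Proof. exact: lin_lift_linear edge_sum_kills. Qed.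

Lemma edge_sum_rg G : prerg G -> edge_sum P op (rg G) = edge_terms G.
Proof.
move=> pG; have [cG|ncG] := pselect (connected_rg G).
  by rewrite [LHS](lin_lift_cls _ edge_sum_kills) asboolT.
rewrite rg_nconn // (lin0 edge_sum_linear) /edge_terms big_seq_cond big1 // => e /andP[eG Pe].
by rewrite rg_nconn ?scaler0 // => /(eo_conn eoP pG eG Pe).
Qed.
End EdgeSum.

Section EdgeOps.
Variables (k : fieldType) (L : Type).
Implicit Type G : rgraph L.
Local Notation rg := (rg k).

Definition iso_invariant (P : forall G, {set 'I_(lab G)} -> bool) : Prop :=
  (forall G G' (f : 'I_(lab G) -> 'I_(lab G')) (e : {set 'I_(lab G)}),
    prerg G -> isoby f -> e \in ori G -> P _ (f @: e) = P _ e) /\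
  forall G s (e : {set 'I_(lab G)}), P (reorient s) e = P G e.

Lemma cut_connected G (e : {set 'I_(lab G)}) : prerg G -> e \in ori G ->
  connected_rg (cut e) -> connected_rg G.
Proof.
move=> pG eG /connected_rgP[_ ne conn]; apply/connected_rgP; split=> // x y xH yH.
have [h [hH hs eE]] := oriP _ pG eG.
by have := conn x y xH yH; rewrite /= eE; exact: conn_cut.
Qed.

Lemma cut_edge_op P : iso_invariant P -> edge_op k P (@cut L).
Proof.
case=> P_iso P_ori; split=> [||||G e pG eG _].
- exact: P_iso.
- move=> G G' f e pG iso eG _; symmetry.
  exact: (rg_iso_eq k (cut_prerg pG eG) (iso_cut pG iso eG)).
- exact: P_ori.
- move=> G s e sG; apply: (@rg_reorient _ k (@cut L G e) (rem e s)) => /=.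
  have [eG|eG] := boolP (e \in ori G); last first.
    by rewrite !rem_id // (perm_mem sG).
  have es : e \in s by rewrite (perm_mem sG).
  by rewrite -(perm_cons e) -(permPl (perm_to_rem es)) (perm_trans sG) ?perm_to_rem.
- exact: cut_connected.
Qed.

Lemma same_face_invariant : iso_invariant (@leaves_in_same_face L).
Proof. by split=> // G G' f e; exact: iso_same_face. Qed.

Lemma predC_invariant P : iso_invariant P -> iso_invariant (fun G e => ~~ P G e).
Proof.
case=> P_iso P_ori; split=> [G G' f e pG iso eG|G s e]; congr (~~ _).
  exact: (P_iso _ _ f).
exact: P_ori.
Qed.

Lemma predT_invariant : iso_invariant (fun _ _ => true).
Proof. by []. Qed.

Lemma loop_invariant : iso_invariant (@is_loop L).
Proof. by split=> // G G' f e pG iso eG; exact: (iso_loop pG iso). Qed.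

Lemma nonloopP G (e : {set 'I_(lab G)}) h : prerg G -> e \in ori G -> h \in e ->
  ~~ is_loop e -> vcl (s0 G) h <> vcl (s0 G) (s1 G h).
Proof. by move=> pG eG he nl /(loopP pG eG he); exact/negP. Qed.

Lemma contract_conn G (e : {set 'I_(lab G)}) x y : prerg G -> e \in ori G -> ~~ is_loop e ->
  x \in hes G :\: e -> y \in hes G :\: e ->
  connect (adjr (s0 (contract e)) (s1 (contract e))) x y
    = connect (adjr (s0 G) (s1 G)) x y.
Proof.
move=> pG eG nl; have [h [hH hs eE]] := oriP _ pG eG.
have he : h \in e by rewrite eE !inE eqxx.
have := nonloopP pG eG he nl; rewrite eE /= => nl' xH yH.
exact: (conn_con (pg_st pG) (pg_val pG) hH nl').
Qed.

Lemma contract_connectedE G (e : {set 'I_(lab G)}) : prerg G -> e \in ori G -> ~~ is_loop e ->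
  connected_rg (contract e) <-> connected_rg G.
Proof.
move=> pG eG nl; have [h [hH hs eE]] := oriP _ pG eG; have stG := pg_st pG.
have he : h \in e by rewrite eE !inE eqxx.
have nl' := nonloopP pG eG he nl.
have s0e g : g \in e -> s0 G g \in hes G :\: e.
  rewrite eE => ge; rewrite in_setD (s0_edge stG (pg_val pG) hH nl' ge).
  by apply: (st0 stG); move: ge; rewrite -eE => /(ori_mem pG eG)[].
have pc := contract_prerg pG eG nl.
split=> /connected_rgP[_ ne conn]; apply/connected_rgP; split=> //.
- by apply/set0Pn; exists h.
- have rep x : x \in hes G -> exists x', [/\ x' \in hes G :\: e,
      connect (adjr (s0 G) (s1 G)) x x' & connect (adjr (s0 G) (s1 G)) x' x].
    move=> xH; have [xe|xe] := boolP (x \in e).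
      exists (s0 G x); split; [exact: s0e|exact: conn_s0|].
      by apply: (conn_sym stG xH); exact: conn_s0.
    by exists x; rewrite in_setD xe xH.
  move=> x y /rep[x' [x'H xx' _]] /rep[y' [y'H _ yy']].
  apply: connect_trans xx' (connect_trans _ yy').
  by rewrite -(contract_conn pG eG nl) //; apply: conn.
- by apply/set0Pn; exists (s0 G h); exact: s0e.
- move=> x y xH yH; rewrite (contract_conn pG eG nl) //.
  by move: xH yH; rewrite !in_setD => /andP[_ xH] /andP[_ yH]; exact: conn.
Qed.

Lemma contract_edge_op : edge_op k (fun G e => ~~ is_loop e) (@contract L).
Proof.
have [P_iso P_ori] := predC_invariant loop_invariant.
split=> [|G G' f e pG iso eG nl|||G e pG eG nl].
- exact: P_iso.
- symmetry.
  exact: (rg_iso_eq k (contract_prerg pG eG nl) (iso_contract pG iso eG)).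
- exact: P_ori.
- move=> G s e sG; apply: (@rg_reorient _ k (@contract L G e) (rem e s)) => /=.
  have [eG|eG] := boolP (e \in ori G); last first.
    by rewrite !rem_id // (perm_mem sG).
  have es : e \in s by rewrite (perm_mem sG).
  by rewrite -(perm_cons e) -(permPl (perm_to_rem es)) (perm_trans sG) ?perm_to_rem.
- by move/(contract_connectedE pG eG nl).
Qed.

Definition cut_sum : RG k L -> RG k L := edge_sum (fun _ _ => true) (@cut L).

Lemma cut_sum_linear : linear cut_sum.
Proof. exact: (edge_sum_linear (cut_edge_op predT_invariant)). Qed.

Lemma boundary_linear : linear (@boundary k L).
Proof. exact: (edge_sum_linear contract_edge_op). Qed.

(** With the face condition for [P], the transposes of [nabla] and [delta_i] combine into one
    operation in which faces no longer occur. *)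
Lemma cut_sum_split P (x : RG k L) : iso_invariant P ->
  edge_sum P (@cut L) x + edge_sum (fun G e => ~~ P G e) (@cut L) x = cut_sum x.
Proof.
move=> P_inv; have lin1 := edge_sum_linear (cut_edge_op P_inv).
have lin2 := edge_sum_linear (cut_edge_op (predC_invariant P_inv)).
apply: (@eq_lin_cls _ _ _ _ (fun x : RG k L => edge_sum P (@cut L) x
  + edge_sum (fun G e => ~~ P G e) (@cut L) x) cut_sum) => [a u v||G].
- by rewrite lin1 lin2 scalerDr; zmod.
- exact: cut_sum_linear.
rewrite -[cls _ G]/(rg G); have [cG|ncG] := pselect (connected_rg G); last first.
  by rewrite rg_nconn // (lin0 lin1) (lin0 lin2) (lin0 cut_sum_linear) addr0.
have pG := connected_prerg cG.
rewrite (edge_sum_rg (cut_edge_op P_inv)) // (edge_sum_rg (cut_edge_op (predC_invariant P_inv))) //.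
rewrite [cut_sum _](edge_sum_rg (cut_edge_op predT_invariant)) // /edge_terms.
by rewrite [RHS](bigID (P G)).
Qed.

Lemma rg_hom G : prerg G -> ghom (- (size (ori G))%:Z) (rg G : RG k L).
Proof.
move=> pG; have [cG|ncG] := pselect (connected_rg G); last by rewrite rg_nconn //; exact: rpred0.
by apply: mem_lspan; exists G.
Qed.

Lemma edge_sum_hom P op j (x : RG k L) : edge_op k P op ->
  (forall G (e : {set 'I_(lab G)}), prerg G -> e \in ori G -> P G e ->
     prerg (op G e) /\ size (ori (op G e)) = (size (ori G)).-1) ->
  ghom j x -> ghom (j + 1) (edge_sum P op x).
Proof.
move=> eoP op_pre; have E_lin := edge_sum_linear eoP; move: x.
apply: lspan_ind => [|a _ x [G [cG jE ->]] IHx].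
  by rewrite (lin0 E_lin); exact: rpred0.
rewrite E_lin; apply: lspan_lin => //; have pG := connected_prerg cG.
rewrite (edge_sum_rg eoP) // /edge_terms big_seq_cond; apply: rpred_sum => e /andP[eG Pe].
have [pop sop] := op_pre G e pG eG Pe; apply: spanZ.
have := rg_hom pop; rewrite sop -jE /=; have : (0 < size (ori G))%N.
  by case: (ori G) eG.
by case: (size _) => // n _ /=; rewrite -addn1 PoszD opprD addrNK.
Qed.

Lemma boundary_hom j (x : RG k L) : ghom j x -> ghom (j + 1) (boundary x).
Proof.
apply: (edge_sum_hom contract_edge_op) => G e pG eG nl; split.
  exact: contract_prerg.
by rewrite size_rem.
Qed.

Lemma cut_hom P j (x : RG k L) : iso_invariant P ->
  ghom j x -> ghom (j + 1) (edge_sum P (@cut L) x).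
Proof.
move=> P_inv; apply: (edge_sum_hom (cut_edge_op P_inv)) => G e pG eG _; split.
  exact: cut_prerg.
by rewrite size_rem.
Qed.

Section Composite.
Variables (P P' : forall G, {set 'I_(lab G)} -> bool).
Variables (H H' : forall G, {set 'I_(lab G)} -> {set 'I_(lab G)}).
Variables (a a' b b' : forall G, {set 'I_(lab G)} -> 'I_(lab G) -> 'I_(lab G)).
(** Cutting and contracting both have this shape. As the labels are kept, an edge of [op e] is
    literally an edge of [G], and the two orders of two operations can be compared. *)
Let op G e : rgraph L := @RGraph L (lab G) (H e) (a e) (b e) (col G) (rem e (ori G)).
Let op' G e : rgraph L := @RGraph L (lab G) (H' e) (a' e) (b' e) (col G) (rem e (ori G)).
Hypotheses (eoP : edge_op k P op) (eoP' : edge_op k P' op').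
Hypothesis pre : forall G (e : {set 'I_(lab G)}),
  prerg G -> e \in ori G -> P e -> prerg (op e).

(** The two signs merge into that of moving both edges to the front. Summation over ordered pairs
    makes the comparison of the two orders a question of symmetry in [e] and [f]. *)
Lemma edge_sum_comp G : prerg G ->
  edge_sum P' op' (edge_sum P op (rg G)) =
  \sum_(e <- ori G) \sum_(f <- ori G) if [&& f != e, P e & @P' (op e) f] then
    osgn (ori G) (e :: f :: rem f (rem e (ori G))) *: rg (@op' (op e) f) else 0.
Proof.
move=> pG; rewrite (edge_sum_rg eoP pG) /edge_terms (lin_sum (edge_sum_linear eoP')).
rewrite big_mkcond big_seq [RHS]big_seq; apply: eq_bigr => e eG.
case: ifP => Pe; last by rewrite big1 // => f _; rewrite andbF.
rewrite (linZ (edge_sum_linear eoP')) (edge_sum_rg eoP' (pre pG eG Pe)) /edge_terms /=.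
rewrite (big_rem_cond _ _ _ (pg_uniq pG)) scaler_sumr big_mkcond big_seq [RHS]big_seq.
apply: eq_bigr => f fG; case: ifP => //= /andP[fe _].
by rewrite scalerA osgn_rem2 ?(pg_uniq pG).
Qed.
End Composite.

Lemma osgn_edges_transp G (e f : {set 'I_(lab G)}) : prerg G ->
  e \in ori G -> f \in ori G -> f != e ->
  osgn (ori G) (f :: e :: rem e (rem f (ori G)))
    = - osgn (ori G) (e :: f :: rem f (rem e (ori G))) :> k.
Proof.
move=> pG eG fG fe; have uG := pg_uniq pG; rewrite (rem_rem e f uG) osgn_transp //.
apply: perm_trans (perm_to_rem eG) _; rewrite perm_cons; apply: perm_to_rem.
by rewrite mem_rem_uniq // inE fe.
Qed.

Lemma cut_cut G (e f : {set 'I_(lab G)}) : prerg G ->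
  @cut L (cut e) f = @cut L (cut f) e.
Proof.
move=> pG; congr RGraph; last by rewrite rem_rem ?(pg_uniq pG).
by apply/funext => x /=; case: (x \in f); case: (x \in e).
Qed.

Lemma contract_cut G (e f : {set 'I_(lab G)}) : prerg G -> e \in ori G -> f \in ori G ->
  f != e -> @contract L (cut e) f = @cut L (contract f) e.
Proof.
move=> pG eG fG fe; congr RGraph; last by rewrite rem_rem ?(pg_uniq pG).
apply/funext => x /=; case: ifP => // xf; case: ifP => // xe; case/eqP: fe.
exact: (ori_disjoint pG fG eG xf xe).
Qed.

(** The right-hand side says that neither edge is a loop and that they are not parallel. This is
    symmetric in the two edges, although the left-hand side is not visibly so. *)
Lemma contract2_vcl G (e f : {set 'I_(lab G)}) h g : prerg G -> e \in ori G -> f \in ori G ->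
  f != e -> h \in e -> g \in f ->
  (~~ is_loop e && ~~ @is_loop L (contract e) f) <->
  [/\ vcl (s0 G) h <> vcl (s0 G) (s1 G h), vcl (s0 G) g <> vcl (s0 G) (s1 G g),
    ~ (vcl (s0 G) g = vcl (s0 G) h /\ vcl (s0 G) (s1 G g) = vcl (s0 G) (s1 G h)) &
    ~ (vcl (s0 G) g = vcl (s0 G) (s1 G h) /\ vcl (s0 G) (s1 G g) = vcl (s0 G) h)].
Proof.
move=> pG eG fG fe he gf; have stG := pg_st pG.
have [hH hs eE] := ori_mem pG eG he; have [gH gs fE] := ori_mem pG fG gf.
have g'H := st1 stG gH.
have notin x : x \in f -> x \notin e.
  by move=> xf; apply: contraNN fe => xe; apply/eqP/(ori_disjoint pG fG eG xf xe).
have gHe : g \in hes G :\: e by rewrite in_setD notin.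
have g'f : s1 G g \in f by rewrite fE !inE eqxx orbT.
have g'He : s1 G g \in hes G :\: e by rewrite in_setD notin.
have main : ~~ is_loop e -> reflect
    ([\/ vcl (s0 G) g = vcl (s0 G) (s1 G g),
      vcl (s0 G) g = vcl (s0 G) h /\ vcl (s0 G) (s1 G h) = vcl (s0 G) (s1 G g) |
      vcl (s0 G) g = vcl (s0 G) (s1 G h) /\ vcl (s0 G) h = vcl (s0 G) (s1 G g)])
    (@is_loop L (contract e) f).
  move=> nl; have nl' := nonloopP pG eG he nl.
  have pc := contract_prerg pG eG nl.
  have fc : f \in ori (contract e) by rewrite /= mem_rem_uniq ?(pg_uniq pG) // inE fe.
  apply: (iffP (loopP pc fc gf)) => /=; rewrite eE in gHe g'He *.
    by move/(vcl_con stG (pg_val pG) hH nl' gHe g'He).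
  by move/(vcl_con stG (pg_val pG) hH nl' gHe g'He).
split=> [/andP[nl nl2]|[v1 v2 v3 v4]].
  have nl' := nonloopP pG eG he nl; split=> // [E|[E1 E2]|[E1 E2]]; move/negP: nl2; apply.
  - by apply/(main nl)/Or31.
  - by apply/(main nl)/Or32.
  - by apply/(main nl)/Or33.
have nl : ~~ is_loop e by apply/negP => /(loopP pG eG he).
rewrite nl /=; apply/negP => /(main nl)[//|[E1 E2]|[E1 E2]]; [apply: v3|apply: v4]; by split.
Qed.

Lemma contract2_loop G (e f : {set 'I_(lab G)}) : prerg G -> e \in ori G -> f \in ori G ->
  f != e ->
  ~~ is_loop e && ~~ @is_loop L (contract e) f = ~~ is_loop f && ~~ @is_loop L (contract f) e.
Proof.
move=> pG eG fG fe; have [h he] := ori_neq0 pG eG; have [g gf] := ori_neq0 pG fG.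
have ef : e != f by rewrite eq_sym.
apply/idP/idP.
  move/(contract2_vcl pG eG fG fe he gf) => [v1 v2 v3 v4].
  by apply/(contract2_vcl pG fG eG ef gf he); split=> // [[E1 E2]|[E1 E2]];
    [apply: v3|apply: v4].
move/(contract2_vcl pG fG eG ef gf he) => [v1 v2 v3 v4].
by apply/(contract2_vcl pG eG fG fe he gf); split=> // [[E1 E2]|[E1 E2]];
  [apply: v3|apply: v4].
Qed.

(** The two graphs may differ at labels that are no longer half-edges, so only their classes are
    compared, through the identity map. *)
Lemma contract_contract G (e f : {set 'I_(lab G)}) : prerg G -> e \in ori G -> f \in ori G ->
  f != e -> ~~ is_loop e && ~~ @is_loop L (contract e) f ->
  rg (@contract L (contract e) f) = rg (@contract L (contract f) e).
Proof.
move=> pG eG fG fe nlef; have /andP[nlf nle] := nlef.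
have := nlef; rewrite (contract2_loop pG eG fG fe) => /andP[nlf' nle'].
have uG := pg_uniq pG; have stG := pg_st pG.
have notin x : x \in f -> x \notin e.
  by move=> xf; apply: contraNN fe => xe; apply/eqP/(ori_disjoint pG fG eG xf xe).
have notin' x : x \in e -> x \in f = false by move=> xe; apply/negP => /notin; rewrite xe.
apply: (@rg_iso_eq L k (@contract L (contract e) f) (@contract L (contract f) e) (fun x => x)).
  apply: contract_prerg => //; first exact: contract_prerg.
  by rewrite /= mem_rem_uniq // inE fe.
split=> //=.
- by rewrite imset_id !setDDl setUC.
- move=> x; rewrite !in_setD => /and3P[xf xe xH]; split=> //.
  have s0H := st0 stG xH.
  have e1 z : z \in e -> [/\ z \in hes G, s1 G z \in e & s1 G (s1 G z) = z].
    move=> ze; have [zH _ eE] := ori_mem pG eG ze.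
    by rewrite (st1K stG) // eE !inE eqxx orbT.
  have f1 z : z \in f -> [/\ z \in hes G, s1 G z \in f & s1 G (s1 G z) = z].
    move=> zf; have [zH _ fE] := ori_mem pG fG zf.
    by rewrite (st1K stG) // fE !inE eqxx orbT.
  have [xe0|xe0] := boolP (s0 G x \in e); have [xf0|xf0] := boolP (s0 G x \in f) => //.
  + by rewrite (notin' _ xe0) in xf0.
  + have [gH g'e gK] := e1 _ xe0; have [g'H _ _] := e1 _ g'e.
    have [xf1|xf1] := boolP (s0 G (s1 G (s0 G x)) \in f); rewrite ?xe0 //=.
    have [kH k'f kK] := f1 _ xf1; have [k'H _ _] := f1 _ k'f.
    (* Having passed [e] and then [f], the rotation does not meet [e] again: otherwise [f] would be
       parallel to [e] or a loop. *)
    have ke : s0 G (s1 G (s0 G (s1 G (s0 G x)))) \notin e.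
      have /(contract2_vcl pG eG fG fe xe0 xf1)[v1 v2 v3 v4] := nlef.
      have [_ _ eE] := ori_mem pG eG xe0.
      have vk := vcl_s0 stG g'H; have vk' := vcl_s0 stG k'H.
      rewrite eE !inE negb_or; apply/andP; split; apply/eqP => E; rewrite E in vk'.
        by apply: v4; rewrite vk vk'.
      by apply: v2; rewrite vk vk'.
    by rewrite (negPf ke).
  + have [gH g'f gK] := f1 _ xf0; have [g'H _ _] := f1 _ g'f.
    have [xe1|xe1] := boolP (s0 G (s1 G (s0 G x)) \in e); rewrite ?xf0 //=.
    have [kH k'e kK] := e1 _ xe1; have [k'H _ _] := e1 _ k'e.
    have kf : s0 G (s1 G (s0 G (s1 G (s0 G x)))) \notin f.
      have ef : e != f by rewrite eq_sym.
      have := nlef; rewrite (contract2_loop pG eG fG fe).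
      move=> /(contract2_vcl pG fG eG ef xf0 xe1)[v1 v2 v3 v4].
      have [_ _ fE] := ori_mem pG fG xf0.
      have vk := vcl_s0 stG g'H; have vk' := vcl_s0 stG k'H.
      rewrite fE !inE negb_or; apply/andP; split; apply/eqP => E; rewrite E in vk'.
        by apply: v4; rewrite vk vk'.
      by apply: v2; rewrite vk vk'.
    by rewrite (negPf kf).
  + by case: ifP => // xe1; case/negP: xe0.
- by rewrite rem_rem // -[LHS]map_id; apply: eq_map => A; rewrite imset_id.
Qed.
End EdgeOps.

(** * The transposed differential squares to zero *)

Section Squares.
Variables (k : fieldType) (L : Type).
Implicit Type G : rgraph L.
Local Notation rg := (rg k).
Local Notation cutop := (@cut L).
Local Notation conop := (@contract L).

Let cut_eo := cut_edge_op k (@predT_invariant L).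
Let con_eo := contract_edge_op k L.

Let cut_pre G (e : {set 'I_(lab G)}) : prerg G -> e \in ori G -> true -> prerg (cut e).
Proof. by move=> pG eG _; exact: cut_prerg. Qed.

Lemma eq_RG (W : lmodType k) (f g : RG k L -> W) : linear f -> linear g ->
  (forall G, connected_rg G -> f (rg G) = g (rg G)) -> f =1 g.
Proof.
move=> f_lin g_lin fg; apply: eq_lin_cls => // G; rewrite -[cls _ G]/(rg G).
have [/fg//|ncG] := pselect (connected_rg G).
by rewrite rg_nconn // !lin0.
Qed.

Lemma linear0 (U W : lmodType k) : linear (fun _ : U => 0 : W).
Proof. by move=> a x y; rewrite scaler0 addr0. Qed.

Lemma cut_sum_sq (x : RG k L) : cut_sum (cut_sum x) = 0.
Proof.
move: x; apply: eq_RG => [a x y||G cG]; first by rewrite !cut_sum_linear.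
  exact: linear0.
have pG := connected_prerg cG.
have -> : cut_sum (cut_sum (rg G)) = _ := @edge_sum_comp k L _ _ _ _ _ _ _ _ cut_eo cut_eo cut_pre G pG.
apply: antisym_sum0 => [e f eG fG|e eG]; last by rewrite eqxx.
rewrite !andbT [in RHS]eq_sym; case: eqP => [_|/eqP fe] /=; first by rewrite oppr0.
have ef : e != f by rewrite eq_sym.
have E := cut_cut f e pG; rewrite /cut /= in E.
by rewrite /= E (osgn_edges_transp k pG fG eG ef) scaleNr.
Qed.

Lemma boundary_sq (x : RG k L) : boundary (boundary x) = 0.
Proof.
move: x; apply: eq_RG => [a x y||G cG]; first by rewrite !boundary_linear.
  exact: linear0.
have pG := connected_prerg cG.
have -> : boundary (boundary (rg G)) = _ :=
  @edge_sum_comp k L _ _ _ _ _ _ _ _ con_eo con_eo (@contract_prerg L) G pG.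
apply: antisym_sum0 => [e f eG fG|e eG]; last by rewrite eqxx.
rewrite [f == e]eq_sym; have [_|ef] := eqVneq e f; first by rewrite oppr0.
have fe : f != e by rewrite eq_sym.
have := contract2_loop pG eG fG fe; rewrite /= => ->; case: ifP => nl; last by rewrite oppr0.
have E := contract_contract k pG fG eG ef nl; rewrite /contract in E.
by rewrite -E (osgn_edges_transp k pG fG eG ef) scaleNr.
Qed.

Lemma cut_boundary (x : RG k L) : cut_sum (boundary x) + boundary (cut_sum x) = 0.
Proof.
move: x; apply: eq_RG => [a x y||G cG].
- by rewrite !(boundary_linear, cut_sum_linear) scalerDr; zmod.
- exact: linear0.
have pG := connected_prerg cG.
have -> : cut_sum (boundary (rg G)) = _ :=
  @edge_sum_comp k L _ _ _ _ _ _ _ _ con_eo cut_eo (@contract_prerg L) G pG.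
have -> : boundary (cut_sum (rg G)) = _ := @edge_sum_comp k L _ _ _ _ _ _ _ _ cut_eo con_eo cut_pre G pG.
rewrite [X in _ + X]exchange_big -big_split big_seq big1 //= => e eG.
rewrite -big_split big_seq big1 //= => f fG; rewrite andbT.
rewrite [e == f]eq_sym; have [|fe] := eqVneq f e => /=; first by rewrite addr0.
have ef : e != f by rewrite eq_sym.
(* A cut leaves the vertices unchanged, hence also the condition of being a loop. *)
rewrite -[@is_loop L (cut f) e]/(is_loop e); case: ifP => nl; last by rewrite addr0.
have E := contract_cut pG fG eG ef; rewrite /contract /cut /= in E.
rewrite -E (osgn_edges_transp k pG eG fG fe) scaleNr addrN //.
Qed.

Definition codiff (x : RG k L) : RG k L := cut_sum x - boundary x.

Lemma codiff_linear : linear codiff.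
Proof.
move=> a x y; rewrite /codiff cut_sum_linear boundary_linear scalerBr; zmod.
Qed.

Lemma codiff_sq x : codiff (codiff x) = 0.
Proof.
rewrite /codiff (linB (@cut_sum_linear k L)) (linB (@boundary_linear k L)) cut_sum_sq boundary_sq.
by rewrite subr0 add0r -opprD cut_boundary oppr0.
Qed.

Lemma codiff_hom j x : ghom j x -> ghom (j + 1) (codiff x).
Proof.
by move=> hx; apply: rpredB; [exact: (cut_hom (@predT_invariant L))|exact: boundary_hom].
Qed.
End Squares.

(** * The bracket *)

Section OsgnBlocks.
Variables (R : comNzRingType) (X : eqType).
Implicit Types (s t a b : seq X).

Lemma osgn_block s1 s2 t1 t2 e : uniq (s1 ++ e :: s2) -> perm_eq s1 t1 -> perm_eq s2 t2 ->
  osgn (s1 ++ e :: s2) (t1 ++ e :: t2) = osgn s1 t1 * osgn s2 t2 :> R.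
Proof.
move=> us p1 p2; have p2' : perm_eq (e :: s2) (e :: t2) by rewrite perm_cons.
have us2 : uniq (e :: s2) by move: us; rewrite cat_uniq => /and3P[].
rewrite -(@osgnM R _ _ (t1 ++ e :: s2)) ?perm_cat2r ?perm_cat2l // osgn_catr //.
congr (_ * _); rewrite osgn_catl // ?osgn_cons //; first by case/andP: us2.
by rewrite -(perm_uniq (perm_cat p1 (perm_refl _))).
Qed.

Lemma perm_swap_ends a b e : perm_eq (a ++ e :: b) (b ++ e :: a).
Proof.
rewrite -[a ++ _]/(a ++ [:: e] ++ b) -[b ++ _]/(b ++ [:: e] ++ a).
apply: perm_trans (permEl (perm_catCA _ _ _)) _; rewrite perm_sym.
apply: perm_trans (permEl (perm_catCA _ _ _)) _; rewrite perm_cat2l.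
exact: (permEl (perm_catC _ _)).
Qed.

(** Moving [a] and [e] past [b] costs (|a|+1)|b|, and moving [e] back in front of [a] costs |a|.
    This is the origin of the antisymmetry sign of the bracket. *)
Lemma osgn_swap_ends a b e : uniq (a ++ e :: b) ->
  osgn (a ++ e :: b) (b ++ e :: a) = (-1) ^+ (size a * size b + size a + size b) :> R.
Proof.
move=> u; have u1 : uniq ((a ++ [:: e]) ++ b) by rewrite -catA.
have u2 : uniq (b ++ (a ++ [:: e])) by rewrite uniq_catC.
have p1 : perm_eq ((a ++ [:: e]) ++ b) (b ++ (a ++ [:: e])) by exact: (permEl (perm_catC _ _)).
have p2 : perm_eq (b ++ (a ++ [:: e])) (b ++ ([:: e] ++ a)).
  by rewrite perm_cat2l; exact: (permEl (perm_catC _ _)).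
have u3 : uniq (a ++ [:: e]) by move: u1; rewrite cat_uniq => /andP[].
rewrite -[a ++ e :: b]/(a ++ [:: e] ++ b) catA -(osgnM R u1 p1 p2).
rewrite osgn_swap // osgn_catl ?osgn_swap //; last exact: (permEl (perm_catC _ _)).
rewrite -exprD size_cat /= mulnDl mul1n muln1; congr (_ ^+ _).
by rewrite addnAC.
Qed.
End OsgnBlocks.

Section Components.
Variable L : Type.
Implicit Type G : rgraph L.

Lemma component_edge G (h g : 'I_(lab G)) (e : {set 'I_(lab G)}) : prerg G ->
  e \in ori G -> g \in e -> (e \subset hes (component h)) = connect (adjr (s0 G) (s1 G)) h g.
Proof.
move=> pG eG ge; have [gH gs eE] := ori_mem pG eG ge.
apply/idP/idP => [/subsetP/(_ g ge)|hg]; first by rewrite inE => /andP[].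
apply/subsetP => x; rewrite inE eE => /set2P[]->; rewrite ?gH //.
by rewrite (st1 (pg_st pG)) //; apply: connect_trans hg _; exact: conn_s1.
Qed.

End Components.

Section Lie.
Variables (k : fieldType) (L : Type).
Implicit Types (G : rgraph L) (phi psi : RGdual k L).
Local Notation rg := (rg k).

Lemma bridgeP G h : prerg G -> h \in hes G -> s1 G h != h ->
  reflect (cl (s0 G) (cutf (s1 G) (edge (s1 G) h)) h
           <> cl (s0 G) (cutf (s1 G) (edge (s1 G) h)) (s1 G h))
          (is_bridge (edge (s1 G) h)).
Proof.
move=> pG hH hs; have eG : edge (s1 G) h \in ori G by rewrite edge_ori.
have pc := cut_prerg pG eG; have stc := pg_st pc; have h'H := st1 (pg_st pG) hH.
apply: (iffP idP) => [/negP nb cc|ncc].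
  apply: nb; apply/forall_inP => x /set2P[]->; apply/forall_inP => y /set2P[]->;
  by rewrite ?connect0 //; apply/(clE stc) => //.
apply/negP => /forall_inP/(_ h (set21 _ _))/forall_inP/(_ _ (set22 _ _)) hh'.
by apply: ncc; apply/(clE stc).
Qed.

Definition side G h : rgraph L := @component L (cut (edge (s1 G) h)) h.

Definition oside G h : seq {set 'I_(lab G)} := ori (side h).

Lemma side_connected G h : prerg G -> h \in hes G -> s1 G h != h -> connected_rg (side h).
Proof.
move=> pG hH hs; apply: component_connected => //.
by apply: cut_prerg => //; rewrite edge_ori.
Qed.

Lemma side_prerg G h : prerg G -> h \in hes G -> s1 G h != h -> prerg (side h).
Proof. by move=> pG hH hs; have /connected_rgP[] := side_connected pG hH hs. Qed.

Lemma edge_other G h : prerg G -> h \in hes G -> edge (s1 G) (s1 G h) = edge (s1 G) h.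
Proof. by move=> pG hH; rewrite (edge_s1 (pg_st pG)). Qed.

Lemma s1_other G h : prerg G -> h \in hes G -> s1 G h != h ->
  s1 G h \in hes G /\ s1 G (s1 G h) != s1 G h.
Proof.
move=> pG hH hs; have stG := pg_st pG.
by rewrite (st1 stG) // (st1K stG) // eq_sym.
Qed.

(** By [cl_cut] every half-edge of a connected graph lies on the side of [h] or of [s1 h], and on
    only one of them as the edge is a bridge. So each remaining edge belongs to exactly one side. *)
Lemma perm_bridge G h : connected_rg G -> h \in hes G -> s1 G h != h ->
  is_bridge (edge (s1 G) h) ->
  perm_eq (oside h ++ edge (s1 G) h :: oside (s1 G h)) (ori G).
Proof.
move=> cG hH hs; have [pG _ conn] := iffLR (connected_rgP G) cG.
move=> /(bridgeP pG hH hs) br; have stG := pg_st pG.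
have eG : edge (s1 G) h \in ori G by rewrite edge_ori.
set e := edge (s1 G) h in br eG *; have pc := cut_prerg pG eG; have stc := pg_st pc.
have h'H := st1 stG hH.
apply: perm_trans (permEl (perm_catCA _ [:: e] _)) _.
rewrite perm_sym; apply: perm_trans (perm_to_rem eG) _; rewrite perm_cons perm_sym.
pose H1 : {set 'I_(lab G)} := hes (side h); pose H2 : {set 'I_(lab G)} := hes (side (s1 G h)).
have -> : oside h = [seq A : {set _} <- rem e (ori G) | A \subset H1] by [].
have -> : oside (s1 G h) = [seq A : {set _} <- rem e (ori G) | A \subset H2].
  by rewrite /oside /H2 /side edge_other.
rewrite [X in _ ++ X](_ : _ = [seq A : {set _} <- rem e (ori G) | ~~ (A \subset H1)]).
  exact: (permEl (perm_filterC _ _)).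
apply: eq_in_filter => A Ac; have [g gA] := ori_neq0 pc Ac.
have [gH _ _] := ori_mem pc Ac gA.
rewrite /H1 /H2 /side edge_other // !(component_edge _ pc Ac gA).
apply/idP/negP => [/(clE stc h'H gH) E1 /(clE stc hH gH) E2|ng].
  by apply: br; rewrite [LHS]E2 [RHS]E1.
have /(clE stG hH gH) := conn h g hH gH.
move/(cl_cut stG hH hH gH) => [E|[_ E]|[E _]].
- by case: ng; apply/(clE stc hH gH).
- by apply/(clE stc h'H gH).
- by case: br.
Qed.

Lemma iso_side G G' (f : 'I_(lab G) -> 'I_(lab G')) h : prerg G -> isoby f ->
  h \in hes G -> s1 G h != h -> @isoby L (side h) (side (f h)) f.
Proof.
move=> pG iso hH hs; have eG : edge (s1 G) h \in ori G by rewrite edge_ori.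
rewrite /side (iso_edge iso hH).
exact: (iso_component (cut_prerg pG eG) (iso_cut pG iso eG) hH).
Qed.

Definition lie_term phi psi G h : k :=
  if is_bridge (edge (s1 G) h) then
    osgn (ori G) (oside h ++ edge (s1 G) h :: oside (s1 G h))
      * (phi (rg (side h)) * psi (rg (side (s1 G h))))
  else 0.

Lemma lie_term_bridge phi psi G h : is_bridge (edge (s1 G) h) ->
  lie_term phi psi h = osgn (ori G) (oside h ++ edge (s1 G) h :: oside (s1 G h))
    * (phi (rg (side h)) * psi (rg (side (s1 G h)))).
Proof. by rewrite /lie_term => ->. Qed.

Definition lie_terms phi psi G : k := \sum_(h in hes G | s1 G h != h) lie_term phi psi h.

Definition lie_fun phi psi G : k^o :=
  if `[< connected_rg G >] then lie_terms phi psi G else 0.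

Lemma rg_lieE phi psi x :
  rg_lie phi psi x = lin_lift (rel := @rg_rel k L) (lie_fun phi psi) x.
Proof.
rewrite /rg_lie.
apply: (congr1 (fun F => lin_lift (rel := @rg_rel k L) (W := k^o) F x)).
apply/funext => G; rewrite /lie_fun.
case: (asboolP (connected_rg G)) => [cG|//].
have pG := connected_prerg cG.
rewrite /lie_terms; apply: eq_bigr => h /andP[hH hs].
by rewrite /lie_term /oside /side edge_other.
Qed.

Lemma lie_terms_iso phi psi G G' (f : 'I_(lab G) -> 'I_(lab G')) :
  connected_rg G -> connected_rg G' -> isoby f -> lie_terms phi psi G = lie_terms phi psi G'.
Proof.
move=> cG cG' iso; have pG := connected_prerg cG.
have [f_inj fH f01 fori] := iso; rewrite /lie_terms -fH.
rewrite big_mkcondr [RHS]big_mkcondr [RHS]big_imset //=; apply: eq_bigr => h hH.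
have [_ f1 _] := f01 h hH; have h'H := st1 (pg_st pG) hH.
have -> : (s1 G' (f h) != f h) = (s1 G h != h).
  by rewrite -f1; congr (~~ _); apply/eqP/eqP => [/f_inj->|->].
case: ifP => // hs; rewrite /lie_term (iso_edge iso hH).
have eG : edge (s1 G) h \in ori G by rewrite edge_ori.
have [h'H1 hs'] := s1_other pG hH hs.
rewrite (iso_bridge pG iso eG); case: ifP => // br.
have iso1 := iso_side pG iso hH hs; have iso2 := iso_side pG iso h'H1 hs'.
rewrite f1 in iso2.
rewrite (rg_iso_eq k (side_prerg pG hH hs) iso1) (rg_iso_eq k (side_prerg pG h'H1 hs') iso2).
congr (_ * _); have [_ _ _ o1] := iso1; have [_ _ _ o2] := iso2.
have oE1 : oside (f h) = [seq f @: A | A : {set _} <- oside h] := o1.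
have oE2 : oside (s1 G' (f h)) = [seq f @: A | A : {set _} <- oside (s1 G h)] := o2.
rewrite fori oE1 oE2.
rewrite -(map_cons (fun A : {set _} => f @: A)) -map_cat osgn_map //.
  by move=> A B AG BG; apply: (iso_imset_inj iso); exact: ori_sub.
by rewrite perm_sym; exact: perm_bridge.
Qed.

(** A new order of all edges induces one on each side. The signs of the two sides multiply to the
    sign relating the concatenated orders, by [osgn_block]. *)
Lemma lie_term_reorient phi psi G s (h : 'I_(lab G)) : linear phi -> linear psi ->
  connected_rg G -> perm_eq s (ori G) -> h \in hes G -> s1 G h != h ->
  @lie_term phi psi (reorient s) h = osgn s (ori G) * lie_term phi psi h.
Proof.
move=> phi_lin psi_lin cG sG hH hs; have pG := connected_prerg cG.
have uG := pg_uniq pG; have us : uniq s by rewrite (perm_uniq sG).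
have cs : connected_rg (reorient s) by apply/(reorient_connected sG).
have brE : is_bridge (edge (s1 (reorient s)) h) = is_bridge (edge (s1 G) h) by [].
case: (boolP (is_bridge (edge (s1 G) h))) => br; last first.
  by rewrite /lie_term brE (negPf br) mulr0.
set e := edge (s1 G) h in br *; set h' := s1 G h.
have eG : e \in ori G by rewrite edge_ori.
have es : e \in s by rewrite (perm_mem sG).
have remP : perm_eq (rem e s) (rem e (ori G)).
  by rewrite -(perm_cons e) -(permPl (perm_to_rem es)) (perm_trans sG) ?perm_to_rem.
have edge' : edge (s1 G) h' = e by rewrite /h' edge_other.
pose H1 : {set 'I_(lab G)} := hes (side h); pose H2 : {set 'I_(lab G)} := hes (side h').
pose s1' := [seq A : {set _} <- rem e s | A \subset H1].
pose s2' := [seq A : {set _} <- rem (edge (s1 G) h') s | A \subset H2].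
have p1 : perm_eq s1' (oside h) by exact: perm_filter.
have p2 : perm_eq s2' (oside h').
  by rewrite /s2' /H2 /oside /side edge'; exact: perm_filter.
have o1 : ori (@side (reorient s) h) = s1' := erefl.
have o2 : ori (@side (reorient s) h') = s2' := erefl.
have r1 : rg (@side (reorient s) h) = osgn s1' (oside h) *: rg (side h).
  exact (@rg_reorient L k (side h) s1' p1).
have r2 : rg (@side (reorient s) h') = osgn s2' (oside h') *: rg (side h').
  exact (@rg_reorient L k (side h') s2' p2).
have f1 : phi (rg (@side (reorient s) h)) = osgn s1' (oside h) * phi (rg (side h)).
  exact (etrans (congr1 phi r1) (linZ phi_lin _ _)).
have f2 : psi (rg (@side (reorient s) h')) = osgn s2' (oside h') * psi (rg (side h')).
  exact (etrans (congr1 psi r2) (linZ psi_lin _ _)).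
have -> : @lie_term phi psi (reorient s) h = osgn s (s1' ++ e :: s2') *
    ((osgn s1' (oside h) * phi (rg (side h)))
      * (osgn s2' (oside h') * psi (rg (side h')))).
  rewrite -f1 -f2; exact (@lie_term_bridge phi psi (reorient s) h br).
rewrite /lie_term br.
have pb := perm_bridge cG hH hs br.
have pbs : perm_eq (s1' ++ e :: s2') s := @perm_bridge (reorient s) h cs hH hs br.
have us' : uniq (s1' ++ e :: s2') by rewrite (perm_uniq pbs).
have E : osgn s (s1' ++ e :: s2') * (osgn s1' (oside h) * osgn s2' (oside h'))
    = osgn s (ori G) * osgn (ori G) (oside h ++ e :: oside h') :> k.
  have pbs' : perm_eq s (s1' ++ e :: s2') by rewrite perm_sym; exact: pbs.
  have pb' : perm_eq (ori G) (oside h ++ e :: oside h') by rewrite perm_sym; exact (pb).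
  have p12 : perm_eq (s1' ++ e :: s2') (oside h ++ e :: oside h').
    by apply: perm_cat p1 _; rewrite perm_cons.
  rewrite -(osgn_block k us' p1 p2) (osgnM k us pbs' p12).
  by rewrite (osgnM k us sG pb').
move: (phi (rg (side h))) (psi (rg (side h'))) => x y.
by rewrite [RHS]mulrA -E -[RHS]mulrA; congr (_ * _); exact: mulrACA.
Qed.

Lemma lie_terms_reorient phi psi G s : linear phi -> linear psi ->
  connected_rg G -> perm_eq s (ori G) ->
  lie_terms phi psi (reorient s) = osgn s (ori G) * lie_terms phi psi G.
Proof.
move=> phi_lin psi_lin cG sG; rewrite /lie_terms mulr_sumr.
by apply: eq_bigr => h /andP[hH hs]; exact: lie_term_reorient.
Qed.

Lemma lie_kills phi psi (r : {freeg (rgraph L) / k}) : linear phi -> linear psi -> rg_rel r ->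
  fglift (lie_fun phi psi) r = 0.
Proof.
move=> phi_lin psi_lin; apply: kills_rg => [G ncG|G G' f cG cG' iso|G s cG sG].
- by rewrite /lie_fun asboolF.
- by rewrite /lie_fun !asboolT //; exact: lie_terms_iso iso.
- by rewrite /lie_fun !asboolT ?lie_terms_reorient //; apply/(reorient_connected sG).
Qed.

Local Opaque side oside edge is_bridge.

Lemma rg_lie_rg phi psi G : linear phi -> linear psi -> connected_rg G ->
  rg_lie phi psi (rg G) = lie_terms phi psi G.
Proof.
move=> phi_lin psi_lin cG; rewrite rg_lieE.
rewrite [LHS](lin_lift_cls _ (fun r => lie_kills phi_lin psi_lin (r := r))).
by rewrite /lie_fun asboolT.
Qed.

Lemma rg_lie_linear phi psi : linear phi -> linear psi -> linear (rg_lie phi psi).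
Proof.
move=> phi_lin psi_lin a x y; rewrite !rg_lieE.
exact: (lin_lift_linear (fun r => lie_kills phi_lin psi_lin (r := r))).
Qed.

(** This is how degrees enter signs: in a nonzero term the graph fed to a functional of degree [i]
    has exactly [i] edges, so its size can be replaced by [i]. *)
Lemma dual_size i phi G : ghom i phi -> prerg G -> (size (ori G))%:Z != i ->
  phi (rg G) = 0.
Proof.
by case=> _ phi0 pG Gi; apply: phi0 (rg_hom k pG); rewrite eqr_opp.
Qed.

Lemma rg_lie_linl a phi phi' psi :
  rg_lie (a *: phi + phi') psi = a *: rg_lie phi psi + rg_lie phi' psi.
Proof.
apply/funext => x; rewrite -[RHS]/(a *: (rg_lie phi psi x : k^o) + rg_lie phi' psi x).
rewrite !rg_lieE -lin_lift_fun_linear; apply: eq_lin_lift => G.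
rewrite /lie_fun; case: asboolP => _; last by rewrite scaler0 addr0.
rewrite /lie_terms scaler_sumr -big_split /=; apply: eq_bigr => h _.
rewrite /lie_term; case: ifP => _; last by rewrite scaler0 addr0.
rewrite -[(a *: phi + phi') _]/(a * phi _ + phi' _) -[_ *: _]/(_ * _); ring.
Qed.

Lemma rg_lie_linr a phi psi psi' :
  rg_lie phi (a *: psi + psi') = a *: rg_lie phi psi + rg_lie phi psi'.
Proof.
apply/funext => x; rewrite -[RHS]/(a *: (rg_lie phi psi x : k^o) + rg_lie phi psi' x).
rewrite !rg_lieE -lin_lift_fun_linear; apply: eq_lin_lift => G.
rewrite /lie_fun; case: asboolP => _; last by rewrite scaler0 addr0.
rewrite /lie_terms scaler_sumr -big_split /=; apply: eq_bigr => h _.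
rewrite /lie_term; case: ifP => _; last by rewrite scaler0 addr0.
rewrite -[(a *: psi + psi') _]/(a * psi _ + psi' _) -[_ *: _]/(_ * _); ring.
Qed.

End Lie.

Section Lie2.
Variables (k : fieldType) (L : Type).
Implicit Types (G : rgraph L) (phi psi : RGdual k L).
Local Notation rg := (rg k).

(** The bridge, which belongs to neither side, accounts for the [+ 1]. *)
Lemma rg_lie_hom i j phi psi : ghom i phi -> ghom j psi -> ghom (i + j + 1) (rg_lie phi psi).
Proof.
move=> hphi hpsi; have [phi_lin _] := hphi; have [psi_lin _] := hpsi.
have lin := rg_lie_linear phi_lin psi_lin; split=> // m x mij; move: x.
apply: lspan_ind => [|a _ x [G [cG Gm ->]] IHx]; first by rewrite (lin0 lin).
rewrite lin IHx addr0 rg_lie_rg // /lie_terms big1 ?scaler0 // => h /andP[hH hs].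
have pG := connected_prerg cG; have [h'H hs'] := s1_other pG hH hs.
rewrite /lie_term; case: ifP => // br; have := perm_size (perm_bridge cG hH hs br).
rewrite size_cat /= => sz.
have Z1 : (size (oside h))%:Z != i -> phi (rg (side h)) = 0.
  exact: dual_size hphi (side_prerg pG hH hs).
have Z2 : (size (oside (s1 G h)))%:Z != j -> psi (rg (side (s1 G h))) = 0.
  exact: dual_size hpsi (side_prerg pG h'H hs').
move: (phi (rg (side h))) (psi (rg (side (s1 G h)))) Z1 Z2 => u v.
move: (osgn (ori G) (oside h ++ edge (s1 G) h :: oside (s1 G h))) sz Gm => w.
move: (size (oside h)) (size (oside (s1 G h))) => p q sz Gm Z1 Z2.
have [Ei|/Z1->] := eqVneq p%:Z i; last by rewrite mul0r mulr0.
have [Ej|/Z2->] := eqVneq q%:Z j; last by rewrite !mulr0.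
case/eqP: mij; rewrite -Gm -sz -Ei -Ej addnS -addn1 !PoszD; zmod.
Qed.

Lemma sum_other G (F : 'I_(lab G) -> k) : prerg G ->
  \sum_(h in hes G | s1 G h != h) F h = \sum_(h in hes G | s1 G h != h) F (s1 G h).
Proof.
move=> pG; have stG := pg_st pG.
rewrite (reindex_onto (s1 G) (s1 G)) => [|h /andP[hH _]]; last exact: (st1K stG).
apply: eq_bigl => h; apply/andP/andP => [[/andP[h'H h's] /eqP hE]|[hH hs]].
  by have := st1 stG h'H; rewrite hE => hH; rewrite hE eq_sym in h's.
have [h'H hs'] := s1_other pG hH hs.
by rewrite h'H hs' (st1K stG).
Qed.

(** Seen from the other end of the bridge the two sides change places; the sign is that of
    [osgn_swap_ends], with sizes replaced by degrees. *)
Lemma lie_term_other i j phi psi G h : ghom i phi -> ghom j psi -> connected_rg G ->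
  h \in hes G -> s1 G h != h ->
  lie_term psi phi (s1 G h) = ksign (i * j + i + j) * lie_term phi psi h.
Proof.
move=> hphi hpsi cG hH hs; have pG := connected_prerg cG.
have [h'H hs'] := s1_other pG hH hs.
have eE := edge_other pG hH; have sE := st1K (pg_st pG) hH.
have Z1 : (size (oside h))%:Z != i -> phi (rg (side h)) = 0.
  exact: dual_size hphi (side_prerg pG hH hs).
have Z2 : (size (oside (s1 G h)))%:Z != j -> psi (rg (side (s1 G h))) = 0.
  exact: dual_size hpsi (side_prerg pG h'H hs').
have pb : is_bridge (edge (s1 G) h) ->
    perm_eq (oside h ++ edge (s1 G) h :: oside (s1 G h)) (ori G).
  exact: perm_bridge.
rewrite /lie_term eE sE.
move: (phi (rg (side h))) (psi (rg (side (s1 G h)))) Z1 Z2 => u v.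
move: (oside h) (oside (s1 G h)) (edge (s1 G) h) (is_bridge _) pb => a b e [] pb Z1 Z2;
  last by rewrite mulr0.
have {}pb : perm_eq (ori G) (a ++ e :: b) by rewrite perm_sym pb.
have ub : uniq (a ++ e :: b) by rewrite -(perm_uniq pb) (pg_uniq pG).
have [Ei|/Z1->] := eqVneq (size a)%:Z i; last by rewrite !(mulr0, mul0r).
have [Ej|/Z2->] := eqVneq (size b)%:Z j; last by rewrite !(mulr0, mul0r).
rewrite -(osgnM k (pg_uniq pG) pb (perm_swap_ends a b e)) (osgn_swap_ends k ub) -Ei -Ej.
rewrite ksignE !poddD poddM !podd_nat -signr_odd !oddD oddM.
by case: (odd _); case: (odd _) => /=; ring.
Qed.

Lemma rg_lie_anti i j phi psi : ghom i phi -> ghom j psi ->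
  rg_lie phi psi = ksign (i * j + i + j) *: rg_lie psi phi.
Proof.
move=> hphi hpsi; have [phi_lin _] := hphi; have [psi_lin _] := hpsi.
apply/funext; apply: eq_RG => [||G cG]; first exact: rg_lie_linear.
  move=> a x y; rewrite -![(_ *: rg_lie _ _) _]/(_ * rg_lie _ _ _) rg_lie_linear //.
  by rewrite -![_ *: _]/(_ * _); ring.
have pG := connected_prerg cG.
rewrite -[RHS]/(_ * rg_lie _ _ _) !rg_lie_rg // /lie_terms [in RHS]sum_other // mulr_sumr.
apply: eq_bigr => h /andP[hH hs]; rewrite (lie_term_other hphi hpsi) // mulrA.
by rewrite -[X in X * _]expr2 sqrr_sign mul1r.
Qed.
End Lie2.

Section Nested.
Variables (k : fieldType) (L : Type).
Implicit Types (G : rgraph L).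
Local Notation rg := (rg k).

(** An equation between graphs yields one between their orientations only up to transport along
    [lab]; therefore the orientations are equated separately, here and in the lemmas of this kind
    below. *)
Lemma component_cut_component G (x y : 'I_(lab G)) (e : {set 'I_(lab G)}) : prerg G ->
  e \in ori G -> connect (adjr (s0 G) (s1 G)) x y ->
  @component L (@cut L (component x) e) y = @component L (cut e) y /\
  ori (@component L (@cut L (component x) e) y) = ori (@component L (cut e) y)
    :> seq {set 'I_(lab G)}.
Proof.
move=> pG eG xy; have [h [hH hs eE]] := oriP _ pG eG.
have hesE : hes (@component L (@cut L (component x) e) y) = hes (@component L (cut e) y).
  apply/setP => z; rewrite !inE /=; apply/andP/andP => [[/andP[-> _] ->]//|[zH yz]].
  split=> //; rewrite zH /=; apply: connect_trans xy _.
  apply: (@conn_cut _ (s0 G) (s1 G) h); rewrite -/(edge _ _) -eE.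
  exact: yz.
pose H1 : {set 'I_(lab G)} := hes (component x).
pose H2 : {set 'I_(lab G)} := hes (@component L (cut e) y).
have H21 : H2 \subset H1.
  apply/subsetP => z; rewrite [in X in X -> _]/H2 -hesE !inE => /andP[].
  by move=> /andP[-> ->].
have oriE : ori (@component L (@cut L (component x) e) y) = ori (@component L (cut e) y)
    :> seq {set 'I_(lab G)}.
  transitivity [seq A : {set _} <- rem e [seq A : {set _} <- ori G | A \subset H1] | A \subset H2].
    by rewrite /H2 -hesE.
  transitivity [seq A : {set _} <- rem e (ori G) | A \subset H2]; last by [].
  have uG := pg_uniq pG; rewrite !rem_filter ?filter_uniq // -!filter_predI.
  apply: eq_in_filter => A AG /=; have [AH|] //= := boolP (A \subset H2).
  by rewrite (subset_trans AH H21) andbT.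
split=> //; rewrite /component; congr RGraph; [exact: hesE|exact: oriE].
Qed.

(** A component that does not meet [e] is not affected by cutting it. The structure maps still
    differ at the ends of [e], outside the component, so the graphs are only isomorphic. *)
Lemma component_cut_other G (x g : 'I_(lab G)) (e : {set 'I_(lab G)}) : prerg G ->
  x \in hes G -> e \in ori G -> g \in e -> ~~ connect (adjr (s0 G) (s1 G)) x g ->
  rg (component x) = rg (@component L (cut e) x) /\
  ori (component x) = ori (@component L (cut e) x) :> seq {set 'I_(lab G)}.
Proof.
move=> pG xH eG ge nxg; have [gH gs eE] := ori_mem pG eG ge.
have stG := pg_st pG; have pc := cut_prerg pG eG; have stc := pg_st pc.
pose H1 : {set 'I_(lab G)} := hes (component x).
pose H2 : {set 'I_(lab G)} := hes (@component L (cut e) x).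
have g'H := st1 stG gH.
have H1e z : z \in H1 -> z \notin e.
  rewrite inE => /andP[zH xz]; apply: contraNN nxg => ze.
  apply: connect_trans xz _; move: ze; rewrite eE => /set2P[]->; first exact: connect0.
  by apply: (conn_sym stG gH); exact: conn_s1.
have hesE : H1 = H2.
  apply/setP => z; rewrite !inE; apply: andb_id2l => zH.
  apply/idP/idP => [xz|]; last first.
    by rewrite -[connect _ _ _]/(connect (adjr (s0 G) (cutf (s1 G) e)) x z) eE; exact: conn_cut.
  have /(clE stG xH zH)/(cl_cut stG gH xH zH) := xz; rewrite -eE.
  case=> [E|[E _]|[E _]]; first exact/(clE stc xH zH).
    by case/negP: nxg; have /(clE stc xH gH) := E; rewrite /= eE; exact: conn_cut.
  have /(clE stc xH g'H) c := E; case/negP: nxg; apply: (connect_trans (y := s1 G g)).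
    by move: c; rewrite /= eE; exact: conn_cut.
  by apply: (conn_sym stG gH); exact: conn_s1.
have oriE : ori (component x) = ori (@component L (cut e) x) :> seq {set 'I_(lab G)}.
  transitivity [seq A : {set _} <- ori G | A \subset H1]; first by [].
  transitivity [seq A : {set _} <- rem e (ori G) | A \subset H1]; last by rewrite hesE.
  rewrite rem_filter ?(pg_uniq pG) // -filter_predI; apply: eq_in_filter => A AG /=.
  have [AH|//] := boolP (A \subset H1); rewrite /=; apply/esym/negP => /eqP AE.
  have gA : g \in A by rewrite AE.
  by have := H1e g (subsetP AH _ gA); rewrite ge.
split=> //; have cx : prerg (component x).
  by have /connected_rgP[] := component_connected pG xH.
apply: (@rg_iso_eq L k (component x) (@component L (cut e) x) (fun z => z)) => //.
split=> //.
- by rewrite imset_id; exact: hesE.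
- move=> z zH; split=> //=.
  by rewrite (negPf (H1e z zH)).
- by rewrite -oriE -[LHS]map_id; apply: eq_map => A; rewrite imset_id.
Qed.
End Nested.

(** * The Jacobi identity *)

Section LieLie.
Variables (k : fieldType) (L : Type).
Implicit Types (G : rgraph L) (phi psi chi : RGdual k L).
Local Notation rg := (rg k).

Definition piece G (e e' : {set 'I_(lab G)}) (y : 'I_(lab G)) : rgraph L :=
  @component L (@cut L (cut e) e') y.

Definition opiece G (e e' : {set 'I_(lab G)}) (y : 'I_(lab G)) : seq {set 'I_(lab G)} :=
  ori (piece e e' y).

Definition pcl G (e e' : {set 'I_(lab G)}) : 'I_(lab G) -> {set 'I_(lab G)} :=
  cl (s0 G) (cutf (cutf (s1 G) e) e').

Lemma component_sides G (x h : 'I_(lab G)) : prerg G ->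
  h \in hes G -> s1 G h != h -> connect (adjr (s0 G) (s1 G)) x h ->
  (@side L (component x) h = side h /\ @oside L (component x) h = oside h) /\
  (@side L (component x) (s1 G h) = side (s1 G h) /\
   @oside L (component x) (s1 G h) = oside (s1 G h)).
Proof.
move=> pG hH hs xh; have eG : edge (s1 G) h \in ori G by rewrite edge_ori.
have e'G : edge (s1 G) (s1 G h) \in ori G by rewrite edge_other.
split; first exact: component_cut_component pG eG xh.
apply: (component_cut_component pG e'G).
by apply: connect_trans xh _; exact: conn_s1.
Qed.

Lemma lie_term_component psi chi G (x h : 'I_(lab G)) : prerg G ->
  h \in hes G -> s1 G h != h -> connect (adjr (s0 G) (s1 G)) x h ->
  @lie_term k L psi chi (component x) h = if is_bridge (edge (s1 G) h) then
    osgn (ori (component x) : seq {set 'I_(lab G)})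
         (oside h ++ edge (s1 G) h :: oside (s1 G h))
    * (psi (rg (side h)) * chi (rg (side (s1 G h)))) else 0.
Proof.
move=> pG hH hs xh; have [[S1 O1] [S2 O2]] := component_sides pG hH hs xh.
rewrite -[LHS]/(if is_bridge (edge (s1 G) h) then
  osgn (ori (component x) : seq {set 'I_(lab G)})
    (@oside L (component x) h ++ edge (s1 G) h :: @oside L (component x) (s1 G h))
   * (psi (rg (@side L (component x) h)) * chi (rg (@side L (component x) (s1 G h)))) else 0).
by rewrite O1 O2 S1 S2.
Qed.

Lemma perm_component G (x h h2 : 'I_(lab G)) (e : {set 'I_(lab G)}) : prerg G ->
  x \in hes G -> h \in hes G -> s1 G h != h -> connect (adjr (s0 G) (s1 G)) x h ->
  s1 G h = h2 -> edge (s1 G) h = e -> is_bridge e ->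
  perm_eq (oside h ++ e :: oside h2) (ori (component x) : seq {set 'I_(lab G)}).
Proof.
move=> pG xH hH hs xh <- <- br; have [[_ O1] [_ O2]] := component_sides pG hH hs xh.
have hc : h \in hes (component x) by rewrite inE hH.
have := @perm_bridge L (component x) h (component_connected pG xH) hc hs br.
by rewrite -O1 -O2.
Qed.

Definition piece_term phi psi chi G (h h' : 'I_(lab G)) : k :=
  let e := edge (s1 G) h in let e' := edge (s1 G) h' in
  osgn (ori G) (opiece e e' h ++ e :: opiece e e' h' ++ e' :: opiece e e' (s1 G h'))
  * (phi (rg (piece e e' h)) * (psi (rg (piece e e' h')) * chi (rg (piece e e' (s1 G h'))))).

(* The pairs occurring in [rg_lie phi (rg_lie psi chi)]: [h] is on a bridge, and [h'] is
   on a bridge of the side of [s1 h]. *)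
Definition nested G (h h' : 'I_(lab G)) : bool :=
  let e := edge (s1 G) h in let e' := edge (s1 G) h' in
  let cl1 := cl (s0 G) (cutf (s1 G) e) in
  [&& h' \notin e, cl1 h != cl1 (s1 G h), cl1 (s1 G h) == cl1 h'
    & pcl e e' h' != pcl e e' (s1 G h')].

Lemma osgn_nest (X : eqType) (s a b c t : seq X) (e e' : X) : uniq s ->
  perm_eq (a ++ e :: t) s -> perm_eq (b ++ e' :: c) t ->
  osgn s (a ++ e :: t) * osgn t (b ++ e' :: c) = osgn s (a ++ e :: b ++ e' :: c) :> k.
Proof.
move=> us p1 p2; have {}p1 : perm_eq s (a ++ e :: t) by rewrite perm_sym.
have {}p2 : perm_eq t (b ++ e' :: c) by rewrite perm_sym.
have u1 : uniq (a ++ e :: t) by rewrite -(perm_uniq p1).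
have p3 : perm_eq (e :: t) (e :: b ++ e' :: c) by rewrite perm_cons.
have u2 : uniq (e :: t) by move: u1; rewrite cat_uniq => /and3P[].
have p4 : perm_eq (a ++ e :: t) (a ++ e :: b ++ e' :: c) by rewrite perm_cat2l.
rewrite -(osgnM k us p1 p4) (osgn_catl k u1 p3) osgn_cons //.
by case/andP: u2.
Qed.

Lemma pieces_of_nested G (h h' : 'I_(lab G)) : prerg G -> h \in hes G -> s1 G h != h ->
  h' \in hes G -> s1 G h' != h' -> nested h h' ->
  let e := edge (s1 G) h in let e' := edge (s1 G) h' in
  [/\ rg (side h) = rg (piece e e' h) /\ oside h = opiece e e' h,
      @side L (cut e) h' = piece e e' h' /\
        @oside L (cut e) h' = opiece e e' h' &
      @side L (cut e) (s1 G h') = piece e e' (s1 G h') /\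
        @oside L (cut e) (s1 G h') = opiece e e' (s1 G h')].
Proof.
move=> pG hH hs h'H hs' /and4P[h'e c1 c2 c3] e e'.
have eG : e \in ori G by rewrite edge_ori.
have pc := cut_prerg pG eG; have stc := pg_st pc.
have s1e : s1 (cut e) h' = s1 G h' by rewrite /= (negPf h'e).
have edgeE : edge (s1 (cut e)) h' = e' by rewrite /edge s1e.
have e'G : e' \in ori (cut e).
  by have := @edge_ori L (cut e) h' pc h'H; rewrite edgeE s1e hs' => ->.
have edgeE' : edge (s1 (cut e)) (s1 G h') = e'.
  by have := @edge_other L (cut e) h' pc h'H; rewrite edgeE s1e.
split.
- have h'e' : h' \in e' by rewrite !inE eqxx.
  have nc : ~~ connect (adjr (s0 (cut e)) (s1 (cut e))) h h'.
    apply/negP => /(clE stc hH h'H) E; move: c1; rewrite (eqP c2) => /eqP; apply.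
    exact: E.
  exact: (@component_cut_other k L (cut e) h h' e' pc hH e'G h'e' nc).
- by rewrite /oside /opiece /piece /side edgeE.
- by rewrite /oside /opiece /piece /side edgeE'.
Qed.

Lemma if_neq (T : eqType) (b : bool) (x y : T) :
  ((if b then x else y) != x) = ~~ b && (y != x).
Proof. by case: b; rewrite ?eqxx. Qed.

(** The case analysis of [lie_term_lie], separated from graphs of varying type: [a] is membership in
    [hes G], [b] being no leaf, [c] lying on the first edge, [d] being on the side of [s1 h], and
    [n] is [nested]. *)
Lemma nest_case (V : nmodType) (a b c d n : bool) (x y : V) :
  (a -> b -> ~~ c -> d -> x = if n then y else 0) -> (c -> n = false) ->
  (a -> ~~ d -> n = false) ->
  (if (a && d) && (~~ c && b) then x else 0) = (if a && b then if n then y else 0 else 0).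
Proof.
case: a; case: b; case: c; case: d; case: n => //= xE cn dn;
  by [exact: xE | have := cn isT | have := dn isT isT].
Qed.

(** A bridge of the side of [s1 h] is an edge of [G], and cutting it there gives the same pieces as
    cutting both edges of [G]. The orientations combine by [osgn_nest]. *)
Lemma lie_term_lie phi psi chi G (h : 'I_(lab G)) : linear psi -> linear chi ->
  connected_rg G -> h \in hes G -> s1 G h != h ->
  lie_term phi (rg_lie psi chi) h =
  \sum_(h' in hes G | s1 G h' != h') if nested h h' then piece_term phi psi chi h h' else 0.
Proof.
move=> psi_lin chi_lin cG hH hs; have [pG _ conn] := iffLR (connected_rgP G) cG.
have stG := pg_st pG; have [h1H hs1] := s1_other pG hH hs.
pose e := edge (s1 G) h; have eG : e \in ori G by rewrite edge_ori.
have pc := cut_prerg pG eG; have stc := pg_st pc.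
have [br|nbr] := boolP (is_bridge e); last first.
  rewrite /lie_term (negPf nbr) big1 // => h' _; case: ifP => // /and4P[_ /eqP c1 _ _].
  by case/negP: nbr; apply/(bridgeP pG hH hs).
have brE := bridgeP pG hH hs br.
have -> : lie_term phi (rg_lie psi chi) h = osgn (ori G) (oside h ++ e :: oside (s1 G h))
    * (phi (rg (side h)) * lie_terms psi chi (side (s1 G h))).
  by rewrite -(rg_lie_rg psi_lin chi_lin (side_connected pG h1H hs1)) /lie_term br.
have sE : side (s1 G h) = @component L (cut e) (s1 G h) by rewrite /side edge_other.
have pb := perm_bridge cG hH hs br.
have oE : oside (s1 G h) = ori (@component L (cut e) (s1 G h)) :> seq {set 'I_(lab G)}.
  by rewrite /oside /side edge_other.
rewrite sE; rewrite oE in pb *; rewrite mulrA mulr_sumr big_mkcond [RHS]big_mkcond.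
apply: eq_bigr => h' _; pose e' := edge (s1 G) h'.
set w := _ * phi _.
have key : h' \in hes G -> s1 G h' != h' -> h' \notin e ->
    connect (adjr (s0 (cut e)) (s1 (cut e))) (s1 G h) h' ->
    w * @lie_term k L psi chi (@component L (cut e) (s1 G h)) h'
      = if nested h h' then piece_term phi psi chi h h' else 0.
  move=> h'H hs' h'e c2; have s1e : s1 (cut e) h' = s1 G h' by rewrite /= (negPf h'e).
  have edgeE : edge (s1 (cut e)) h' = e' by rewrite /edge s1e.
  have hs'c : s1 (cut e) h' != h' by rewrite s1e.
  rewrite (@lie_term_component psi chi (cut e) (s1 G h) h' pc h'H hs'c c2).
  have brE' := @bridgeP L (cut e) h' pc h'H hs'c.
  rewrite s1e in brE' *; rewrite edgeE in brE' *.
  have nE : nested h h' = @is_bridge L (cut e) e'.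
    have b1 : cl (s0 G) (cutf (s1 G) (edge (s1 G) h)) h
      != cl (s0 G) (cutf (s1 G) (edge (s1 G) h)) (s1 G h) by apply/eqP.
    have b2 : cl (s0 G) (cutf (s1 G) (edge (s1 G) h)) (s1 G h)
      == cl (s0 G) (cutf (s1 G) (edge (s1 G) h)) h' by apply/eqP/(clE stc h1H h'H).
    rewrite /nested h'e b1 b2 /=; apply/idP/idP => [/eqP ne|br']; first exact/brE'.
    by apply/eqP; exact: (elimT brE' br').
  rewrite -nE; case: (boolP (nested h h')) => [nest|_]; last exact: mulr0.
  have [[R1 O1] [R2 O2] [R3 O3]] := pieces_of_nested pG hH hs h'H hs' nest.
  have br' : @is_bridge L (cut e) e' by rewrite -nE.
  have pbc : perm_eq (@oside L (cut e) h' ++ e' :: @oside L (cut e) (s1 G h'))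
      (ori (@component L (cut e) (s1 G h)) : seq {set 'I_(lab G)}).
    exact (@perm_component (cut e) (s1 G h) h' (s1 G h') e' pc h1H h'H hs'c c2 s1e edgeE br').
  have sgn := osgn_nest (pg_uniq pG) pb pbc.
  rewrite O1 O2 O3 in sgn; rewrite /w O2 O3 R2 R3 R1 O1 /piece_term -!/e -!/e' -sgn.
  move: (phi _) => a; move: (psi _) => b.
  move: (chi _) => c; move: (osgn (ori G) _) => p; move: (osgn _ _) => q.
  ring.
have hesE : (h' \in hes (@component L (cut e) (s1 G h))) =
  (h' \in hes G) && connect (adjr (s0 (cut e)) (s1 (cut e))) (s1 G h) h' by rewrite inE.
have s1E : s1 (@component L (cut e) (s1 G h)) h' = if h' \in e then h' else s1 G h' by [].
have s1N : ((if h' \in e then h' else s1 G h') != h') = (h' \notin e) && (s1 G h' != h').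
  exact: if_neq.
rewrite hesE s1E s1N; apply: nest_case; first exact: key.
  by rewrite /nested => ->.
move=> h'H nc2; apply/negP => /and4P[_ _ /eqP c2 _]; case/negP: nc2.
by apply/(clE stc h1H h'H).
Qed.
End LieLie.

Section Chain.
Variables (k : fieldType) (L : Type).
Implicit Types (G : rgraph L) (phi psi chi : RGdual k L).
Local Notation rg := (rg k).

(* Cutting the edges of [h] and [h'] leaves three pieces in a row, namely those of [h],
   of both [s1 h] and [h'], and of [s1 h']. *)
Definition chain G (h h' : 'I_(lab G)) : bool :=
  let e := edge (s1 G) h in let c := pcl e (edge (s1 G) h') in
  [&& h' \notin e, c (s1 G h) == c h', c h != c (s1 G h), c h != c (s1 G h')
    & c h' != c (s1 G h')].

Lemma pclC G (e e' : {set 'I_(lab G)}) : pcl e e' = pcl e' e.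
Proof.
rewrite /pcl; congr (cl _ _); apply/funext => x; rewrite /cutf.
by case: (x \in e'); case: (x \in e).
Qed.

Lemma pieceC G (e e' : {set 'I_(lab G)}) y : prerg G ->
  piece e e' y = piece e' e y /\ opiece e e' y = opiece e' e y.
Proof.
move=> pG; pose M s1' o := @RGraph L (lab G) (hes G) (s0 G) s1' (col G) o.
have sE : cutf (cutf (s1 G) e) e' = cutf (cutf (s1 G) e') e.
  by apply/funext => x; rewrite /cutf; case: (x \in e'); case: (x \in e).
have oE := rem_rem e e' (pg_uniq pG).
split.
  rewrite -[LHS]/(@component L (M (cutf (cutf (s1 G) e) e') (rem e' (rem e (ori G)))) y).
  by rewrite sE -oE.
rewrite -[LHS]/(ori (@component L (M (cutf (cutf (s1 G) e) e') (rem e' (rem e (ori G)))) y)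
  : seq {set 'I_(lab G)}).
by rewrite sE -oE.
Qed.

Lemma cl_pcl G (h h' x y : 'I_(lab G)) : prerg G -> h \in hes G -> s1 G h != h ->
  h' \in hes G -> h' \notin edge (s1 G) h -> x \in hes G -> y \in hes G ->
  let c := pcl (edge (s1 G) h) (edge (s1 G) h') in
  cl (s0 G) (cutf (s1 G) (edge (s1 G) h)) x = cl (s0 G) (cutf (s1 G) (edge (s1 G) h)) y <->
  [\/ c x = c y, c x = c h' /\ c (s1 G h') = c y | c x = c (s1 G h') /\ c h' = c y].
Proof.
move=> pG hH hs h'H h'e xH yH; have stc := stable_cut (pg_st pG) hH.
have := cl_cut stc h'H xH yH.
have -> : cutf (s1 G) (edge (s1 G) h) h' = s1 G h' by rewrite /cutf (negPf h'e).
have -> : edge (cutf (s1 G) (edge (s1 G) h)) h' = edge (s1 G) h'.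
  by rewrite /edge /cutf (negPf h'e).
by [].
Qed.

Lemma edge_notin G (h h' : 'I_(lab G)) : prerg G -> h \in hes G -> h' \in hes G ->
  (h' \in edge (s1 G) h) = (h \in edge (s1 G) h').
Proof.
move=> pG hH h'H; have stG := pg_st pG.
have imp x y : x \in hes G -> y \in edge (s1 G) x -> x \in edge (s1 G) y.
  by move=> xH yx; rewrite (edge_mem stG xH yx) !inE eqxx.
by apply/idP/idP; exact: imp.
Qed.

Lemma nested_chain G (h h' : 'I_(lab G)) : prerg G -> h \in hes G -> s1 G h != h ->
  h' \in hes G -> s1 G h' != h' ->
  (nested h h' <-> chain h h' \/ chain h (s1 G h')) /\ ~~ (chain h h' && chain h (s1 G h')).
Proof.
move=> pG hH hs h'H hs'; have stG := pg_st pG; have h1H := st1 stG hH.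
have h1'H := st1 stG h'H.
rewrite /nested /chain (edge_other pG h'H) (s1_edge stG hH h'H) (st1K stG h'H).
have [h'e|h'e] := boolP (h' \in edge (s1 G) h); first by split=> //=; split=> // -[].
have C1 := cl_pcl pG hH hs h'H h'e hH h1H.
have C2 := cl_pcl pG hH hs h'H h'e h1H h'H.
move: C1 C2 => /=; move: (pcl _ _) => c; move: (cl _ _) => d.
move: (c h) (c (s1 G h)) (c h') (c (s1 G h')) => a b p q.
move: (d h) (d (s1 G h)) (d h') => x y z [C1 C1'] [C2 C2'] {c d}.
split; last first.
  apply/negP => /andP[/and4P[/eqP bp _ _ pq] /and4P[/eqP bq _ _ _]].
  by rewrite -bp -bq eqxx in pq.
split=> [/and3P[/eqP xy /eqP yz pq]|[/and4P[/eqP bp ab aq pq]|/and4P[/eqP bq ab ap pq]]].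
- case: (C2 yz) => [bp|[bp _]|[bq _]]; [left|left|right]; apply/and4P; split=> //;
    try (by apply/eqP); try (by rewrite eq_sym);
    apply/eqP => E; apply: xy; apply: C1'; 
    by solve [apply: Or31; congruence | apply: Or32; split; congruence
             | apply: Or33; split; congruence].
- apply/and3P; split=> //; last by apply/eqP/C2'/Or31.
  apply/eqP => /C1[E|[E1 E2]|[E1 E2]]; first by rewrite E eqxx in ab.
    by rewrite -bp -E2 eqxx in pq.
  by rewrite E1 eqxx in aq.
- rewrite eq_sym in pq.
  apply/and3P; split=> //; last by apply/eqP/C2'/Or33.
  apply/eqP => /C1[E|[E1 E2]|[E1 E2]]; first by rewrite E eqxx in ab.
    by rewrite E1 eqxx in ap.
  by rewrite E2 bq eqxx in pq.
Qed.

Lemma chain_rev G (h h' : 'I_(lab G)) : prerg G -> h \in hes G -> h' \in hes G ->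
  chain (s1 G h') (s1 G h) = chain h h'.
Proof.
move=> pG hH h'H; have stG := pg_st pG; rewrite /chain (edge_other pG hH) (edge_other pG h'H).
rewrite (s1_edge stG h'H hH) -(edge_notin pG hH h'H) (st1K stG hH) (st1K stG h'H) pclC.
move: (pcl _ _) => c; move: (c h) (c (s1 G h)) (c h') (c (s1 G h')) => a b p q.
rewrite [p == b]eq_sym [q == p]eq_sym [q == a]eq_sym.
have [<-|bp] := eqVneq b p; last by rewrite !andbF.
rewrite [b == a]eq_sym.
by case: (_ \notin _); case: (b == q); case: (a == q); case: (a == b).
Qed.

Lemma piece_prerg G (h h' y : 'I_(lab G)) : prerg G -> h \in hes G -> s1 G h != h ->
  h' \in hes G -> s1 G h' != h' -> h' \notin edge (s1 G) h -> y \in hes G ->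
  prerg (piece (edge (s1 G) h) (edge (s1 G) h') y).
Proof.
move=> pG hH hs h'H hs' h'e yH.
have eG : edge (s1 G) h \in ori G by rewrite edge_ori.
have e'G : edge (s1 G) h' \in ori G by rewrite edge_ori.
have pc := cut_prerg pG eG.
have e'c : edge (s1 G) h' \in ori (cut (edge (s1 G) h)).
  rewrite /= mem_rem_uniq ?(pg_uniq pG) // inE e'G andbT.
  by apply: contraNneq h'e => <-; rewrite !inE eqxx.
by have /connected_rgP[] := component_connected (cut_prerg pc e'c) yH.
Qed.

Lemma perm_pieces G (h h' : 'I_(lab G)) : connected_rg G -> h \in hes G -> s1 G h != h ->
  h' \in hes G -> s1 G h' != h' -> nested h h' ->
  forall e e', e = edge (s1 G) h -> e' = edge (s1 G) h' ->
  perm_eq (ori G) (opiece e e' h ++ e :: opiece e e' h' ++ e' :: opiece e e' (s1 G h')).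
Proof.
move=> cG hH hs h'H hs' nest _ _ -> ->.
pose e := edge (s1 G) h; pose e' := edge (s1 G) h'; have [pG _ conn] := iffLR (connected_rgP G) cG.
have [[_ O1] [_ O2] [_ O3]] := pieces_of_nested k pG hH hs h'H hs' nest.
have stG := pg_st pG; have [h1H hs1] := s1_other pG hH hs.
have eG : e \in ori G by rewrite edge_ori.
have pc := cut_prerg pG eG; have stc := pg_st pc.
move: nest => /and4P[h'e /eqP c1 /eqP c2 /eqP c3].
have br : is_bridge e by apply/(bridgeP pG hH hs).
have pb := perm_bridge cG hH hs br.
have oE : oside (s1 G h) = ori (@component L (cut e) (s1 G h)) :> seq {set 'I_(lab G)}.
  by rewrite /oside /side edge_other.
have s1e : s1 (cut e) h' = s1 G h' by rewrite /= (negPf h'e).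
have edgeE : edge (s1 (cut e)) h' = e' by rewrite /edge s1e.
have hs'c : s1 (cut e) h' != h' by rewrite s1e.
have conn2 : connect (adjr (s0 (cut e)) (s1 (cut e))) (s1 G h) h'.
  by apply/(clE stc h1H h'H).
have br' : @is_bridge L (cut e) e'.
  have := @bridgeP L (cut e) h' pc h'H hs'c; rewrite s1e edgeE => brE'.
  by apply: (introT brE').
have pbc := @perm_component L (cut e) (s1 G h) h' (s1 G h') e' pc h1H h'H hs'c conn2 s1e edgeE br'.
rewrite oE in pb; rewrite O1 in pb; rewrite O2 O3 in pbc.
rewrite perm_sym; apply: perm_trans pb.
by rewrite perm_cat2l perm_cons.
Qed.
End Chain.

Section Reversal.
Variables (R : comNzRingType) (X : eqType).

Lemma perm_reverse (a b c : seq X) e e' :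
  perm_eq (a ++ e :: b ++ e' :: c) (c ++ e' :: b ++ e :: a).
Proof.
have -> : c ++ e' :: b ++ e :: a = (c ++ e' :: b) ++ e :: a by rewrite -catA.
by apply: perm_trans (perm_swap_ends _ _ _) _; rewrite perm_cat2r; exact: perm_swap_ends.
Qed.

(** Five blocks of sizes |a|, 1, |b|, 1, |c| are reversed, so every pair of them is exchanged. The
    minus sign comes from the pair of edges; what |a|, |b| and |c| contribute with the two edges is
    even. *)
Lemma osgn_reverse (a b c : seq X) e e' : uniq (a ++ e :: b ++ e' :: c) ->
  osgn (a ++ e :: b ++ e' :: c) (c ++ e' :: b ++ e :: a)
    = - (-1) ^+ (size a * size b + size b * size c + size a * size c) :> R.
Proof.
move=> u; have p1 := perm_swap_ends a (b ++ e' :: c) e; have p2 := perm_swap_ends b c e'.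
have u1 : uniq ((b ++ e' :: c) ++ e :: a) by rewrite -(perm_uniq p1).
have p3 : perm_eq ((b ++ e' :: c) ++ e :: a) ((c ++ e' :: b) ++ e :: a).
  by rewrite perm_cat2r.
have -> : c ++ e' :: b ++ e :: a = (c ++ e' :: b) ++ e :: a by rewrite -catA.
rewrite -(osgnM R u p1 p3) (osgn_catr R u1 p2) osgn_swap_ends //.
rewrite (osgn_swap_ends R (e := e')); last by move: u1; rewrite cat_uniq => /andP[].
rewrite -exprD size_cat /= -[LHS]signr_odd -[in RHS]signr_odd.
rewrite !(oddD, oddM, oddS) /=.
by move: (odd (size a)) (odd (size b)) (odd (size c)) => [] [] []; rewrite /= ?expr0 ?expr1 ?opprK.
Qed.
End Reversal.

Section Jacobi.
Variables (k : fieldType) (L : Type).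
Implicit Types (G : rgraph L) (phi psi chi : RGdual k L).
Local Notation rg := (rg k).

Definition chain_sum phi psi chi G : k :=
  \sum_(h in hes G | s1 G h != h) \sum_(h' in hes G | s1 G h' != h')
    if chain h h' then piece_term phi psi chi h h' else 0.

Lemma chain_notin G (h h' : 'I_(lab G)) : chain h h' -> h' \notin edge (s1 G) h.
Proof. by case/and4P. Qed.

Lemma chain_nested G (h h' : 'I_(lab G)) : prerg G -> h \in hes G -> s1 G h != h ->
  h' \in hes G -> s1 G h' != h' -> chain h h' -> nested h h'.
Proof.
move=> pG hH hs h'H hs' ch; have [E _] := nested_chain pG hH hs h'H hs'.
by apply/E; left.
Qed.

Lemma piece_size i phi G (h h' y : 'I_(lab G)) : ghom i phi -> prerg G -> h \in hes G ->
  s1 G h != h -> h' \in hes G -> s1 G h' != h' -> h' \notin edge (s1 G) h -> y \in hes G ->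
  (size (opiece (edge (s1 G) h) (edge (s1 G) h') y))%:Z != i ->
  phi (rg (piece (edge (s1 G) h) (edge (s1 G) h') y)) = 0.
Proof.
move=> hphi pG hH hs h'H hs' h'e yH.
exact: (dual_size hphi (piece_prerg pG hH hs h'H hs' h'e yH)).
Qed.

Lemma piece_term_other i j n phi psi chi G (h h' : 'I_(lab G)) :
  ghom i phi -> ghom j psi -> ghom n chi -> connected_rg G ->
  h \in hes G -> s1 G h != h -> h' \in hes G -> s1 G h' != h' -> chain h h' ->
  piece_term phi psi chi h (s1 G h')
    = ksign (j * n + j + n) * piece_term phi chi psi h h'.
Proof.
move=> hphi hpsi hchi cG hH hs h'H hs' ch; have pG := connected_prerg cG.
have h'e := chain_notin ch; have nest := chain_nested pG hH hs h'H hs' ch.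
have h1'H := st1 (pg_st pG) h'H.
have pp := perm_pieces k cG hH hs h'H hs' nest erefl erefl.
have Z1 := piece_size hpsi pG hH hs h'H hs' h'e h1'H.
have Z2 := piece_size hchi pG hH hs h'H hs' h'e h'H.
rewrite /piece_term (edge_other pG h'H) (st1K (pg_st pG) h'H).
move: pp Z1 Z2; move: (edge (s1 G) h) (edge (s1 G) h') => e e'.
move: (phi (rg (piece e e' h))) => x.
move: (psi (rg (piece e e' (s1 G h')))) => y.
move: (chi (rg (piece e e' h'))) => z.
move: (opiece e e' h) (opiece e e' h') (opiece e e' (s1 G h')) => a b c pp Z1 Z2.
have uG := pg_uniq pG.
have [Ej|/Z1->] := eqVneq (size c)%:Z j; last by rewrite !(mul0r, mulr0).
have [En|/Z2->] := eqVneq (size b)%:Z n; last by rewrite !(mul0r, mulr0).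
have u1 : uniq ((a ++ [:: e]) ++ (b ++ e' :: c)) by rewrite -catA -(perm_uniq pp).
have u2 : uniq (b ++ e' :: c) by move: u1; rewrite cat_uniq => /and3P[].
have p2 := perm_swap_ends b c e'.
have p3 : perm_eq (a ++ e :: b ++ e' :: c) (a ++ e :: c ++ e' :: b).
  by rewrite perm_cat2l perm_cons.
have sgn : osgn (a ++ e :: b ++ e' :: c) (a ++ e :: c ++ e' :: b)
    = (-1) ^+ (size b * size c + size b + size c) :> k.
  rewrite -(osgn_swap_ends k u2) -(osgn_catl k u1 p2).
  by rewrite -!catA.
rewrite -(osgnM k uG pp p3) sgn -Ej -En ksignE !poddD poddM !podd_nat -signr_odd !(oddD, oddM).
move: (odd (size b)) (odd (size c)) => [] [] /=; ring.
Qed.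

(** The second sum collects the nested pairs in which [s1 h'] is the end facing the first bridge.
    Renaming it [h'] interchanges [psi] and [chi] and costs an antisymmetry sign. *)
Lemma lie_lie j n i phi psi chi G : ghom i phi -> ghom j psi -> ghom n chi -> connected_rg G ->
  rg_lie phi (rg_lie psi chi) (rg G)
    = chain_sum phi psi chi G + ksign (j * n + j + n) * chain_sum phi chi psi G.
Proof.
move=> hphi hpsi hchi cG; have [phi_lin _] := hphi.
have [psi_lin _] := hpsi; have [chi_lin _] := hchi.
have pG := connected_prerg cG; have stG := pg_st pG.
rewrite (rg_lie_rg phi_lin (rg_lie_linear psi_lin chi_lin) cG) /lie_terms /chain_sum.
rewrite mulr_sumr -big_split; apply: eq_bigr => h /andP[hH hs].
rewrite lie_term_lie //.
transitivity (\sum_(h' in hes G | s1 G h' != h')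
     ((if chain h h' then piece_term phi psi chi h h' else 0)
      + (if chain h (s1 G h') then piece_term phi psi chi h (s1 G (s1 G h')) else 0))).
  apply: eq_bigr => h' /andP[h'H hs']; rewrite (st1K stG h'H).
  have [E1 E2] := nested_chain pG hH hs h'H hs'.
  have {}E1 : nested h h' = chain h h' || chain h (s1 G h') by apply/idP/orP => /E1.
  rewrite E1; move: E2; move: (piece_term _ _ _ _ _) => x.
  by case: (chain h h'); case: (chain h (s1 G h')); rewrite ?addr0 ?add0r.
rewrite big_split; congr (_ + _); rewrite mulr_sumr.
rewrite -(sum_other (fun h' => if chain h h' then piece_term phi psi chi h (s1 G h') else 0) pG).
apply: eq_bigr => h' /andP[h'H hs']; case: (boolP (chain h h')) => [ch|_]; last by rewrite mulr0.
exact: piece_term_other hphi hpsi hchi cG hH hs h'H hs' ch.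
Qed.

Lemma piece_eq G (h h' y y' : 'I_(lab G)) : prerg G -> h \in hes G -> s1 G h != h ->
  h' \in hes G -> s1 G h' != h' -> h' \notin edge (s1 G) h -> y \in hes G -> y' \in hes G ->
  let e := edge (s1 G) h in let e' := edge (s1 G) h' in
  pcl e e' y = pcl e e' y' -> piece e e' y = piece e e' y' /\ opiece e e' y = opiece e e' y'.
Proof.
move=> pG hH hs h'H hs' h'e yH y'H e e' /setP E.
have hesE : [set x in hes G | connect (@adjacent L (@cut L (cut e) e')) y x]
    = [set x in hes G | connect (@adjacent L (@cut L (cut e) e')) y' x].
  by apply/setP => x; have := E x; rewrite !inE => Ex; apply: andb_id2l => xH; move: Ex.
split; last by rewrite /opiece /=; rewrite /= in hesE; rewrite hesE.
rewrite /piece /component; move: hesE; rewrite /= => ->.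
by congr RGraph.
Qed.

Lemma chain_sum_rev i j n phi psi chi G : ghom i phi -> ghom j psi -> ghom n chi ->
  connected_rg G -> chain_sum phi psi chi G
    = ksign (i * j + j * n + i * n + 1) * chain_sum chi psi phi G.
Proof.
move=> hphi hpsi hchi cG; have pG := connected_prerg cG; have stG := pg_st pG.
rewrite /chain_sum exchange_big /= [in RHS]sum_other // mulr_sumr.
apply: eq_bigr => h' /andP[h'H hs']; rewrite [in RHS]sum_other // mulr_sumr.
apply: eq_bigr => h /andP[hH hs]; rewrite chain_rev //.
case: (boolP (chain h h')) => [ch|_]; last by rewrite mulr0.
have h'e := chain_notin ch; have nest := chain_nested pG hH hs h'H hs' ch.
have h1H := st1 stG hH; have h1'H := st1 stG h'H.
have pp := perm_pieces k cG hH hs h'H hs' nest erefl erefl.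
have Z1 := piece_size hphi pG hH hs h'H hs' h'e hH.
have Z2 := piece_size hpsi pG hH hs h'H hs' h'e h'H.
have Z3 := piece_size hchi pG hH hs h'H hs' h'e h1'H.
have [P1 O1] := pieceC (edge (s1 G) h') (edge (s1 G) h) (s1 G h') pG.
have [P2 O2] := pieceC (edge (s1 G) h') (edge (s1 G) h) (s1 G h) pG.
have [P3 O3] := pieceC (edge (s1 G) h') (edge (s1 G) h) h pG.
(* The middle piece is named after [h'] in the chain and after [s1 h] in the reversed one; both
   half-edges lie on it. *)
have bp : pcl (edge (s1 G) h) (edge (s1 G) h') (s1 G h)
    = pcl (edge (s1 G) h) (edge (s1 G) h') h'.
  by case/and5P: ch => _ /eqP.
have [P4 O4] := piece_eq pG hH hs h'H hs' h'e h1H h'H bp.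
rewrite /piece_term (edge_other pG h'H) (edge_other pG hH) (st1K stG hH).
rewrite P1 P2 P3 O1 O2 O3 P4 O4 {P1 P2 P3 P4 O1 O2 O3 O4 bp}.
move: pp Z1 Z2 Z3; move: (edge (s1 G) h) (edge (s1 G) h') => e e'.
move: (phi (rg (piece e e' h))) => x.
move: (psi (rg (piece e e' h'))) => y.
move: (chi (rg (piece e e' (s1 G h')))) => z.
move: (opiece e e' h) (opiece e e' h') (opiece e e' (s1 G h')) => a b c pp Z1 Z2 Z3.
have uG := pg_uniq pG.
have [Ei|/Z1->] := eqVneq (size a)%:Z i; last by rewrite !(mul0r, mulr0).
have [Ej|/Z2->] := eqVneq (size b)%:Z j; last by rewrite !(mul0r, mulr0).
have [En|/Z3->] := eqVneq (size c)%:Z n; last by rewrite !(mul0r, mulr0).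
have u1 : uniq (a ++ e :: b ++ e' :: c) by rewrite -(perm_uniq pp).
have pr := perm_reverse a b c e e'.
rewrite -(osgnM k uG pp pr) (osgn_reverse k u1) -Ei -Ej -En ksignE !poddD !poddM !podd_nat.
rewrite -(signr_odd _ (size a * size b + _ + _)) !(oddD, oddM).
move: (odd (size a)) (odd (size b)) (odd (size c)) => [] [] [] /=; ring.
Qed.

Lemma rg_lie_jacobi i j n phi psi chi : ghom i phi -> ghom j psi -> ghom n chi ->
  rg_lie phi (rg_lie psi chi) = rg_lie (rg_lie phi psi) chi
    + ksign ((i + 1) * (j + 1)) *: rg_lie psi (rg_lie phi chi).
Proof.
move=> hphi hpsi hchi; have hij := rg_lie_hom hphi hpsi.
(* Antisymmetry turns the double bracket nested on the left into the form that [lie_lie] expands. *)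
rewrite (rg_lie_anti hij hchi).
have [[phi_lin _] [psi_lin _] [chi_lin _]] := And3 hphi hpsi hchi.
have l1 := rg_lie_linear psi_lin chi_lin; have l2 := rg_lie_linear phi_lin psi_lin.
have l3 := rg_lie_linear phi_lin chi_lin.
apply/funext; apply: eq_RG => [||G cG]; first exact: rg_lie_linear.
  move=> a x y; rewrite -![(_ *: rg_lie _ _ + _ *: rg_lie _ _) _]/(_ * rg_lie _ _ _ + _ * rg_lie _ _ _).
  rewrite (rg_lie_linear chi_lin l2) (rg_lie_linear psi_lin l3).
  by rewrite -![_ *: _]/(_ * _); ring.
rewrite -[RHS]/(_ * rg_lie _ _ _ + _ * rg_lie _ _ _).
rewrite (lie_lie hphi hpsi hchi cG) (lie_lie hchi hphi hpsi cG) (lie_lie hpsi hphi hchi cG).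
(* Of the six chain sums three remain, one for each choice of the functional in the middle. *)
rewrite (chain_sum_rev hchi hphi hpsi cG) (chain_sum_rev hchi hpsi hphi cG).
rewrite (chain_sum_rev hphi hchi hpsi cG).
move: (chain_sum _ _ _ _) (chain_sum _ _ _ _) (chain_sum _ _ _ _) => x y z.
rewrite !ksignE !(poddD, poddM).
move: (podd i) (podd j) (podd n) => [] [] [] /=; ring.
Qed.
End Jacobi.

(** * The differential is a derivation of the bracket *)

Section RemSigns.
Variables (R : comNzRingType) (X : eqType).

Lemma osgn_rem_left (s a b : seq X) e f : uniq s -> perm_eq s (a ++ f :: b) -> e \in a ->
  osgn s (e :: rem e s) * osgn (rem e s) (rem e a ++ f :: b)
    = osgn s (a ++ f :: b) * osgn a (e :: rem e a) :> R.
Proof.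
move=> us sP ea; have es : e \in s by rewrite (perm_mem sP) mem_cat ea.
have u1 : uniq (a ++ f :: b) by rewrite -(perm_uniq sP).
have ens : e \notin rem e s by rewrite mem_rem_uniqF.
have p1 : perm_eq (a ++ f :: b) ((e :: rem e a) ++ f :: b).
  by rewrite perm_cat2r perm_to_rem.
have p2 : perm_eq (rem e s) (rem e a ++ f :: b).
  rewrite -(perm_cons e) -(permPl (perm_to_rem es)); apply: perm_trans sP _; exact: p1.
rewrite -(osgn_cons R ens p2) (osgnM R us) ?perm_to_rem ?perm_cons //.
rewrite -(osgn_catr R u1 (perm_to_rem ea)) (osgnM R us sP) //.
Qed.

(** To come to the front, [e] passes all of [a] and the bridge [f]. This gives the sign in front of
    the second term of the derivation property. *)
Lemma osgn_rem_right (s a b : seq X) e f : uniq s -> perm_eq s (a ++ f :: b) -> e \in b ->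
  osgn s (e :: rem e s) * osgn (rem e s) (a ++ f :: rem e b)
    = (-1) ^+ (size a).+1 * (osgn s (a ++ f :: b) * osgn b (e :: rem e b)) :> R.
Proof.
move=> us sP eb; have es : e \in s by rewrite (perm_mem sP) mem_cat inE eb !orbT.
have u1 : uniq ((a ++ [:: f]) ++ b) by rewrite -catA -(perm_uniq sP).
have ens : e \notin rem e s by rewrite mem_rem_uniqF.
have p1 : perm_eq ((a ++ [:: f]) ++ b) ((a ++ [:: f]) ++ e :: rem e b).
  by rewrite perm_cat2l perm_to_rem.
have p0 : perm_eq ((a ++ [:: f]) ++ e :: rem e b) (e :: a ++ f :: rem e b).
  apply: perm_trans (permEl (perm_catCA _ [:: e] _)) _.
  by rewrite -catA perm_refl.
have sP' : perm_eq s ((a ++ [:: f]) ++ b) by rewrite -catA.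
have p2 : perm_eq (rem e s) (a ++ f :: rem e b).
  rewrite -(perm_cons e) -(permPl (perm_to_rem es)); apply: perm_trans sP' _.
  exact: perm_trans p1 p0.
rewrite -(osgn_cons R ens p2) (osgnM R us) ?perm_to_rem ?perm_cons //.
have -> : a ++ f :: b = (a ++ [:: f]) ++ b by rewrite -catA.
rewrite -(osgn_catl R u1 (perm_to_rem eb)) (osgnM R us sP' p1).
rewrite -(osgnM R us (perm_trans sP' p1) p0) mulrC; congr (_ * _).
have u2 : uniq (((a ++ [:: f]) ++ [:: e]) ++ rem e b).
  by rewrite -catA /= -(perm_uniq p1).
have p3 : perm_eq ((a ++ [:: f]) ++ [:: e]) ([:: e] ++ (a ++ [:: f])) by exact: (permEl (perm_catC _ _)).
have -> : (a ++ [:: f]) ++ e :: rem e b = ((a ++ [:: f]) ++ [:: e]) ++ rem e b by rewrite -[RHS]catA.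
have -> : e :: a ++ f :: rem e b = ([:: e] ++ (a ++ [:: f])) ++ rem e b by rewrite /= -catA.
rewrite (osgn_catr R u2 p3) osgn_swap; last by move: u2; rewrite cat_uniq => /andP[].
by rewrite size_cat /= muln1 addn1.
Qed.
End RemSigns.

Section Components2.
Variables (k : fieldType) (L : Type).
Implicit Types (G : rgraph L).
Local Notation rg := (rg k).

Lemma component_contract_in G (x : 'I_(lab G)) (e : {set 'I_(lab G)}) : prerg G ->
  e \in ori G -> ~~ is_loop e -> x \in hes G -> x \notin e ->
  @component L (contract e) x = @contract L (component x) e /\
  ori (@component L (contract e) x) = rem e (ori (component x) : seq {set 'I_(lab G)})
    :> seq {set 'I_(lab G)}.
Proof.
move=> pG eG nl xH xe; pose H1 : {set 'I_(lab G)} := hes (component x).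
have xHe : x \in hes G :\: e by rewrite in_setD xe.
have hesE : hes (@component L (contract e) x) = H1 :\: e.
  apply/setP => z; rewrite [in RHS]in_setD [in LHS]inE [in LHS]/= [in RHS]inE in_setD.
  case: (boolP (z \in e)) => //= ze; case: (boolP (z \in hes G)) => //= zH.
  by apply: (contract_conn pG eG nl xHe); rewrite in_setD ze.
have oriE : ori (@component L (contract e) x) = rem e (ori (component x) : seq {set 'I_(lab G)})
    :> seq {set 'I_(lab G)}.
  transitivity [seq A : {set _} <- rem e (ori G) | A \subset H1 :\: e].
    by rewrite -hesE.
  transitivity (rem e [seq A : {set _} <- ori G | A \subset H1]); last by [].
  have uG := pg_uniq pG; rewrite !rem_filter ?filter_uniq // -!filter_predI.
  apply: eq_in_filter => A AG /=; rewrite [RHS]andbC.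
  have [->|Ae] /= := eqVneq A e; first by rewrite !andbF.
  rewrite !andbT subsetD; apply/andP/idP => [[]//|AH]; split=> //.
  apply/pred0P => z /=; apply/negP => /andP[zA ze]; case/eqP: Ae.
  exact: ori_disjoint pG AG eG zA ze.
split=> //; rewrite /component; congr RGraph; [exact: hesE|exact: oriE].
Qed.

Lemma component_contract_other G (x g : 'I_(lab G)) (e : {set 'I_(lab G)}) : prerg G ->
  x \in hes G -> e \in ori G -> ~~ is_loop e -> g \in e -> ~~ connect (adjr (s0 G) (s1 G)) x g ->
  rg (@component L (contract e) x) = rg (component x) /\
  ori (@component L (contract e) x) = ori (component x) :> seq {set 'I_(lab G)}.
Proof.
move=> pG xH eG nl ge nxg; have [gH gs eE] := ori_mem pG eG ge.
have stG := pg_st pG.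
pose H1 : {set 'I_(lab G)} := hes (component x).
have H1e z : z \in H1 -> z \notin e.
  rewrite inE => /andP[zH xz]; apply: contraNN nxg => ze.
  apply: connect_trans xz _; move: ze; rewrite eE => /set2P[]->; first exact: connect0.
  by apply: (conn_sym stG gH); exact: conn_s1.
have xe : x \notin e by apply: H1e; rewrite inE xH connect0.
have [_ oriE] := component_contract_in pG eG nl xH xe.
have hesE : hes (@component L (contract e) x) = H1.
  have xHe : x \in hes G :\: e by rewrite in_setD xe.
  apply/setP => z; rewrite [in LHS]inE [in LHS]/= in_setD.
  have [zH1|zH1] := boolP (z \in H1).
    have zH : z \in hes G by move: zH1; rewrite inE => /andP[].
    rewrite (H1e _ zH1) zH /=; rewrite [LHS](contract_conn pG eG nl xHe).
      by move: zH1; rewrite inE => /andP[].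
    by rewrite in_setD (H1e _ zH1).
  apply/negP => /andP[/andP[ze zH] xz]; case/negP: zH1; rewrite inE zH /=.
  by rewrite -(contract_conn pG eG nl xHe) // in_setD ze.
have {}oriE : ori (@component L (contract e) x) = ori (component x) :> seq {set 'I_(lab G)}.
  rewrite oriE; apply: rem_id; rewrite mem_filter; apply/negP => /andP[/subsetP eH _].
  by have := H1e g (eH g ge); rewrite ge.
split=> //; symmetry; have cx : prerg (component x).
  by have /connected_rgP[] := component_connected pG xH.
apply: (@rg_iso_eq L k (component x) (@component L (contract e) x) (fun z => z)) => //.
split=> //.
- by rewrite imset_id; exact: esym hesE.
- move=> z zH; split=> //=.
  have s0H : s0 G z \in H1 by exact: (st0 (pg_st cx)).
  by rewrite (negPf (H1e _ s0H)).
- by rewrite oriE -[LHS]map_id; apply: eq_map => A; rewrite imset_id.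
Qed.

Lemma component_cut_in G (x : 'I_(lab G)) (e : {set 'I_(lab G)}) : prerg G ->
  e \in ori G -> x \in hes G -> connected_rg (@cut L (component x) e) ->
  @component L (cut e) x = @cut L (component x) e /\
  ori (@component L (cut e) x) = rem e (ori (component x) : seq {set 'I_(lab G)})
    :> seq {set 'I_(lab G)}.
Proof.
move=> pG eG xH /connected_rgP[_ _ conn]; pose H1 : {set 'I_(lab G)} := hes (component x).
have [h [hH hs eE]] := oriP _ pG eG.
have xH1 : x \in H1 by rewrite inE xH connect0.
have hesE : hes (@component L (cut e) x) = H1.
  apply/setP => z; apply/idP/idP => [|zH]; last first.
    by rewrite inE; move: (zH); rewrite inE => /andP[-> _] /=; exact: conn.
  rewrite !inE => /andP[zH xz]; apply/andP; split; first exact: zH.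
  apply: (@conn_cut _ (s0 G) (s1 G) h); rewrite -/(edge _ _) -eE; exact: xz.
have oriE : ori (@component L (cut e) x) = rem e (ori (component x) : seq {set 'I_(lab G)})
    :> seq {set 'I_(lab G)}.
  transitivity [seq A : {set _} <- rem e (ori G) | A \subset H1].
    by rewrite -hesE.
  transitivity (rem e [seq A : {set _} <- ori G | A \subset H1]); last by [].
  have uG := pg_uniq pG; rewrite !rem_filter ?filter_uniq // -!filter_predI.
  by apply: eq_filter => A /=; rewrite andbC.
split=> //; rewrite /component; congr RGraph; [exact: hesE|exact: oriE].
Qed.
End Components2.

(** * The derivation property for a general operation on edges *)

Section LieEdgeSum.
Variables (k : fieldType) (L : Type).
Implicit Types (G : rgraph L) (phi psi : RGdual k L).
Local Notation rg := (rg k).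
(** Contraction and cutting are treated together: the hypotheses of this section list what the
    argument uses of an operation, and both satisfy them. *)
Variables (P : forall G, {set 'I_(lab G)} -> bool).
Variables (H : forall G, {set 'I_(lab G)} -> {set 'I_(lab G)}).
Variables (a b : forall G, {set 'I_(lab G)} -> 'I_(lab G) -> 'I_(lab G)).
Let op G e : rgraph L := @RGraph L (lab G) (H e) (a e) (b e) (col G) (rem e (ori G)).
Hypothesis eoP : edge_op k P op.
Hypothesis pre : forall G (e : {set 'I_(lab G)}),
  prerg G -> e \in ori G -> P e -> prerg (op e).
Hypothesis op_hes : forall G (e : {set 'I_(lab G)}) h, prerg G -> e \in ori G ->
  (h \in H e) && (b e h != h) = [&& h \in hes G, s1 G h != h & h \notin e].
Hypothesis op_s1 : forall G (e : {set 'I_(lab G)}) h, h \notin e -> b e h = s1 G h.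
Hypothesis P_side : forall G h (e : {set 'I_(lab G)}), @P (side h) e = P e.

(* Cutting the bridge of [h] after operating on an edge [e] on the side of [h] amounts to
   operating on that side. *)
Definition splits G (e : {set 'I_(lab G)}) (h : 'I_(lab G)) : Prop :=
  [/\ @is_bridge L (op e) (edge (s1 G) h),
      rg (@side L (op e) h) = rg (@op (side h) e),
      @oside L (op e) h = rem e (oside h : seq {set 'I_(lab G)}) :> seq {set 'I_(lab G)},
      rg (@side L (op e) (s1 G h)) = rg (side (s1 G h)) &
      @oside L (op e) (s1 G h) = oside (s1 G h) :> seq {set 'I_(lab G)}].

(** The second part says that an operation that disconnects the graph makes the class of the altered
    side vanish, so that the term drops out on both sides of the derivation property. *)
Hypothesis op_split : forall G (e : {set 'I_(lab G)}) h,
  connected_rg G -> h \in hes G -> s1 G h != h -> is_bridge (edge (s1 G) h) ->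
  e \in ori G -> P e -> h \notin e -> e \in (oside h : seq {set 'I_(lab G)}) ->
  (connected_rg (op e) -> splits e h) /\
  (~ connected_rg (op e) -> rg (@op (side h) e) = 0).

Definition op_term phi psi G (h : 'I_(lab G)) (e : {set 'I_(lab G)}) : k :=
  if [&& P e, h \notin e & `[< connected_rg (op e) >]] then
    osgn (ori G) (e :: rem e (ori G)) * @lie_term k L phi psi (op e) h
  else 0.

(* Edges that are not bridges may become bridges by [op]; their terms must cancel. *)
Hypothesis op_extra : forall phi psi G, connected_rg G ->
  \sum_(h in hes G | s1 G h != h) \sum_(e <- ori G)
    (if is_bridge (edge (s1 G) h) then 0 else op_term phi psi h e) = 0.

(** By [op_hes], the half-edges of internal edges of [op e] are those of [G] outside [e], so all
    sums can be indexed by [G] and exchanged. *)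
Lemma lie_edge_sum_terms phi psi G : linear phi -> linear psi -> connected_rg G ->
  rg_lie phi psi (edge_sum P op (rg G))
    = \sum_(h in hes G | s1 G h != h) \sum_(e <- ori G) op_term phi psi h e.
Proof.
move=> phi_lin psi_lin cG; have pG := connected_prerg cG.
have lin := rg_lie_linear phi_lin psi_lin.
rewrite (edge_sum_rg eoP pG) /edge_terms (lin_sum lin) exchange_big /=.
rewrite big_mkcond big_seq [RHS]big_seq; apply: eq_bigr => e eG.
rewrite /op_term; case: (boolP (P e)) => Pe; last by rewrite big1.
rewrite (linZ lin) -[_ *: _]/(_ * _); case: (asboolP (connected_rg (op e))) => [cop|ncop].
  rewrite (rg_lie_rg phi_lin psi_lin cop) /lie_terms mulr_sumr.
  rewrite (eq_bigl (fun h => [&& h \in hes G, s1 G h != h & h \notin e])); last first.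
    by move=> h; exact: (op_hes h pG eG).
  rewrite big_mkcond [RHS]big_mkcond; apply: eq_bigr => h _.
  by case: (h \in hes G); case: (s1 G h != h); case: (h \in e).
rewrite rg_nconn // (lin0 lin) mulr0 big1 // => h _.
by rewrite !andbF.
Qed.

Lemma oside_mem G (h : 'I_(lab G)) (e : {set 'I_(lab G)}) : prerg G -> h \in hes G ->
  s1 G h != h -> e \in (oside h : seq {set 'I_(lab G)}) ->
  [/\ e \in ori G, e != edge (s1 G) h, h \notin e & s1 G h \notin e].
Proof.
move=> pG hH hs; have uG := pg_uniq pG.
rewrite mem_filter => /andP[_]; rewrite [ori _]/= mem_rem_uniq // inE => /andP[ef eG].
split=> //; apply: contraNN ef => /(ori_mem pG eG)[_ _ ->] //.
by rewrite edge_other.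
Qed.

Lemma lie_term_val phi psi G (h : 'I_(lab G)) (e : {set 'I_(lab G)}) x y A B :
  prerg G -> e \in ori G -> h \in hes G -> s1 G h != h -> h \notin e ->
  @is_bridge L (op e) (edge (s1 G) h) ->
  rg (@side L (op e) h) = x -> @oside L (op e) h = A :> seq {set 'I_(lab G)} ->
  rg (@side L (op e) (s1 G h)) = y -> @oside L (op e) (s1 G h) = B :> seq {set 'I_(lab G)} ->
  @lie_term k L phi psi (op e) h
    = osgn (rem e (ori G)) (A ++ edge (s1 G) h :: B) * (phi x * psi y).
Proof.
move=> pG eG hH hs he br <- <- <- <-; have s1E : s1 (op e) h = s1 G h := op_s1 he.
have edgeE : edge (s1 (op e)) h = edge (s1 G) h by rewrite /edge s1E.
by rewrite /lie_term s1E edgeE br.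
Qed.

Lemma op_term_left phi psi G (h : 'I_(lab G)) (e : {set 'I_(lab G)}) : linear phi ->
  connected_rg G -> h \in hes G -> s1 G h != h -> is_bridge (edge (s1 G) h) ->
  e \in (oside h : seq {set 'I_(lab G)}) ->
  op_term phi psi h e = if P e then
    osgn (ori G) (oside h ++ edge (s1 G) h :: oside (s1 G h))
    * (osgn (oside h : seq {set 'I_(lab G)}) (e :: rem e (oside h : seq {set 'I_(lab G)}))
       * phi (rg (@op (side h) e)) * psi (rg (side (s1 G h)))) else 0.
Proof.
move=> phi_lin cG hH hs br eA; have pG := connected_prerg cG.
have [eG ef he h'e] := oside_mem pG hH hs eA.
rewrite /op_term he; case: (boolP (P e)) => [Pe|_]; last by [].
have [sp nsp] := op_split cG hH hs br eG Pe he eA.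
have pb : perm_eq (ori G) (oside h ++ edge (s1 G) h :: oside (s1 G h)).
  by rewrite perm_sym; exact (perm_bridge cG hH hs br).
case: (asboolP (connected_rg (op e))) => [/sp[br' r1 o1 r2 o2]|/nsp->]; last first.
  by rewrite (lin0 phi_lin) mulr0 mul0r mulr0.
rewrite (lie_term_val phi psi pG eG hH hs he br' r1 o1 r2 o2).
move: pb eA; move: (phi _) (psi _) => x y; move: (edge (s1 G) h) => f.
move: (oside h : seq {set 'I_(lab G)}) (oside (s1 G h) : seq {set 'I_(lab G)}) => A B pb eA.
transitivity (osgn (ori G) (e :: rem e (ori G)) * osgn (rem e (ori G)) (rem e A ++ f :: B)
    * (x * y)); first exact: mulrA.
by rewrite (osgn_rem_left k (pg_uniq pG) pb eA); ring.
Qed.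

(** [op_split] is used from the other end of the bridge. The sign of [osgn_rem_right] counts the
    edges on the side of [h], of which there are [i] unless [phi] vanishes. *)
Lemma op_term_right i phi psi G (h : 'I_(lab G)) (e : {set 'I_(lab G)}) :
  ghom i phi -> linear psi ->
  connected_rg G -> h \in hes G -> s1 G h != h -> is_bridge (edge (s1 G) h) ->
  e \in (oside (s1 G h) : seq {set 'I_(lab G)}) ->
  op_term phi psi h e = ksign (i + 1) * if P e then
    osgn (ori G) (oside h ++ edge (s1 G) h :: oside (s1 G h))
    * (phi (rg (side h)) *
       (osgn (oside (s1 G h) : seq {set 'I_(lab G)})
             (e :: rem e (oside (s1 G h) : seq {set 'I_(lab G)}))
        * psi (rg (@op (side (s1 G h)) e)))) else 0.
Proof.
move=> hphi psi_lin cG hH hs br eB; have pG := connected_prerg cG.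
have [h'H hs'] := s1_other pG hH hs; have eE := edge_other pG hH.
have sE := st1K (pg_st pG) hH.
have [eG ef h'e he] := oside_mem pG h'H hs' eB; rewrite sE in he; rewrite eE in ef.
rewrite /op_term he; case: (boolP (P e)) => [Pe|_]; last by rewrite mulr0.
have br1 : is_bridge (edge (s1 G) (s1 G h)) by rewrite eE.
have [sp nsp] := op_split cG h'H hs' br1 eG Pe h'e eB.
have pb : perm_eq (ori G) (oside h ++ edge (s1 G) h :: oside (s1 G h)).
  by rewrite perm_sym; exact (perm_bridge cG hH hs br).
have Z1 : (size (oside h))%:Z != i -> phi (rg (side h)) = 0.
  exact: dual_size hphi (side_prerg pG hH hs).
case: (asboolP (connected_rg (op e))) => [/sp|/nsp->]; last first.
  by rewrite (lin0 psi_lin) !mulr0.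
rewrite /splits sE eE => -[br' r1 o1 r2 o2].
rewrite (lie_term_val phi psi pG eG hH hs he br' r2 o2 r1 o1).
move: pb eB Z1; move: (phi _) (psi _) => x y; move: (edge (s1 G) h) => f.
move: (oside h : seq {set 'I_(lab G)}) (oside (s1 G h) : seq {set 'I_(lab G)}) => A B pb eB Z1.
have [Ei|/Z1->] := eqVneq (size A)%:Z i; last by rewrite !(mul0r, mulr0).
transitivity (osgn (ori G) (e :: rem e (ori G)) * osgn (rem e (ori G)) (A ++ f :: rem e B)
    * (x * y)); first exact: mulrA.
rewrite (osgn_rem_right k (pg_uniq pG) pb eB) -Ei -PoszD addn1.
by rewrite /ksign absz_nat; ring.
Qed.

Lemma lie_term_edge_sum_left phi psi G h : linear phi -> linear psi -> connected_rg G ->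
  h \in hes G -> s1 G h != h -> is_bridge (edge (s1 G) h) ->
  @lie_term k L (phi \o edge_sum P op) psi G h =
  \sum_(e <- (oside h : seq {set 'I_(lab G)})) if P e then
    osgn (ori G) (oside h ++ edge (s1 G) h :: oside (s1 G h))
    * (osgn (oside h : seq {set 'I_(lab G)}) (e :: rem e (oside h : seq {set 'I_(lab G)}))
       * phi (rg (@op (side h) e)) * psi (rg (side (s1 G h)))) else 0.
Proof.
move=> phi_lin psi_lin cG hH hs br; have pG := connected_prerg cG.
rewrite /lie_term br.
have -> : (phi \o edge_sum P op) (rg (side h)) =
    \sum_(e <- (oside h : seq {set 'I_(lab G)}) | P e)
      osgn (oside h : seq {set 'I_(lab G)}) (e :: rem e (oside h : seq {set 'I_(lab G)}))
      * phi (rg (@op (side h) e)).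
  rewrite /= (edge_sum_rg eoP (side_prerg pG hH hs)) /edge_terms (lin_sum phi_lin).
  apply: eq_big => [e|e _]; first exact: P_side.
  exact: (linZ phi_lin).
move: (psi _) (osgn (ori G) _) => y w.
by rewrite mulr_suml mulr_sumr big_mkcond.
Qed.

Lemma lie_term_edge_sum_right phi psi G h : linear phi -> linear psi -> connected_rg G ->
  h \in hes G -> s1 G h != h -> is_bridge (edge (s1 G) h) ->
  @lie_term k L phi (psi \o edge_sum P op) G h =
  \sum_(e <- (oside (s1 G h) : seq {set 'I_(lab G)})) if P e then
    osgn (ori G) (oside h ++ edge (s1 G) h :: oside (s1 G h))
    * (phi (rg (side h)) *
       (osgn (oside (s1 G h) : seq {set 'I_(lab G)})
             (e :: rem e (oside (s1 G h) : seq {set 'I_(lab G)}))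
        * psi (rg (@op (side (s1 G h)) e)))) else 0.
Proof.
move=> phi_lin psi_lin cG hH hs br; have pG := connected_prerg cG.
have [h'H hs'] := s1_other pG hH hs.
rewrite /lie_term br.
have -> : (psi \o edge_sum P op) (rg (side (s1 G h))) =
    \sum_(e <- (oside (s1 G h) : seq {set 'I_(lab G)}) | P e)
      osgn (oside (s1 G h) : seq {set 'I_(lab G)}) (e :: rem e (oside (s1 G h) : seq {set 'I_(lab G)}))
      * psi (rg (@op (side (s1 G h)) e)).
  rewrite /= (edge_sum_rg eoP (side_prerg pG h'H hs')) /edge_terms (lin_sum psi_lin).
  apply: eq_big => [e|e _]; first exact: P_side.
  exact: (linZ psi_lin).
move: (phi _) (osgn (ori G) _) => y w.
by rewrite mulr_sumr mulr_sumr big_mkcond.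
Qed.

Lemma lie_edge_sum i phi psi G : ghom i phi -> linear psi -> connected_rg G ->
  rg_lie phi psi (edge_sum P op (rg G))
    = rg_lie (phi \o edge_sum P op) psi (rg G)
      + ksign (i + 1) * rg_lie phi (psi \o edge_sum P op) (rg G).
Proof.
move=> hphi psi_lin cG; have [phi_lin _] := hphi.
have pG := connected_prerg cG; have E_lin := edge_sum_linear eoP.
have phiE : linear (phi \o edge_sum P op) by move=> c x y; rewrite /= E_lin phi_lin.
have psiE : linear (psi \o edge_sum P op) by move=> c x y; rewrite /= E_lin psi_lin.
rewrite lie_edge_sum_terms // (rg_lie_rg phiE psi_lin cG) (rg_lie_rg phi_lin psiE cG).
rewrite /lie_terms.
(* Subtracting the vanishing sum [op_extra] discards the terms whose half-edge is not on a bridge of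
   [G]. *)
rewrite mulr_sumr -big_split -[LHS]subr0 -[X in _ - X = _](op_extra phi psi cG) -sumrB.
apply: eq_bigr => h /andP[hH hs]; rewrite -sumrB.
have [br|nbr] := boolP (is_bridge (edge (s1 G) h)); last first.
  rewrite big1 => [|e _]; last by rewrite subrr.
  rewrite /lie_term (negPf nbr) mulr0; exact: esym (addr0 _).
rewrite (lie_term_edge_sum_left phi_lin psi_lin cG hH hs br).
rewrite (lie_term_edge_sum_right phi_lin psi_lin cG hH hs br).
have pb : perm_eq (ori G) (oside h ++ edge (s1 G) h :: oside (s1 G h)).
  by rewrite perm_sym; exact (perm_bridge cG hH hs br).
(* The edges of [G] are those on the side of [h], the bridge itself, and those on the other side.
   The bridge gives no term, as it contains [h]. *)
rewrite (perm_big _ pb) big_cat big_cons /=.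
have -> : op_term phi psi h (edge (s1 G) h) = 0 by rewrite /op_term !inE eqxx andbF.
rewrite subrr add0r; congr (_ + _).
  rewrite big_seq [RHS]big_seq; apply: eq_bigr => e eA.
  by rewrite subr0; exact: op_term_left.
rewrite mulr_sumr big_seq [RHS]big_seq; apply: eq_bigr => e eB.
by rewrite subr0; exact: op_term_right.
Qed.
End LieEdgeSum.

(** * The derivation property for contraction *)

Section LieBoundary.
Variables (k : fieldType) (L : Type).
Implicit Types (G : rgraph L) (phi psi : RGdual k L).
Local Notation rg := (rg k).

Lemma lie_term_nbridge phi psi G h :
  ~~ is_bridge (edge (s1 G) h) -> lie_term phi psi h = 0.
Proof. by rewrite /lie_term => /negPf->. Qed.

Lemma mulr_eq0r (R : pzRingType) (x y : R) : y = 0 -> x * y = 0.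
Proof. by move->; rewrite mulr0. Qed.

Lemma conf_cutf G (e f : {set 'I_(lab G)}) : prerg G -> e \in ori G -> f \in ori G ->
  e != f -> conf (s0 G) (cutf (s1 G) f) e = conf (s0 G) (s1 G) e.
Proof.
move=> pG eG fG ef; apply/funext => x; rewrite /conf /cutf; case: ifP => // xe.
case: ifP => // xf; case/eqP: ef; exact: (ori_disjoint pG eG fG xe xf).
Qed.

Lemma component_contract_cut G (e f : {set 'I_(lab G)}) y : prerg G ->
  e \in ori G -> f \in ori G -> e != f ->
  @component L (@cut L (contract e) f) y = @component L (@contract L (cut f) e) y /\
  ori (@component L (@cut L (contract e) f) y) = ori (@component L (@contract L (cut f) e) y)
    :> seq {set 'I_(lab G)}.
Proof.
move=> pG eG fG ef.
pose M s0' o := @RGraph L (lab G) (hes G :\: e) s0' (cutf (s1 G) f) (col G) o.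
have sE := conf_cutf pG eG fG ef; have oE := @rem_rem _ (ori G) e f (pg_uniq pG).
split.
  rewrite -[LHS]/(@component L (M (conf (s0 G) (s1 G) e) (rem f (rem e (ori G)))) y).
  by rewrite -sE -oE.
rewrite -[LHS]/(ori (@component L (M (conf (s0 G) (s1 G) e) (rem f (rem e (ori G)))) y)
  : seq {set 'I_(lab G)}).
by rewrite -sE -oE.
Qed.

(** Contraction preserves connectedness, also in the graph cut at [h]. No new bridges arise, and the
    extra terms vanish one by one. *)
Lemma contract_bridge G (e : {set 'I_(lab G)}) h : prerg G -> e \in ori G -> ~~ is_loop e ->
  h \in hes G -> s1 G h != h -> h \notin e ->
  @is_bridge L (contract e) (edge (s1 G) h) = is_bridge (edge (s1 G) h).
Proof.
move=> pG eG nl hH hs he; have fG : edge (s1 G) h \in ori G by rewrite edge_ori.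
have stG := pg_st pG; have h'H := st1 stG hH.
have ef : e != edge (s1 G) h by apply: contraNneq he => ->; rewrite !inE eqxx.
have h'e : s1 G h \notin e.
  apply: contraNN ef => /(ori_mem pG eG)[_ _ ->]; by rewrite edge_other.
have pc := cut_prerg pG fG; have pk := contract_prerg pG eG nl.
have ec : e \in ori (cut (edge (s1 G) h)) by rewrite /= mem_rem_uniq ?(pg_uniq pG) // inE ef.
have hk : h \in hes (contract e) by rewrite in_setD he.
have h'k : s1 G h \in hes (contract e) by rewrite in_setD h'e.
have pck := contract_prerg pc ec nl.
have C : connect (adjr (conf (s0 G) (s1 G) e) (cutf (s1 G) (edge (s1 G) h))) h (s1 G h)
    = connect (adjr (s0 G) (cutf (s1 G) (edge (s1 G) h))) h (s1 G h).
  rewrite -(conf_cutf pG eG fG ef).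
  exact: (@contract_conn L (cut (edge (s1 G) h)) e h (s1 G h) pc ec nl hk h'k).
have C1 : connect (adjr (conf (s0 G) (s1 G) e) (cutf (s1 G) (edge (s1 G) h))) h (s1 G h)
    <-> cl (conf (s0 G) (s1 G) e) (cutf (s1 G) (edge (s1 G) h)) h
        = cl (conf (s0 G) (s1 G) e) (cutf (s1 G) (edge (s1 G) h)) (s1 G h).
  by rewrite -(conf_cutf pG eG fG ef); exact: (clE (pg_st pck) hk h'k).
have C2 := clE (pg_st pc) hH h'H.
apply/idP/idP.
  move=> /(@bridgeP L (contract e) h pk hk hs) br; apply/(bridgeP pG hH hs) => E.
  by apply: br; apply/C1; rewrite C; apply/C2.
move=> /(bridgeP pG hH hs) br; apply/(@bridgeP L (contract e) h pk hk hs) => E.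
by apply: br; apply/C2; have := iffRL C1 E; rewrite C.
Qed.

Lemma oside_conn G (h g : 'I_(lab G)) (e : {set 'I_(lab G)}) : prerg G -> h \in hes G ->
  s1 G h != h -> e \in (oside h : seq {set 'I_(lab G)}) -> g \in e ->
  cl (s0 G) (cutf (s1 G) (edge (s1 G) h)) h = cl (s0 G) (cutf (s1 G) (edge (s1 G) h)) g.
Proof.
move=> pG hH hs; rewrite mem_filter => /andP[/subsetP eH _] ge.
have fG : edge (s1 G) h \in ori G by rewrite edge_ori.
have := eH g ge; rewrite inE => /andP[gH]; move/(clE (pg_st (cut_prerg pG fG)) hH gH).
exact.
Qed.

(** Contracting [e] commutes with cutting the bridge, and after the cut [e] meets only the component
    of [h]. *)
Lemma contract_split G (e : {set 'I_(lab G)}) h :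
  connected_rg G -> h \in hes G -> s1 G h != h -> is_bridge (edge (s1 G) h) ->
  e \in ori G -> ~~ is_loop e -> h \notin e -> e \in (oside h : seq {set 'I_(lab G)}) ->
  @splits k L (fun G e => hes G :\: e) (fun G e => conf (s0 G) (s1 G) e)
    (fun G _ => s1 G) G e h.
Proof.
move=> cG hH hs br eG nl he eA; have pG := connected_prerg cG.
have [_ ef _ h'e] := oside_mem pG hH hs eA; have stG := pg_st pG; have h'H := st1 stG hH.
have fG : edge (s1 G) h \in ori G by rewrite edge_ori.
have [g ge] := ori_neq0 pG eG; have [gH _ _] := ori_mem pG eG ge.
have pc := cut_prerg pG fG; have stc := pg_st pc.
have ec : e \in ori (cut (edge (s1 G) h)) by rewrite /= mem_rem_uniq ?(pg_uniq pG) // inE ef.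
have hg := oside_conn pG hH hs eA ge.
have h'g : ~~ connect (adjr (s0 (cut (edge (s1 G) h))) (s1 (cut (edge (s1 G) h)))) (s1 G h) g.
  apply/negP => /(clE stc h'H gH) E; move/(bridgeP pG hH hs): br; apply.
  by rewrite hg; exact: esym E.
have [r1 o1] := component_contract_cut h pG eG fG ef.
have [r2 o2] := component_contract_cut (s1 G h) pG eG fG ef.
have [r3 o3] := @component_contract_in L (cut (edge (s1 G) h)) h e pc ec nl hH he.
have [r4 o4] := @component_contract_other k L (cut (edge (s1 G) h)) (s1 G h) g e pc h'H ec nl ge h'g.
have eE := edge_other pG hH.
split.
- by rewrite -(contract_bridge pG eG nl hH hs he) in br.
- exact (etrans (congr1 (@Defs.rg k L) r1) (congr1 (@Defs.rg k L) r3)).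
- exact (etrans o1 o3).
- rewrite -[X in X = _]/(rg (@component L (@cut L (contract e) (edge (s1 G) (s1 G h))) (s1 G h))).
  rewrite -[X in _ = X]/(rg (@component L (@cut L G (edge (s1 G) (s1 G h))) (s1 G h))) eE.
  exact (etrans (congr1 (@Defs.rg k L) r2) r4).
- rewrite -[X in X = _]/(ori (@component L (@cut L (contract e) (edge (s1 G) (s1 G h))) (s1 G h)) :
    seq {set 'I_(lab G)}).
  rewrite -[X in _ = X]/(ori (@component L (@cut L G (edge (s1 G) (s1 G h))) (s1 G h)) :
    seq {set 'I_(lab G)}) eE.
  exact (etrans o2 o4).
Qed.

Lemma lie_boundary i phi psi (x : RG k L) : ghom i phi -> linear psi ->
  rg_lie phi psi (boundary x) = rg_lie (phi \o @boundary k L) psi x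
    + ksign (i + 1) * rg_lie phi (psi \o @boundary k L) x.
Proof.
move=> hphi psi_lin; have [phi_lin _] := hphi; have E_lin := @boundary_linear k L.
have phiE : linear (phi \o @boundary k L) by move=> c u v; rewrite /= E_lin phi_lin.
have psiE : linear (psi \o @boundary k L) by move=> c u v; rewrite /= E_lin psi_lin.
move: x; apply: eq_RG => [c u v|c u v|G cG].
- by rewrite E_lin rg_lie_linear.
- by rewrite (rg_lie_linear phiE psi_lin) (rg_lie_linear phi_lin psiE) -![_ *: _]/(_ * _); ring.
apply (@lie_edge_sum k L (fun G e => ~~ is_loop e) (fun G e => hes G :\: e)
  (fun G e => conf (s0 G) (s1 G) e) (fun G _ => s1 G) (contract_edge_op k L)).
- move=> G' e h pG' eG'; rewrite in_setD.
  by case: (h \in e); case: (h \in hes G'); case: (_ != _).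
- by [].
- by [].
- move=> G' e h cG' hH hs br eG nl he eA; split=> [_|nc]; first exact: contract_split.
  have pG := connected_prerg cG'.
  by case: nc; apply/(contract_connectedE pG eG nl).
- move=> phi' psi' G' cG'; have pG := connected_prerg cG'.
  rewrite big1 // => h /andP[hH hs]; rewrite big_seq big1 // => e eG.
  case: ifP => // nbr; rewrite /op_term; case: ifP => // /and3P[nl he _].
  by apply: mulr_eq0r; apply: lie_term_nbridge; rewrite [X in ~~ X](contract_bridge pG eG nl hH hs he) nbr.
- exact: hphi.
- exact: psi_lin.
- exact: cG.
Qed.
End LieBoundary.

Lemma osgn_exchange (R : comNzRingType) (X : eqType) (A B : seq X) e f :
  uniq (f :: A ++ e :: B) -> perm_eq (f :: A ++ e :: B) (e :: A ++ f :: B) /\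
  osgn (f :: A ++ e :: B) (e :: A ++ f :: B) = -1 :> R.
Proof.
have E x y : x :: A ++ y :: B = (x :: A ++ [:: y]) ++ B by rewrite /= -catA.
rewrite !E => u; have p : perm_eq (f :: A ++ [:: e]) (e :: A ++ [:: f]).
  exact: (perm_reverse [::] A [::] f e).
split; first by rewrite perm_cat2r.
rewrite (osgn_catr R u p); move: u; rewrite cat_uniq => /andP[u _].
have := @osgn_reverse R X [::] A [::] f e u.
by rewrite /= mul0n muln0 expr0.
Qed.

(** * The derivation property for cutting *)

Section LieCut.
Variables (k : fieldType) (L : Type).
Implicit Types (G : rgraph L) (phi psi : RGdual k L).
Local Notation rg := (rg k).

Lemma cut_connectedE G h : connected_rg G -> h \in hes G -> s1 G h != h ->
  connected_rg (cut (edge (s1 G) h)) <->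
  cl (s0 G) (cutf (s1 G) (edge (s1 G) h)) h = cl (s0 G) (cutf (s1 G) (edge (s1 G) h)) (s1 G h).
Proof.
move=> cG hH hs; have [pG ne conn] := iffLR (connected_rgP G) cG; have stG := pg_st pG.
have fG : edge (s1 G) h \in ori G by rewrite edge_ori.
have pc := cut_prerg pG fG; have stc := pg_st pc; have h'H := st1 stG hH.
split=> [/connected_rgP[_ _ c]|E]; first by apply/(clE stc hH h'H); exact: c.
apply/connected_rgP; split=> // x y xH yH; apply/(clE stc xH yH).
have /(clE stG xH yH)/(cl_cut stG hH xH yH) := conn x y xH yH.
by case=> [//|[E1 E2]|[E1 E2]]; rewrite /= E1 -E2 ?E.
Qed.

(** A connection between the ends of [e] inside the side of [h] survives in [cut e]. Used
    contrapositively: if cutting [e] disconnects the graph, it disconnects the side, whose class is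
    then zero. *)
Lemma cut_splitN G (e : {set 'I_(lab G)}) h : connected_rg G -> h \in hes G -> s1 G h != h ->
  e \in ori G -> h \notin e -> e \in (oside h : seq {set 'I_(lab G)}) ->
  connected_rg (@cut L (side h) e) -> connected_rg (cut e).
Proof.
move=> cG hH hs eG he eA; have pG := connected_prerg cG; have stG := pg_st pG.
have [g [gH gs eE]] := oriP _ pG eG; have g'H := st1 stG gH.
rewrite eE in eG he eA *; case/connected_rgP=> _ _ conn.
apply/(cut_connectedE cG gH gs).
have he' : g \notin edge (s1 G) h by rewrite (edge_notin pG hH gH).
have inA x : x \in edge (s1 G) g -> x \in hes (side h).
  by move: eA; rewrite mem_filter => /andP[/subsetP sub _]; exact: sub.
have := conn g (s1 G g) (inA _ (set21 _ _)) (inA _ (set22 _ _)).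
have fG : edge (s1 G) h \in ori G by rewrite edge_ori.
have pc := cut_prerg pG fG.
have ec : edge (s1 G) g \in ori (cut (edge (s1 G) h)).
  rewrite /= mem_rem_uniq ?(pg_uniq pG) // inE eG andbT.
  by apply: contraNneq he' => <-; rewrite !inE eqxx.
move/(clE (pg_st (cut_prerg pc ec)) gH g'H) => D.
apply/(cl_pcl pG gH gs hH he gH g'H)/Or31; rewrite pclC; exact: D.
Qed.

Lemma cut_split G (e : {set 'I_(lab G)}) h :
  connected_rg G -> h \in hes G -> s1 G h != h -> is_bridge (edge (s1 G) h) ->
  e \in ori G -> h \notin e -> e \in (oside h : seq {set 'I_(lab G)}) ->
  connected_rg (cut e) ->
  @splits k L (fun G _ => hes G) (fun G _ => s0 G) (fun G e => cutf (s1 G) e) G e h.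
Proof.
move=> cG hH hs br eG he eA ce; have pG := connected_prerg cG.
have [_ ef _ h'e] := oside_mem pG hH hs eA; have stG := pg_st pG; have h'H := st1 stG hH.
have fG : edge (s1 G) h \in ori G by rewrite edge_ori.
have [g [gH gs eE]] := oriP _ pG eG; have g'H := st1 stG gH.
have ge : g \in e by rewrite eE !inE eqxx.
have hg := oside_conn pG hH hs eA ge.
have pc := cut_prerg pG fG; have stc := pg_st pc.
have ec : e \in ori (cut (edge (s1 G) h)) by rewrite /= mem_rem_uniq ?(pg_uniq pG) // inE ef.
have pcc := cut_prerg pc ec; have stcc := pg_st pcc.
have heg : h \notin edge (s1 G) g by rewrite -eE.
have geh : g \notin edge (s1 G) h by rewrite (edge_notin pG hH gH).
move/(bridgeP pG hH hs): (br) => br'.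
(* Cutting [e] does not break up the side of [h]: in the connected graph [cut e], any other way to
   join [h] to [x] uses the bridge and would connect [h] to [s1 h] without it. *)
have D x : x \in hes G -> cl (s0 G) (cutf (s1 G) (edge (s1 G) h)) h
    = cl (s0 G) (cutf (s1 G) (edge (s1 G) h)) x ->
    pcl (edge (s1 G) h) (edge (s1 G) g) h = pcl (edge (s1 G) h) (edge (s1 G) g) x.
  move=> xH hx; have [pce _ conn] := iffLR (connected_rgP _) ce.
  have : cl (s0 G) (cutf (s1 G) e) h = cl (s0 G) (cutf (s1 G) e) x.
    by apply/(clE (pg_st pce) hH xH); exact: conn.
  rewrite eE; move/(cl_pcl pG gH gs hH heg hH xH); rewrite pclC => -[//|[_ E]|[E _]]; exfalso; apply: br'.
    by rewrite hx; apply/esym/(cl_pcl pG hH hs gH geh h'H xH)/Or31.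
  by apply/(cl_pcl pG hH hs gH geh hH h'H)/Or31.
have cside : connected_rg (@cut L (side h) e).
  apply/connected_rgP; split.
  - exact: cut_prerg (side_prerg pG hH hs) eA.
  - by apply/set0Pn; exists h; rewrite inE hH connect0.
  have hD x : x \in hes (side h) -> x \in hes G /\
      connect (adjr (s0 G) (cutf (cutf (s1 G) (edge (s1 G) h)) e)) h x.
    rewrite inE => /andP[xH hx]; split; first exact: xH.
    apply/(clE stcc hH xH); rewrite eE; apply: (D x xH).
    by apply/(clE stc hH xH).
  move=> x y /hD[xH hx] /hD[yH hy]; apply: connect_trans hy.
  exact: (conn_sym stcc hH hx).
have h'g : ~~ connect (adjr (s0 (cut (edge (s1 G) h))) (s1 (cut (edge (s1 G) h)))) (s1 G h) g.
  apply/negP => /(clE stc h'H gH) E; apply: br'; rewrite hg; exact: esym E.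
have [r1 o1] := pieceC e (edge (s1 G) h) h pG.
have [r2 o2] := pieceC e (edge (s1 G) h) (s1 G h) pG.
have [r3 o3] := @component_cut_in L (cut (edge (s1 G) h)) h e pc ec hH cside.
have [r4 o4] := @component_cut_other k L (cut (edge (s1 G) h)) (s1 G h) g e pc h'H ec ge h'g.
have eE' := edge_other pG hH.
have s1E : s1 (cut e) h = s1 G h by rewrite /= (negPf he).
have s1E' : s1 (cut e) (s1 G h) = h by rewrite /= (negPf h'e) (st1K stG).
have fE : edge (s1 (cut e)) h = edge (s1 G) h by rewrite /edge s1E.
have fE' : edge (s1 (cut e)) (s1 G h) = edge (s1 G) h by rewrite /edge s1E' setUC.
split.
- have pce := connected_prerg ce.
  have hsc : s1 (cut e) h != h by rewrite s1E.
  have := @bridgeP L (cut e) h pce hH hsc; rewrite fE s1E => brE; apply: (introT brE) => E.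
  apply: br'; apply/(cl_pcl pG hH hs gH geh hH h'H)/Or31; rewrite pclC -eE; exact: E.
- rewrite -[X in X = _]/(rg (@component L (@cut L (cut e) (edge (s1 (cut e)) h)) h)) fE.
  exact (etrans (congr1 (@Defs.rg k L) r1) (congr1 (@Defs.rg k L) r3)).
- rewrite -[X in X = _]/(ori (@component L (@cut L (cut e) (edge (s1 (cut e)) h)) h) :
    seq {set 'I_(lab G)}) fE.
  exact (etrans o1 o3).
- rewrite -[X in X = _]/(rg (@component L (@cut L (cut e) (edge (s1 (cut e)) (s1 G h))) (s1 G h))) fE'.
  rewrite -[X in _ = X]/(rg (@component L (@cut L G (edge (s1 G) (s1 G h))) (s1 G h))) eE'.
  exact (etrans (congr1 (@Defs.rg k L) r2) (esym r4)).
- rewrite -[X in X = _]/(ori (@component L (@cut L (cut e) (edge (s1 (cut e)) (s1 G h))) (s1 G h)) :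
    seq {set 'I_(lab G)}) fE'.
  rewrite -[X in _ = X]/(ori (@component L (@cut L G (edge (s1 G) (s1 G h))) (s1 G h)) :
    seq {set 'I_(lab G)}) eE'.
  exact (etrans o2 (esym o4)).
Qed.

Lemma sum_edges G (F : 'I_(lab G) -> k) : prerg G ->
  \sum_(e <- ori G) \sum_(g in e) F g = \sum_(g in hes G | s1 G g != g) F g.
Proof.
move=> pG; under eq_bigr do rewrite big_mkcond.
rewrite exchange_big [RHS]big_mkcond; apply: eq_bigr => g _ /=.
rewrite -big_mkcond /=; case: ifP => [/andP[gH gs]|ng].
  have eG : edge (s1 G) g \in ori G by rewrite edge_ori.
  rewrite (big_rem _ eG) /= !inE eqxx /= big1_seq ?addr0 // => e /andP[ge].
  rewrite mem_rem_uniq ?(pg_uniq pG) // inE => /andP[/eqP ne er]; case: ne.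
  by have [_ _] := ori_mem pG er ge.
rewrite big1_seq // => e /andP[ge er]; have [gH gs _] := ori_mem pG er ge.
by rewrite gH gs in ng.
Qed.

(* [bad h g]: neither of the edges of [h] and [g] is a bridge, but cutting both
   disconnects the graph, with [h] and [g] on the same side. *)
Definition bad G (h g : 'I_(lab G)) : bool :=
  let c := pcl (edge (s1 G) h) (edge (s1 G) g) in
  [&& g \notin edge (s1 G) h, c h == c g, c (s1 G h) == c (s1 G g) & c h != c (s1 G h)].

Lemma badC G (h g : 'I_(lab G)) : prerg G -> h \in hes G -> g \in hes G -> bad h g = bad g h.
Proof.
move=> pG hH gH; rewrite /bad (edge_notin pG hH gH) pclC; congr (_ && _).
move: (pcl _ _) => c; rewrite [c g == _]eq_sym [c (s1 G g) == _]eq_sym.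
by case: eqP => //= ->; case: eqP => //= ->.
Qed.

(** If the edge of [h] becomes a bridge only after the edge of [g] is cut, then with both cut [h]
    and [s1 h] lie apart and each shares its piece with one end of the edge of [g]. Exactly one of
    [g] and [s1 g] is with [h]. *)
Lemma bad_edge G (h g : 'I_(lab G)) : connected_rg G -> h \in hes G -> s1 G h != h ->
  g \in hes G -> s1 G g != g -> h \notin edge (s1 G) g ->
  [&& ~~ is_bridge (edge (s1 G) h), `[< connected_rg (cut (edge (s1 G) g)) >]
    & @is_bridge L (cut (edge (s1 G) g)) (edge (s1 G) h)] = bad h g || bad h (s1 G g)
  /\ ~~ (bad h g && bad h (s1 G g)).
Proof.
move=> cG hH hs gH gs he; have pG := connected_prerg cG.
have stG := pg_st pG; have h'H := st1 stG hH; have g'H := st1 stG gH.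
have ge : g \notin edge (s1 G) h by rewrite (edge_notin pG hH gH).
have eG : edge (s1 G) g \in ori G by rewrite edge_ori.
have pce := cut_prerg pG eG.
have s1E : s1 (cut (edge (s1 G) g)) h = s1 G h by rewrite /= (negPf he).
have fE : edge (s1 (cut (edge (s1 G) g))) h = edge (s1 G) h by rewrite /edge s1E.
have hsc : s1 (cut (edge (s1 G) g)) h != h by rewrite s1E.
have B1 := bridgeP pG hH hs.
have B2 := @bridgeP L (cut (edge (s1 G) g)) h pce hH hsc; rewrite fE s1E in B2.
have C1 := cut_connectedE cG gH gs.
have D1 := cl_pcl pG hH hs gH ge hH h'H.
have D2 := cl_pcl pG gH gs hH he gH g'H.
rewrite pclC in D2; have {}B2 : reflect
    (pcl (edge (s1 G) h) (edge (s1 G) g) h <> pcl (edge (s1 G) h) (edge (s1 G) g) (s1 G h))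
    (@is_bridge L (cut (edge (s1 G) g)) (edge (s1 G) h)) by rewrite pclC.
rewrite /bad (edge_other pG gH) (st1K stG gH) (s1_edge stG hH gH) ge.
move: B1 B2 C1 D1 D2; move: (is_bridge _) (is_bridge _) => b1 b2.
move: (pcl _ _) => c; move: (cl _ _) (cl _ _) => d d' B1 B2 C1 D1 D2 /=; split.
  apply/and3P/orP => [[/B1 nb /asboolP/C1/D2 ce /B2 D]|].
    case/D1: (contrapT nb) => [E|[E1 E2]|[E1 E2]]; first by case: D.
      by left; rewrite E1 -E2 !eqxx /=; apply/eqP; rewrite -E1 E2.
    by right; rewrite E1 -E2 !eqxx /=; apply/eqP; rewrite -E1 E2.
  move=> H; have {H} : exists u v, [/\ c h = u, c (s1 G h) = v, u <> v &
      c g = u /\ c (s1 G g) = v \/ c g = v /\ c (s1 G g) = u].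
    exists (c h), (c (s1 G h)); case: H => /and3P[/eqP E1 /eqP E2 /eqP E3]; split=> //.
      by left.
    by right.
  move=> [u [v [Eh Eh' uv gg]]]; split.
  - apply/B1 => nb; apply: nb; apply/D1; rewrite Eh Eh'.
    by case: gg => -[-> ->]; [apply: Or32|apply: Or33].
  - apply/asboolP/C1/D2; rewrite Eh Eh'.
    by case: gg => -[-> ->]; [apply: Or32|apply: Or33].
  - by apply/B2; rewrite Eh Eh'.
apply/negP => /andP[/and3P[/eqP E1 /eqP E2 /eqP E3] /and3P[/eqP E4 _ _]].
by apply: E3; rewrite E2 -E4.
Qed.

Lemma edge_cut G h (e : {set 'I_(lab G)}) : prerg G -> h \in hes G ->
  h \notin e -> s1 G h \notin e ->
  edge (s1 (cut e)) h = edge (s1 G) h /\ edge (s1 (cut e)) (s1 G h) = edge (s1 G) h.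
Proof.
move=> pG hH he h'e; rewrite /edge /= (negPf he) (negPf h'e) (st1K (pg_st pG) hH).
by split=> //; rewrite setUC.
Qed.

Definition cut_term phi psi G (h g : 'I_(lab G)) : k :=
  if bad h g then osgn (ori G) (edge (s1 G) g :: rem (edge (s1 G) g) (ori G))
    * @lie_term k L phi psi (cut (edge (s1 G) g)) h else 0.

Lemma cut_termE phi psi G (h g : 'I_(lab G)) : connected_rg G ->
  h \in hes G -> s1 G h != h -> g \in hes G -> s1 G g != g -> bad h g ->
  let e := edge (s1 G) g in let f := edge (s1 G) h in
  let A := opiece f e h in let B := opiece f e (s1 G h) in
  perm_eq (ori G) (e :: A ++ f :: B) /\
  cut_term phi psi h g = osgn (ori G) (e :: A ++ f :: B)
    * (phi (rg (piece f e h)) * psi (rg (piece f e (s1 G h)))).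
Proof.
move=> cG hH hs gH gs hg; have pG := connected_prerg cG.
have stG := pg_st pG; move: (hg); rewrite /bad => /and4P[geh _ _ _].
have heg : h \notin edge (s1 G) g by rewrite -(edge_notin pG hH gH).
have [] := bad_edge cG hH hs gH gs heg; rewrite hg => /and3P[_ /asboolP ce br] _.
have s1E : s1 (cut (edge (s1 G) g)) h = s1 G h by rewrite /= (negPf heg).
have h'eg : s1 G h \notin edge (s1 G) g by rewrite (s1_edge stG gH hH).
have [fE fE'] := edge_cut pG hH heg h'eg.
have hsc : s1 (cut (edge (s1 G) g)) h != h by rewrite s1E.
have eG : edge (s1 G) g \in ori G by rewrite edge_ori.
have [r1 o1] := pieceC (edge (s1 G) g) (edge (s1 G) h) h pG.
have [r2 o2] := pieceC (edge (s1 G) g) (edge (s1 G) h) (s1 G h) pG.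
have br' : @is_bridge L (cut (edge (s1 G) g)) (edge (s1 (cut (edge (s1 G) g))) h) by rewrite fE.
have pb := @perm_bridge L (cut (edge (s1 G) g)) h ce hH hsc br'.
have R1 : rg (@side L (cut (edge (s1 G) g)) h) = rg (piece (edge (s1 G) h) (edge (s1 G) g) h).
  rewrite /side fE; exact (congr1 (@Defs.rg k L) r1).
have R2 : rg (@side L (cut (edge (s1 G) g)) (s1 G h))
    = rg (piece (edge (s1 G) h) (edge (s1 G) g) (s1 G h)).
  rewrite /side fE'; exact (congr1 (@Defs.rg k L) r2).
have O1 : @oside L (cut (edge (s1 G) g)) h
    = opiece (edge (s1 G) h) (edge (s1 G) g) h :> seq {set 'I_(lab G)}.
  rewrite /oside /side fE; exact o1.
have O2 : @oside L (cut (edge (s1 G) g)) (s1 G h)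
    = opiece (edge (s1 G) h) (edge (s1 G) g) (s1 G h) :> seq {set 'I_(lab G)}.
  rewrite /oside /side fE'; exact o2.
rewrite s1E fE in pb.
have {}pb : perm_eq (rem (edge (s1 G) g) (ori G)) (opiece (edge (s1 G) h) (edge (s1 G) g) h
    ++ edge (s1 G) h :: opiece (edge (s1 G) h) (edge (s1 G) g) (s1 G h)).
  by rewrite perm_sym -O1 -O2; exact pb.
have ens : edge (s1 G) g \notin rem (edge (s1 G) g) (ori G) by rewrite mem_rem_uniqF ?(pg_uniq pG).
split.
  by apply: perm_trans (perm_to_rem eG) _; rewrite perm_cons; exact pb.
rewrite /cut_term hg.
rewrite (@lie_term_val k L (fun G _ => hes G) (fun G _ => s0 G) (fun G e => cutf (s1 G) e) _
  phi psi G h (edge (s1 G) g) _ _ _ _ pG eG hH hs heg br R1 O1 R2 O2); last first.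
  by move=> G' e' h' h'e'; rewrite /cutf (negPf h'e').
rewrite mulrA; congr (_ * _).
rewrite -(osgn_cons k ens pb) (osgnM k (pg_uniq pG)) ?perm_to_rem ?perm_cons //.
Qed.

(** The pieces are the same whichever of the two edges is cut first. In the orientation the two
    edges trade places, which costs the sign of a transposition. *)
Lemma cut_term_anti phi psi G (h g : 'I_(lab G)) : connected_rg G ->
  h \in hes G -> s1 G h != h -> g \in hes G -> s1 G g != g ->
  cut_term phi psi h g = - cut_term phi psi g h.
Proof.
move=> cG hH hs gH gs; have pG := connected_prerg cG; have stG := pg_st pG.
have [hg|hg] := boolP (bad h g); last first.
  by rewrite /cut_term -(badC pG hH gH) (negPf hg) oppr0.
have gh : bad g h by rewrite -(badC pG hH gH).
have [pb ->] := cut_termE phi psi cG hH hs gH gs hg.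
have [_ ->] := cut_termE phi psi cG gH gs hH hs gh.
have h'H := st1 stG hH; have g'H := st1 stG gH.
have [r1 o1] := pieceC (edge (s1 G) g) (edge (s1 G) h) g pG.
have [r2 o2] := pieceC (edge (s1 G) g) (edge (s1 G) h) (s1 G g) pG.
move: hg; rewrite /bad => /and4P[geh /eqP c1 /eqP c2 _].
have [r3 o3] := piece_eq pG hH hs gH gs geh hH gH c1.
have [r4 o4] := piece_eq pG hH hs gH gs geh h'H g'H c2.
rewrite r1 r2 o1 o2 -r3 -r4 -o3 -o4.
move: pb; move: (edge (s1 G) h) (edge (s1 G) g) => e f.
move: (phi _) (psi _) => x y; move: (opiece _ _ _) (opiece _ _ _) => B A pb.
have uG := pg_uniq pG.
have [sw sgn] := osgn_exchange k (etrans (esym (perm_uniq pb)) uG).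
by rewrite -(osgnM k uG pb sw) sgn mulrN1 mulNr opprK.
Qed.

Lemma op_term_cut phi psi G (h g : 'I_(lab G)) : connected_rg G ->
  h \in hes G -> s1 G h != h -> g \in hes G -> s1 G g != g ->
  (if is_bridge (edge (s1 G) h) then 0 else
   @op_term k L (fun _ _ => true) (fun G _ => hes G) (fun G _ => s0 G)
     (fun G e => cutf (s1 G) e) phi psi G h (edge (s1 G) g))
  = cut_term phi psi h g + cut_term phi psi h (s1 G g).
Proof.
move=> cG hH hs gH gs; have pG := connected_prerg cG; have stG := pg_st pG.
have eE := edge_other pG gH.
have [he|he] := boolP (h \in edge (s1 G) g).
  rewrite /op_term he /cut_term /bad (s1_edge stG hH gH) (edge_notin pG hH gH) he addr0.
  by case: ifP.
have [bE bN] := bad_edge cG hH hs gH gs he.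
have -> : cut_term phi psi h g + cut_term phi psi h (s1 G g)
    = (if bad h g || bad h (s1 G g) then
        osgn (ori G) (edge (s1 G) g :: rem (edge (s1 G) g) (ori G))
         * @lie_term k L phi psi (cut (edge (s1 G) g)) h else 0).
  rewrite /cut_term eE; move: bN; move: (_ * _) => w.
  by case: (bad h g); case: (bad h (s1 G g)); rewrite ?addr0 ?add0r.
rewrite -bE /op_term he; have [br|nbr] := boolP (is_bridge (edge (s1 G) h)); first by [].
rewrite -[RGraph _ _ _ _ _]/(cut (edge (s1 G) g)).
case: asboolP => [ce|_]; last by [].
have fE : edge (s1 (cut (edge (s1 G) g))) h = edge (s1 G) h.
  by apply: (edge_cut pG hH he _).1; rewrite (s1_edge stG gH hH).
have [br2|nbr2] := boolP (@is_bridge L (cut (edge (s1 G) g)) (edge (s1 G) h)); first by [].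
by apply: mulr_eq0r; apply: lie_term_nbridge; rewrite fE.
Qed.

Lemma lie_cut_sum i phi psi (x : RG k L) : ghom i phi -> linear psi ->
  rg_lie phi psi (cut_sum x) = rg_lie (phi \o @cut_sum k L) psi x
    + ksign (i + 1) * rg_lie phi (psi \o @cut_sum k L) x.
Proof.
move=> hphi psi_lin; have [phi_lin _] := hphi; have E_lin := @cut_sum_linear k L.
have phiE : linear (phi \o @cut_sum k L) by move=> c u v; rewrite /= E_lin phi_lin.
have psiE : linear (psi \o @cut_sum k L) by move=> c u v; rewrite /= E_lin psi_lin.
move: x; apply: eq_RG => [c u v|c u v|G cG].
- by rewrite E_lin rg_lie_linear.
- by rewrite (rg_lie_linear phiE psi_lin) (rg_lie_linear phi_lin psiE) -![_ *: _]/(_ * _); ring.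
apply (@lie_edge_sum k L (fun _ _ => true) (fun G _ => hes G) (fun G _ => s0 G)
  (fun G e => cutf (s1 G) e) (cut_edge_op k (@predT_invariant L))).
- move=> G' e h pG' eG'; rewrite /cutf.
  by case: (h \in e); rewrite ?eqxx ?andbF // !andbT.
- by move=> G' e h /negPf he; rewrite /cutf he.
- by [].
- move=> G' e h cG' hH hs br eG _ he eA; split=> [|nc]; first exact: cut_split.
  by apply: rg_nconn => /(cut_splitN cG' hH hs eG he eA).
- move=> phi' psi' G' cG'; have pG := connected_prerg cG'.
  (* Summing over half-edges [g] instead of edges puts both indices in the same set, so that
     antisymmetry can cancel the terms in pairs. *)
  transitivity (\sum_(h in hes G' | s1 G' h != h) \sum_(g in hes G' | s1 G' g != g)
    cut_term phi' psi' h g).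
    apply: eq_bigr => h /andP[hH hs]; rewrite -sum_edges //.
    rewrite big_seq [RHS]big_seq; apply: eq_bigr => e eG.
    have [g [gH gs eE]] := oriP _ pG eG; rewrite eE /edge big_setU1 ?big_set1; last first.
      by rewrite inE eq_sym.
    by rewrite op_term_cut // addrC.
  rewrite -big_filter; under eq_bigr do rewrite -big_filter.
  apply: antisym_sum0 => h; last first.
    by rewrite mem_filter => _; rewrite /cut_term /bad !inE eqxx.
  by move=> g; rewrite !mem_filter => /andP[/andP[hH hs] _] /andP[/andP[gH gs] _]; exact: cut_term_anti.
- exact: hphi.
- exact: psi_lin.
- exact: cG.
Qed.
End LieCut.

(** * The BD algebra *)

Section RibbonBD.
Variables (k : fieldType) (L : Type) (d : int).
Local Notation V := (RGs k L d).
Local Notation c := (2 * d - 5).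

Definition rg_total (phi : V) : V := phi \o @codiff k L.

(** The shift of the dual is even and therefore changes no sign. *)
Let s_even : podd (2 * d - 6) = false.
Proof. by rewrite poddD poddM poddN. Qed.

Lemma RGs_bracket : lie_bracket c (@rg_lie k L : V -> V -> V).
Proof.
split.
- split=> [i|i a x y [xl x0] [yl y0]].
    by split=> // a x y; rewrite scaler0 addr0.
  split=> [b u v|j u ji hu].
    rewrite -![(a *: x + y) _]/(a * x _ + y _) xl yl -![_ *: _]/(_ * _); ring.
  by rewrite -[LHS]/(a * x u + y u) (x0 j) // (y0 j) // mulr0 addr0.
- by rewrite poddD poddM poddN.
- move=> i j x y hx hy; have := rg_lie_hom hx hy.
  congr (ghom _ _); have -> : (5 : int) = 6 - 1 by []; zmod.
- by move=> i j a x y z _ _ _; exact: rg_lie_linl.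
- by move=> i j a x y z _ _ _; exact: rg_lie_linr.
- move=> i j x y hx hy; rewrite [LHS](rg_lie_anti hx hy); congr (_ *: _).
  move: s_even; move: (2 * d - 6) => s es.
  by rewrite !ksignE !poddE es !addbF.
- move=> i j n x y z hx hy hz; rewrite [LHS](rg_lie_jacobi hx hy hz); congr (_ + _ *: _).
  move: s_even; move: (2 * d - 6) => s es.
  by rewrite !ksignE !poddE es !addbF.
Qed.

Lemma comp_degree1 (E : RG k L -> RG k L) : linear E ->
  (forall j x, ghom j x -> ghom (j + 1) (E x)) -> degree1 (fun phi : V => (phi \o E : V)).
Proof.
move=> E_lin E_hom; split=> // i phi [lin phi0].
split=> [a x y|j x ji hx]; first by rewrite /= E_lin lin.
apply: (phi0 (j + 1)); last exact: E_hom.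
apply: contraNneq ji => j1; have -> : j = (j + 1) - 1 by zmod.
by rewrite j1; apply/eqP; zmod.
Qed.

Let P_inv := @same_face_invariant L.

Lemma rg_d_degree1 : degree1 (@rg_d k L : V -> V).
Proof. by apply: comp_degree1; [exact: boundary_linear|exact: boundary_hom]. Qed.

Lemma nabla_degree1 : degree1 (@nabla k L : V -> V).
Proof.
apply: comp_degree1 => [|j x hx]; last exact: cut_hom.
exact: (edge_sum_linear (cut_edge_op k P_inv)).
Qed.

Lemma delta_i_degree1 : degree1 (@delta_i k L : V -> V).
Proof.
have PC := predC_invariant P_inv.
apply: comp_degree1 => [|j x hx]; last exact: cut_hom.
exact: (edge_sum_linear (cut_edge_op k PC)).
Qed.

Lemma rg_total_degree1 : degree1 rg_total.
Proof. by apply: comp_degree1; [exact: codiff_linear|exact: codiff_hom]. Qed.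

Lemma rg_totalE i (phi : V) : ghom i phi -> rg_total phi = - rg_d phi + nabla phi + delta_i phi.
Proof.
case=> phi_lin _; apply/funext => x; rewrite /rg_total /codiff /=.
rewrite -(cut_sum_split x P_inv) (linB phi_lin) (linD phi_lin).
by rewrite -[RHS]/(- (phi _) + phi _ + phi _); zmod.
Qed.

Lemma rg_total_sq i (phi : V) : ghom i phi -> rg_total (rg_total phi) = 0.
Proof.
by case=> phi_lin _; apply/funext => x; rewrite /rg_total /= codiff_sq (lin0 phi_lin).
Qed.

Lemma rg_total_lie i j (phi psi : V) : ghom i phi -> ghom j psi ->
  rg_total (rg_lie phi psi) = rg_lie (rg_total phi) psi + ksign (i + 1) *: rg_lie phi (rg_total psi).
Proof.
move=> hphi hpsi; have [phi_lin _] := hphi; have [psi_lin _] := hpsi.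
have lin := rg_lie_linear phi_lin psi_lin.
have split_total (f : V) : linear f -> rg_total f = -1 *: (f \o @boundary k L : V) + (f \o @cut_sum k L).
  move=> f_lin; apply/funext => x; rewrite /rg_total /codiff /= (linB f_lin).
  by rewrite -[RHS]/(-1 * f _ + f _) mulN1r addrC.
rewrite !split_total // rg_lie_linl rg_lie_linr; apply/funext => x.
rewrite -[LHS]/(-1 * rg_lie phi psi (boundary x) + rg_lie phi psi (cut_sum x)).
have hphi' : @ghom _ (RGdual k L) (i + (2 * d - 6)) phi := hphi.
rewrite (lie_boundary x hphi' psi_lin) (lie_cut_sum x hphi' psi_lin).
have -> : ksign (i + (2 * d - 6) + 1) = ksign (i + 1) :> k.
  by move: s_even; move: (2 * d - 6) => s es; rewrite !ksignE !poddE es !addbF.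
rewrite -[RHS]/((-1 * rg_lie _ _ x + rg_lie _ _ x) + ksign (i + 1) * (-1 * rg_lie _ _ x + rg_lie _ _ x)).
ring.
Qed.

(** [rg_totalE] holds for homogeneous functionals, so it cannot be rewritten inside [der]. Instead,
    both sides are derivations that agree on letters. *)
Lemma der_total s :
  der rg_total s = - @der k V (@rg_d k L) s + @der k V (@nabla k L) s + @der k V (@delta_i k L) s.
Proof.
have V_closed := lb_closed RGs_bracket.
have dt := der_derivation V_closed rg_total_degree1.
have dd := der_derivation V_closed rg_d_degree1.
have dn := der_derivation V_closed nabla_degree1.
have di := der_derivation V_closed delta_i_degree1.
transitivity (-1 *: @der k V (@rg_d k L) s
  + (1 *: @der k V (@nabla k L) s + @der k V (@delta_i k L) s)); last first.
  by rewrite scaleN1r scale1r addrA.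
apply: (eq_derivation dt (derivation_lin (-1) dd (derivation_lin 1 dn di))) => l hl.
rewrite !(der_ltr V_closed) //; [|exact: delta_i_degree1|exact: nabla_degree1|
  exact: rg_d_degree1|exact: rg_total_degree1].
have h1 := proj1 rg_d_degree1 _ _ hl; have h2 := proj1 nabla_degree1 _ _ hl.
have h3 := proj1 delta_i_degree1 _ _ hl.
have h4 : ghom (l.1 + 1) (1 *: nabla l.2 + delta_i l.2 : V) by case: V_closed => _; exact.
rewrite -!ltr_lin // scaleN1r scale1r (rg_totalE hl); congr (ltr (_, _)).
by rewrite addrA.
Qed.
End RibbonBD.

Theorem theoremA (k : fieldType) (k_char0 : [pchar k] =i pred0)
    (Lambda : Type) (d : int) (d_odd : odd `|d|%N) :
  is_BD_algebra (d - 2) (3 - d)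
    (@RG_mul k Lambda d) (@RG_one k Lambda d)
    (@RG_bracket k Lambda d) (@RG_diff k Lambda d).
Proof.
have m_even : podd (3 - d) = false by rewrite poddD poddN /podd d_odd.
(* [zmod] treats numerals as atoms, so 6 is first written as 1 + 5; likewise 5 as 3 + 2 in the next
   equation. *)
have eE : deg_gamma d = 1 - (2 * d - 5) by rewrite /deg_gamma; have -> : (6 : int) = 1 + 5 by []; zmod.
have rE : d - 2 = (3 - d) + (2 * d - 5).
  have -> : (5 : int) = 3 + 2 by []; have -> : 2 * d = d + d by rewrite mulrDl mul1r.
  zmod.
have BD := powser_BD (@RGs_bracket k Lambda d) (@rg_total_degree1 k Lambda d)
  (@rg_total_sq k Lambda d) (@rg_total_lie k Lambda d) m_even eE rE.
have -> : @RG_diff k Lambda d = @ps_diff k (RGs k Lambda d) (2 * d - 5) (3 - d)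
    (@rg_lie k Lambda) (@rg_total k Lambda d) (deg_gamma d).
  by apply/funext => x; apply/funext => n; rewrite /ps_diff der_total.
exact: BD.
Qed.
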